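(* Let $k$ be an algebraically closed field of characteristic $p>0$, and let $X$ be an Artin-Schreier curve over $k$ with equation $y^p-y=f(x)$, where $f(x)\in k(x)$ is a non-constant rational function. Suppose $f(x)$ has exactly $m+1$ poles on $\mathbb{P}^1(k)$ (the point $\infty$ being allowed as a pole), with orders $d_0,\ldots,d_m$, and let $L=\mathrm{LCM}(d_0,\ldots,d_m)$. If $p\equiv 1 \bmod L$, then the $a$-number of $X$ is \[a_X=\sum_{j=0}^{m} a_j,\quad\text{where}\quad a_j=\begin{cases}\dfrac{(p-1)d_j}{4} & \text{if } d_j \text{ is even},\\[2mm] \dfrac{(p-1)(d_j-1)(d_j+1)}{4d_j} & \text{if } d_j \text{ is odd}.\end{cases}\]
   Context: A curve is a smooth projective connected $k$-curve. The Artin-Schreier curve with equation $y^p-y=f(x)$ is the smooth projective connected curve $X$ with function field $k(x)[y]/(y^p-y-f(x))$; it is a $\mathbb{Z}/p$-Galois cover of the projective line with coordinate $x$. It is assumed throughout that $p$ does not divide the order of any pole of $f(x)$ (this is automatic when $p\equiv 1\bmod L$). The $a$-number of $X$ is $a_X=\dim_k \mathrm{Hom}(\alpha_p,\mathrm{Jac}(X)[p])$, where $\alpha_p$ is the kernel of Frobenius on the additive group $\mathbb{G}_a$ over $k$ and $\mathrm{Jac}(X)[p]$ is the $p$-torsion group scheme of the Jacobian of $X$. Equivalently, $a_X$ is the dimension over $k$ of the kernel of the (modified) Cartier operator $\mathcal{C}$ on the space $H^0(X,\Omega^1_X)$ of regular 1-forms, where $\mathcal{C}$ is the additive, $1/p$-linear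 map (i.e. $\mathcal{C}(h^p\omega)=h\,\mathcal{C}(\omega)$ for functions $h$) which takes exact 1-forms to zero and satisfies $\mathcal{C}(h^{p-1}dh)=dh$. *)

(* Defs.v *)
From HB Require Import structures.
From mathcomp Require Import all_boot all_order all_algebra all_field.

Set Implicit Arguments.
Unset Strict Implicit.
Unset Printing Implicit Defensive.

Import GRing.Theory.
Local Open Scope ring_scope.

Notation ratfun k := {fraction {poly k}}.

Definition cst_ratfun (k : fieldType) (c : k) : ratfun k := FracField.tofrac c%:P.

(** A point of P^1(k) is an [option k]; [None] stands for infinity. The value
    does not depend on the representative of the fraction, except for f = 0,
    where it is meaningless (the order should be +oo). *)
Definition ordP1 (k : fieldType) (P : option k) (f : ratfun k) : int :=
  let n := (frac (repr f)).1 in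
  let d := (frac (repr f)).2 in
  match P with
  | Some a => (mup a n)%:Z - (mup a d)%:Z
  | None => (size d)%:Z - (size n)%:Z
  end.

(** [K] is k(x)[y] / (y^p - y - f). *)
Definition is_artin_schreier (k : fieldType) (p : nat) (f : ratfun k)
    (K : fieldExtType (ratfun k)) (y : K) : Prop :=
  minPoly 1%VS y = 'X^p - 'X - (f%:A)%:P /\ <<1; y>>%VS = fullv.

(** A smooth projective connected k-curve is encoded by its function field [K],
    a finite extension of k(x). *)
Section CurveOfFunctionField.

Variables (k : fieldType) (K : fieldExtType (ratfun k)).

Definition cst (c : k) : K := (cst_ratfun c)%:A.

(** The closed points of the curve are the places of K/k; [O] is the local ring
    at the point: a valuation ring of K, other than K, that contains k. Since
    K/k has transcendence degree 1, such a ring is automatically discrete. *)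
Record is_point (O : K -> Prop) : Prop := IsPoint {
  point_cst : forall c : k, O (cst c);
  point_sub : forall a b, O a -> O b -> O (a - b);
  point_mul : forall a b, O a -> O b -> O (a * b);
  point_val : forall a, O a \/ O a^-1;
  point_proper : exists a, ~ O a }.

Record is_derivation (M : lmodType K) (D : K -> M) : Prop := IsDerivation {
  derivation_add : forall a b, D (a + b) = D a + D b;
  derivation_mul : forall a b, D (a * b) = a *: D b + b *: D a;
  derivation_cst : forall c : k, D (cst c) = 0 }.

(** [Omega] with [d] is the module of Kaehler differentials of K/k. *)
Definition is_kaehler (Omega : lmodType K) (d : K -> Omega) : Prop :=
  is_derivation d /\
  forall (M : lmodType K) (D : K -> M), is_derivation D ->
    exists phi : {linear Omega -> M},
      (forall a, phi (d a) = D a) /\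
      (forall psi : {linear Omega -> M},
         (forall a, psi (d a) = D a) -> psi =1 phi).

Section Forms.

Variables (Omega : lmodType K) (d : K -> Omega).

(** The stalk at [O] of the sheaf of 1-forms, inside the module of rational
    1-forms [Omega], is the O-submodule spanned by d(O). *)
Definition regular_at (O : K -> Prop) (w : Omega) : Prop :=
  exists (n : nat) (a b : 'I_n -> K),
    (forall i, O (a i) /\ O (b i)) /\ w = \sum_(i < n) a i *: d (b i).

Definition regular_form (w : Omega) : Prop :=
  forall O : K -> Prop, is_point O -> regular_at O w.

Record is_cartier (p : nat) (C : Omega -> Omega) : Prop := IsCartier {
  cartier_add : forall w1 w2, C (w1 + w2) = C w1 + C w2;
  cartier_scale : forall h w, C (h ^+ p *: w) = h *: C w;
  cartier_exact : forall h, C (d h) = 0;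
  cartier_log : forall h, C (h ^+ p.-1 *: d h) = d h }.

(** The k-vector space [V] of 1-forms has a basis with [n] elements. *)
Definition has_dim (V : Omega -> Prop) (n : nat) : Prop :=
  exists e : 'I_n -> Omega,
    (forall w, V w <-> exists c : 'I_n -> k, w = \sum_(i < n) cst (c i) *: e i) /\
    (forall c : 'I_n -> k, \sum_(i < n) cst (c i) *: e i = 0 -> forall i, c i = 0).

Definition is_a_number (C : Omega -> Omega) (a : nat) : Prop :=
  has_dim (fun w => regular_form w /\ C w = 0) a.

End Forms.

End CurveOfFunctionField.

Definition a_term (p d : nat) : rat :=
  if odd d then ((p%:R - 1) * (d%:R - 1) * (d%:R + 1)) / (4 * d%:R)
  else ((p%:R - 1) * d%:R) / 4.

(* Main.v *)
Require Import Defs.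
From HB Require Import structures.
From mathcomp Require Import all_boot all_order all_algebra all_field.
From mathcomp Require Import zify ring.
From Stdlib Require Import Classical.

(** Every rational form on the curve is h dx for a unique h in K, and h is a sum of
    monomials g_r y^r with r < p and g_r in k(x). The proof turns regularity and
    the vanishing of the Cartier operator into conditions on the coordinates
    g_r, and then counts dimensions.

    Regularity. Let d be the order of a pole Q of f, and gam = (p - 1) / d. As p
    does not divide d, there is one point above Q; there y has a pole of order d,
    the orders of the monomials g_r y^r are distinct modulo p, and the different
    has exponent (p - 1) (d + 1). So a regular form has coordinates with
    poles of order at most d - floor(r / gam) at Q, relative to dt for a
    uniformizer t at Q ([ramified_bound]). Over any other Q the curve is
    unramified, and g_r dx is regular there ([unramified_bound]). Conversely,
    these bounds imply regularity at every point ([regular_at_ramified],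
    [regular_at_unramified]): each point lies above a Q ([point_center]), and
    t y^gam is a uniformizer at the ramified points. So g_r ranges over a
    Riemann-Roch space of the projective line.

    Kernel. Since y = y^p - f, the form h dx is the sum of the y^(p l) A_l dx with
    A_l the sum over r of binomial(r, l) (- f)^(r - l) g_r. It is killed by
    the operator iff each A_l dx is ([cartier_ker]), and for a form on the
    projective line this is a condition on every p-th coefficient of a
    numerator. In particular, such a form has no order -1 modulo p
    ([exactF_order]).

    Upper bound. A kernel element vanishes if, beyond the previous bounds, the poles of
    its coordinates have order at most floor(r / gam) + 1, or two less at infinity
    ([low_kernel_zero]): the leading term of its top coordinate at a pole would
    give some A_l dx the order -1 modulo p. So the kernel embeds in the
    quotient of two Riemann-Roch spaces, of dimension the sum over the poles
    and over r < p of the positive part of d - 1 - 2 floor(r / gam).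

    Lower bound. For forms of degree less than (p - 1) / 2 in y, the poles of the
    A_l bound the number of coefficients that have to vanish. The number of
    parameters minus the number of these conditions is the same sum
    ([kernel_count_le]). Both bounds are combined in [squeeze_dim], and the sum is
    evaluated in [kernel_countE].

    The spaces of coordinates are required to vanish to order 1 at infinity, so
    that their dimensions are degrees of divisors. If f is regular at infinity,
    this admits forms with a simple pole there, but the kernel condition
    excludes them ([infinity_order]). *)


Set Implicit Arguments.
Unset Strict Implicit.
Unset Printing Implicit Defensive.

Import Order.TTheory GRing.Theory Num.Theory.
Local Open Scope ring_scope.

(** * Places with a derivation *)

(** The order of 0 counts as infinite, whatever value v takes there. *)
Definition vge (F : fieldType) (v : F -> int) (n : int) (g : F) : bool :=
  (g == 0) || (n <= v g).

(** What the proof uses about the places of k(x): the residue field is k, and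
    differentiation with respect to the uniformizer t preserves the valuation
    ring. Finite points and infinity share this interface. *)
Record is_place (k F : fieldType) (iota : {rmorphism k -> F}) (D : F -> F)
    (v : F -> int) (t : F) : Prop := IsPlace {
  place_t : t != 0 /\ v t = 1;
  placeM : forall g h, g != 0 -> h != 0 -> v (g * h) = v g + v h;
  placeD : forall n g h, vge v n g -> vge v n h -> vge v n (g + h);
  place_cst : forall c, c != 0 -> v (iota c) = 0;
  place_res : forall g, vge v 0 g -> exists c, vge v 1 (g - iota c);
  place_derD : forall g h, D (g + h) = D g + D h;
  place_derM : forall g h, D (g * h) = g * D h + h * D g;
  place_derC : forall c, D (iota c) = 0;
  place_dert : D t != 0;
  place_der : forall g, vge v 0 g -> vge v 0 (D g / D t) }.

Section Place.

Variables (k F : fieldType) (iota : {rmorphism k -> F}) (D : F -> F).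
Variables (v : F -> int) (t : F).
Hypothesis vP : is_place iota D v t.

Notation ge := (vge v).
Notation del := (fun g => D g / D t).

Let t0 : t != 0. Proof. by case: (place_t vP). Qed.
Let vt : v t = 1. Proof. by case: (place_t vP). Qed.

Lemma vge0 n : ge n 0. Proof. by rewrite /vge eqxx. Qed.

Lemma vgeE n g : g != 0 -> ge n g = (n <= v g).
Proof. by rewrite /vge => /negbTE ->. Qed.

Lemma vge_v g : ge (v g) g. Proof. by rewrite /vge lexx orbT. Qed.

Lemma vge_le m n g : m <= n -> ge n g -> ge m g.
Proof. by rewrite /vge => mn /orP[->//|/(le_trans mn) ->]; rewrite orbT. Qed.

Lemma vge_cst c : ge 0 (iota c).
Proof.
have [->|c0] := eqVneq c 0; first by rewrite rmorph0 vge0.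
by rewrite /vge (place_cst vP) // lexx orbT.
Qed.

Lemma v1 : v 1 = 0.
Proof. by rewrite -(rmorph1 iota) (place_cst vP) ?oner_eq0. Qed.

Lemma vge1 : ge 0 1. Proof. by rewrite -(rmorph1 iota) vge_cst. Qed.

Lemma vgeM m n g h : ge m g -> ge n h -> ge (m + n) (g * h).
Proof.
have [->|g0] := eqVneq g 0; first by rewrite mul0r !vge0.
have [->|h0] := eqVneq h 0; first by rewrite mulr0 !vge0.
by rewrite !vgeE ?mulf_neq0 // (placeM vP) // => *; lia.
Qed.

Lemma vge0M n g h : ge 0 g -> ge n h -> ge n (g * h).
Proof. by move=> gg hh; rewrite -(add0r n) vgeM. Qed.

Lemma vgeX n g i : ge n g -> ge (n *+ i) (g ^+ i).
Proof.
move=> gg; elim: i => [|i IH]; first by rewrite expr0 mulr0n vge1.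
by rewrite exprS mulrS vgeM.
Qed.

Lemma vgeD n g h : ge n g -> ge n h -> ge n (g + h). Proof. exact: (placeD vP). Qed.

Lemma vgeN n g : ge n (- g) = ge n g.
Proof.
suff H h : ge n h -> ge n (- h) by apply/idP/idP => /H //; rewrite opprK.
move=> hh; rewrite -mulN1r -(rmorphN1 iota); exact: vge0M (vge_cst _) hh.
Qed.

Lemma vgeB n g h : ge n g -> ge n h -> ge n (g - h).
Proof. by move=> gg hh; rewrite vgeD ?vgeN. Qed.

Lemma vge_sum (I : Type) (r : seq I) (P : pred I) n (E : I -> F) :
  (forall i, P i -> ge n (E i)) -> ge n (\sum_(i <- r | P i) E i).
Proof.
move=> H; elim/big_ind: _ => //; first exact: vge0.
by move=> *; apply: vgeD.
Qed.

Lemma vge_nat i : ge 0 i%:R.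
Proof. by rewrite -(rmorph_nat iota) vge_cst. Qed.

Lemma vge_natr n g i : ge n g -> ge n (g *+ i).
Proof. by move=> gg; rewrite -mulr_natl vge0M ?vge_nat. Qed.

Lemma vV g : g != 0 -> v g^-1 = - v g.
Proof.
move=> g0; have := placeM vP g0 (invr_neq0 g0).
by rewrite divff // v1; lia.
Qed.

Lemma vX g i : g != 0 -> v (g ^+ i) = v g *+ i.
Proof.
move=> g0; elim: i => [|i IH]; first by rewrite expr0 v1.
by rewrite exprS (placeM vP) ?expf_neq0 // mulrS IH.
Qed.

Lemma vN g : v (- g) = v g.
Proof.
have [->|g0] := eqVneq g 0; first by rewrite oppr0.
rewrite -mulN1r (placeM vP) ?oppr_eq0 ?oner_eq0 //.
by rewrite -(rmorphN1 iota) (place_cst vP) ?oppr_eq0 ?oner_eq0 ?add0r.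
Qed.

Lemma vge_monomial g h (i r s : nat) : g != 0 -> h != 0 ->
  0 <= i%:Z * v g + (r%:Z - s%:Z) * v h -> ge 0 (g ^+ i * h ^+ r / h ^+ s).
Proof.
move=> g0 h0; have [gi hr hs] : [/\ g ^+ i != 0, h ^+ r != 0 & h ^+ s != 0].
  by split; apply: expf_neq0.
rewrite vgeE ?mulf_neq0 ?invr_eq0 //.
rewrite !(placeM vP) ?mulf_neq0 ?invr_eq0 // vV // !vX // !pmulrn !mulrzz.
by rewrite mulrBl addrA ![_%:Z * _]mulrC.
Qed.

(** The ultrametric inequality is sharp when one of the two orders is strictly
    least; this isolates leading terms. *)
Lemma v_addr g h : g != 0 -> ge (v g + 1) h -> g + h != 0 /\ v (g + h) = v g.
Proof.
move=> g0 hh.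
have N : ~~ ge (v g + 1) (g + h).
  apply/negP => H; have := vgeB H hh; rewrite addrK vgeE //; lia.
have n0 : g + h != 0 by apply: contraNneq N => ->; rewrite vge0.
split=> //; move: N; rewrite vgeE //.
have : ge (v g) (g + h) by rewrite vgeD ?vge_v // (vge_le _ hh) //; lia.
by rewrite vgeE //; lia.
Qed.

Lemma der0 : D 0 = 0.
Proof. by rewrite -[X in D X](rmorph0 iota) (place_derC vP). Qed.

Lemma derX g i : D (g ^+ i) = i%:R * g ^+ i.-1 * D g.
Proof.
elim: i => [|i IH]; first by rewrite expr0 -(rmorph1 iota) (place_derC vP) !mul0r.
rewrite exprS (place_derM vP) IH /=; case: i {IH} => [|i] /=; first by ring.
by rewrite exprS -[i.+2%:R]natr1; ring.
Qed.

(** A function is t^n times a regular function u, and the derivative of t^n u is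
    n t^(n - 1) u plus t^n times a regular function. *)
Lemma vge_del n g : ge n g -> ge (n - 1) (del g).
Proof.
move=> gg.
have vX' i : ge i%:Z (t ^+ i) by rewrite vgeE ?expf_neq0 // vX // vt; lia.
have vXn i : ge (- i%:Z) (t ^- i).
  by rewrite vgeE ?invr_neq0 ?expf_neq0 // vV ?expf_neq0 // vX // vt; lia.
have t1 : D t != 0 := place_dert vP.
case: n gg => n gg.
  have -> : g = t ^+ n * (g / t ^+ n) by rewrite mulrCA divff ?expf_neq0 ?mulr1.
  have ug : ge 0 (g / t ^+ n) by rewrite -(subrr n%:Z) vgeM.
  set u := g / _ in ug *.
  have -> : D (t ^+ n * u) / D t = t ^+ n * del u + n%:R * t ^+ n.-1 * u.
    by rewrite (place_derM vP) derX; field.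
  apply: vgeD.
    by apply: vgeM (vX' n) _; apply: vge_le (place_der vP ug).
  clearbody u; case: n {gg} => [|n]; first by rewrite !mul0r vge0.
  rewrite -(addr0 (_ - _)); apply: vgeM ug.
  by apply: vge0M (vge_nat _) _; apply: vge_le (vX' _) => /=; lia.
have ug : ge 0 (t ^+ n.+1 * g) by rewrite -(subrr n.+1%:Z) vgeM // -NegzE.
set u := t ^+ n.+1 * g in ug.
have -> : del g = (del u - n.+1%:R * t^-1 * u) / t ^+ n.+1.
  by rewrite /u (place_derM vP) derX exprS /=; field; rewrite t1 t0 expf_neq0.
have -> : Negz n - 1 = - 1 + - (n.+1%:Z) by rewrite NegzE addrC.
apply: vgeM (vXn _); apply: vgeB.
  by apply: vge_le (place_der vP ug).
rewrite -(addr0 (-1)); apply: vgeM ug; apply: vge0M (vge_nat _) _.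
by have := vXn 1%N; rewrite expr1.
Qed.

(** The derivative of u t^(- d) has the leading term - d u t^(- d - 1), which does
    not vanish because d is prime to the characteristic. *)
Lemma v_del_pole d g : g != 0 -> v g = - d%:Z -> d%:R != 0 :> k ->
  del g != 0 /\ v (del g) = - (d.+1)%:Z.
Proof.
move=> g0 vg d0.
have dF : d%:R != 0 :> F by rewrite -(rmorph_nat iota) fmorph_eq0.
have td0 : t ^+ d != 0 by rewrite expf_neq0.
have vtd : v (t ^+ d) = d%:Z by rewrite vX // vt; lia.
have t1 : D t != 0 := place_dert vP.
case: d => [|d] in vg d0 dF td0 vtd *; first by rewrite eqxx in d0.
have ug : ge 0 (t ^+ d.+1 * g).
  by rewrite -(subrr d.+1%:Z) vgeM // ?vgeE // ?vtd ?vg.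
set u := t ^+ d.+1 * g in ug.
have eqd : del g = (- (d.+1%:R * t^-1 * u) + del u) / t ^+ d.+1.
  by rewrite /u (place_derM vP) derX exprS /=; field; rewrite t1 t0 expf_neq0.
set h := d.+1%:R * t^-1 * u in eqd.
have u0 : u != 0 by rewrite mulf_neq0.
have h0 : h != 0 by rewrite !mulf_neq0 ?invr_neq0.
have vh : v h = - 1.
  rewrite !(placeM vP) ?mulf_neq0 ?invr_neq0 // vV // vt vtd vg.
  by rewrite -(rmorph_nat iota) (place_cst vP) //; lia.
have [] := @v_addr (- h) (del u); first by rewrite oppr_eq0.
  by rewrite vN vh; apply: (place_der vP).
rewrite vN vh => n0 vn; rewrite eqd mulf_neq0 ?invr_neq0 //; split=> //.
by rewrite (placeM vP) ?invr_neq0 // vn vV // vtd; lia.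
Qed.

(** For a root y of y^p - y = g, the derivative of t y^gam is
    - b y^(gam - 1) (1 - (D t / b) y). The p-th power of (D t / b) y is
    (D t / b)^p g up to a unit, so the third claim makes the last factor a unit.
    The fourth claim compares denominators D t and b. *)
Lemma del_unif d gam g : g != 0 -> v g = - d%:Z -> (0 < d)%N ->
  d%:R != 0 :> k -> gam%:R != 0 :> k ->
  let b := gam%:R * t * D g in
  [/\ b != 0, D g != 0,
      forall p, (1 < p)%N -> ge 1 ((D t / b) ^+ p * g) &
      forall n c, ge n (c / D t) -> ge (n + d%:Z) (c / b)].
Proof.
move=> g0 vg dpos d0 gam0 b; have [df0 vdf] := v_del_pole g0 vg d0.
have t1 : D t != 0 := place_dert vP.
have Dg0 : D g != 0 by apply: contraNneq df0 => ->; rewrite mul0r.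
have gamF : gam%:R != 0 :> F by rewrite -(rmorph_nat iota) fmorph_eq0.
have b0 : b != 0 by rewrite !mulf_neq0.
have bV0 : D t / b != 0 by rewrite mulf_neq0 ?invr_eq0.
have vb : v (D t / b) = d%:Z.
  have -> : D t / b = (gam%:R * t * (D g / D t))^-1.
    by rewrite /b; field; rewrite t1 Dg0 gamF t0.
  have gt0 : gam%:R * t != 0 by rewrite mulf_neq0.
  rewrite vV; last exact: mulf_neq0 gt0 df0.
  rewrite (placeM vP gt0 df0) (placeM vP gamF t0) vt vdf.
  by rewrite -(rmorph_nat iota) (place_cst vP) //; lia.
split=> // [p p1|n c Hc].
  rewrite vgeE ?mulf_neq0 ?expf_neq0 // (placeM vP) ?expf_neq0 // vX // vb vg.
  by rewrite pmulrn mulrzz; nia.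
have -> : c / b = c / D t * (D t / b) by rewrite mulrA divfK.
by rewrite -vb; apply: vgeM Hc (vge_v _).
Qed.

End Place.

(** * The field k(x) and its places *)

Notation "q %:F" := (FracField.tofrac q) : ring_scope.

(* Abstracts the sizes in the goal, whose implicit structures may differ. *)
Ltac size_lia :=
  repeat match goal with |- context [@size ?T ?s] => move: (@size T s) => ? end;
  lia.

Arguments ordP1 : simpl never.

Section RatFun.

Variable k : fieldType.
Implicit Types (n : int) (g h : ratfun k) (N M : {poly k}) (Q : option k).

Definition cstF : {rmorphism k -> ratfun k} :=
  (@FracField.tofrac {poly k} \o polyC : {rmorphism k -> ratfun k}).

Lemma ratfun_repr g : g = (frac (repr g)).1%:F / (frac (repr g)).2%:F.
Proof.
have d0 : (frac (repr g)).2 != 0 by exact: denom_ratioP.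
apply: (mulIf (x := (frac (repr g)).2%:F)); first by rewrite tofrac_eq0.
rewrite mulfVK ?tofrac_eq0 // -{1}[g]reprK; move: (repr g) d0 => x d0.
rewrite !piE; apply/eqmodP => /=; rewrite FracField.equivfE /FracField.mulf /=.
by rewrite !numden_Ratio ?oner_eq0 ?mulf_neq0 ?oner_eq0 // !mulr1 mulrC.
Qed.

Lemma ratfunP g : exists N M, M != 0 /\ g = N%:F / M%:F.
Proof.
exists (frac (repr g)).1, (frac (repr g)).2; rewrite -ratfun_repr.
by split=> //; exact: denom_ratioP.
Qed.

Lemma eq_frac N M N' M' : M != 0 -> M' != 0 ->
  (N%:F / M%:F == N'%:F / M'%:F) = (N * M' == N' * M).
Proof. by move=> M0 M'0; rewrite eqr_div ?tofrac_eq0 // -!rmorphM /= tofrac_eq. Qed.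

Lemma frac_neq0 N M : N != 0 -> M != 0 -> N%:F / M%:F != 0.
Proof. by move=> *; rewrite mulf_neq0 ?invr_neq0 ?tofrac_eq0. Qed.

(** At infinity the order is minus the degree. The value at the zero polynomial
    is meaningless. *)
Definition ordp Q N : int :=
  if Q is Some a then (mup a N)%:Z else 1 - (size N)%:Z.

Lemma ordpM Q N M : N != 0 -> M != 0 -> ordp Q (N * M) = ordp Q N + ordp Q M.
Proof.
move=> N0 M0; case: Q => [a|] /=; first by rewrite mupM.
by move: (N0) (M0); rewrite size_mul // -!size_poly_gt0; size_lia.
Qed.

Lemma ordpC Q c : c != 0 -> ordp Q c%:P = 0.
Proof.
by move=> c0; case: Q => [a|] /=; rewrite ?size_polyC ?c0 // mupNroot // rootC.
Qed.

Lemma ordp_ge_add Q n N M : N != 0 -> M != 0 -> N + M != 0 ->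
  n <= ordp Q N -> n <= ordp Q M -> n <= ordp Q (N + M).
Proof.
move=> N0 M0 S0; case: Q => [a|] /=.
  case: n => n; last by lia.
  by rewrite !lez_nat !mup_geq //; apply: dvdp_add.
by have := size_polyD N M; size_lia.
Qed.

(** Orders of polynomials are additive, so that the choice of a representative in
    the definition of the order of a fraction does not matter. *)
Lemma ordP1E Q N M : N != 0 -> M != 0 ->
  ordP1 Q (N%:F / M%:F) = ordp Q N - ordp Q M.
Proof.
move=> N0 M0; set g := _ / _.
have g0 : g != 0 by rewrite frac_neq0.
have d0 : (frac (repr g)).2 != 0 by exact: denom_ratioP.
have gE := ratfun_repr g.
have n0 : (frac (repr g)).1 != 0.
  by apply: contraNneq g0 => n0; rewrite gE n0 tofrac0 mul0r.
have -> : ordP1 Q g = ordp Q (frac (repr g)).1 - ordp Q (frac (repr g)).2.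
  by rewrite /ordP1 /ordp; case: Q => //; size_lia.
move/eqP: gE; rewrite eq_frac // => /eqP /(congr1 (ordp Q)).
rewrite !ordpM // => E.
by rewrite -[ordp Q N](addrK (ordp Q (frac (repr g)).2)) E addrAC addrK.
Qed.

Lemma frac_add N M N' M' : M != 0 -> M' != 0 ->
  N%:F / M%:F + N'%:F / M'%:F = (N * M' + N' * M)%:F / (M * M')%:F.
Proof. by move=> M0 M'0; rewrite addf_div ?tofrac_eq0 // !(rmorphM, rmorphD). Qed.

Lemma frac_mul N M N' M' :
  N%:F / M%:F * (N'%:F / M'%:F) = (N * N')%:F / (M * M')%:F.
Proof. by rewrite mulf_div !rmorphM. Qed.

Lemma frac_ge Q n N M : M != 0 ->
  vge (ordP1 Q) n (N%:F / M%:F) = (N == 0) || (n + ordp Q M <= ordp Q N).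
Proof.
move=> M0; have [->|N0] := eqVneq N 0; first by rewrite tofrac0 mul0r /vge eqxx.
by rewrite /vge (negbTE (frac_neq0 _ _)) // ordP1E //= lerBrDr.
Qed.

Lemma ordP1M Q g h : g != 0 -> h != 0 ->
  ordP1 Q (g * h) = ordP1 Q g + ordP1 Q h.
Proof.
have [N [M [M0 ->]]] := ratfunP g; have [N' [M' [M'0 ->]]] := ratfunP h.
rewrite !mulf_eq0 !invr_eq0 !tofrac_eq0 !negb_or => /andP[N0 _] /andP[N'0 _].
by rewrite frac_mul !ordP1E ?mulf_neq0 // !ordpM // opprD addrACA.
Qed.

Lemma ordP1D Q n g h :
  vge (ordP1 Q) n g -> vge (ordP1 Q) n h -> vge (ordP1 Q) n (g + h).
Proof.
have [N [M [M0 ->]]] := ratfunP g; have [N' [M' [M'0 ->]]] := ratfunP h.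
have -> : N%:F / M%:F = (N * M')%:F / (M * M')%:F.
  by apply/eqP; rewrite eq_frac ?mulf_neq0 //; apply/eqP; ring.
have -> : N'%:F / M'%:F = (N' * M)%:F / (M * M')%:F.
  by apply/eqP; rewrite eq_frac ?mulf_neq0 //; apply/eqP; ring.
rewrite -mulrDl -rmorphD /= !frac_ge ?mulf_neq0 //.
move: (N * M') (N' * M) (M * M') => A B D.
have [->|A0] := eqVneq A 0; first by rewrite add0r.
have [->|B0] := eqVneq B 0; first by rewrite addr0 (negbTE A0).
by have [//|S0] := eqVneq (A + B) 0 => /= ? ?; apply: ordp_ge_add.
Qed.

Lemma frac_regular a g : vge (ordP1 (Some a)) 0 g ->
  exists N M, M.[a] != 0 /\ g = N%:F / M%:F.
Proof.
have [->|g0] := eqVneq g 0.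
  by exists 0, 1; rewrite hornerC oner_eq0 tofrac0 mul0r.
have [N [M [M0 gE]]] := ratfunP g; rewrite gE in g0 *.
have N0 : N != 0 by apply: contraNneq g0 => ->; rewrite tofrac0 mul0r.
rewrite frac_ge // (negbTE N0) /= add0r lez_nat mup_geq // => /dvdpP[N1 NE].
have [m [M1]] := multiplicity_XsubC M a; rewrite M0 /= => M1a ME.
have mE : mup a M = m by rewrite ME mupMr // mup_XsubCX eqxx.
exists N1, M1; split=> //; apply/eqP; rewrite eq_frac //; last first.
  by apply: contraNneq M1a => ->; rewrite root0.
by rewrite NE mE ME; apply/eqP; ring.
Qed.

Lemma mup_ge1 a N : N != 0 -> N.[a] = 0 -> 1 <= (mup a N)%:Z.
Proof. by move=> N0 Na; rewrite lez_nat mup_geq // expr1 dvdp_XsubCl; apply/eqP. Qed.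

(** The residue is the value at a finite point, and the quotient of the leading
    coefficients, or 0, at infinity. *)
Lemma ordP1_residue Q g : vge (ordP1 Q) 0 g ->
  exists c, vge (ordP1 Q) 1 (g - cstF c).
Proof.
have H N M c : M != 0 -> N%:F / M%:F - cstF c = (N - c *: M)%:F / M%:F.
  move=> M0; rewrite rmorphB /= -mul_polyC rmorphM /= mulrBl.
  by rewrite mulfK ?tofrac_eq0.
case: Q => [a|].
  move=> /frac_regular[N [M [Ma ->]]].
  have M0 : M != 0 by apply: contraNneq Ma => ->; rewrite horner0.
  exists (N.[a] / M.[a]); rewrite H // frac_ge //.
  have [//|S0] := eqVneq; rewrite /= [mup a M]mupNroot // addr0.
  by apply: mup_ge1 => //; rewrite !hornerE mulfVK ?subrr.
have [N [M [M0 ->]]] := ratfunP g; rewrite frac_ge //= => NM.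
exists (N`_(size M).-1 / lead_coef M); rewrite H // frac_ge //.
set c := _ / _; have sM : (0 < size M)%N by rewrite size_poly_gt0.
have [|S0 /=] := eqVneq; first by [].
suff : (size (N - c *: M)%R <= (size M).-1)%N by move: sM; size_lia.
apply/leq_sizeP => j; rewrite leq_eqVlt => /orP[/eqP <-|jM].
  by rewrite coefB coefZ -lead_coefE mulfVK ?subrr // lead_coef_eq0.
rewrite coefB coefZ [M`_j]nth_default; last by move: sM jM; size_lia.
rewrite mulr0 subr0 nth_default //.
by move: NM sM jM; have [->|_ /=] := eqVneq N 0; rewrite ?size_poly0; size_lia.
Qed.

(** The quotient rule for d/dx, on the representative of the fraction. *)
Definition der g : ratfun k :=
  let N := (frac (repr g)).1 in let M := (frac (repr g)).2 in
  (N^`() * M - N * M^`())%:F / (M ^+ 2)%:F.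

Lemma derE N M : M != 0 ->
  der (N%:F / M%:F) = (N^`() * M - N * M^`())%:F / (M ^+ 2)%:F.
Proof.
move=> M0; rewrite /der.
have := ratfun_repr (N%:F / M%:F); move: (repr _) (denom_ratioP (repr (N%:F / M%:F))).
case=> [[n d] /= d0] _ /eqP; rewrite eq_frac // => /eqP E1.
have := congr1 deriv E1; rewrite !derivM => E2.
apply/eqP; rewrite eq_frac ?expf_neq0 // -subr_eq0; apply/eqP.
transitivity (- (d * M) * (N^`() * d + N * d^`() - (n^`() * M + n * M^`()))
   + (d^`() * M + d * M^`()) * (N * d - n * M)); first by ring.
by rewrite E1 E2 !subrr !mulr0 addr0.
Qed.

Lemma der_poly N : der N%:F = N^`()%:F.
Proof.
have := derE N (oner_neq0 _); rewrite rmorph1 divr1 => ->.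
by rewrite derivC mulr0 subr0 mulr1 expr1n rmorph1 divr1.
Qed.

Lemma der_cst c : der (cstF c) = 0.
Proof. by rewrite der_poly derivC rmorph0. Qed.

Lemma derX1 : der 'X%:F = 1.
Proof. by rewrite der_poly derivX rmorph1. Qed.

Lemma derD g h : der (g + h) = der g + der h.
Proof.
have [N [M [M0 ->]]] := ratfunP g; have [N' [M' [M'0 ->]]] := ratfunP h.
rewrite frac_add // !derE ?mulf_neq0 // frac_add ?expf_neq0 //.
apply/eqP; rewrite eq_frac ?mulf_neq0 ?expf_neq0 // !(derivM, derivD).
by apply/eqP; ring.
Qed.

Lemma derM g h : der (g * h) = g * der h + h * der g.
Proof.
have [N [M [M0 ->]]] := ratfunP g; have [N' [M' [M'0 ->]]] := ratfunP h.
rewrite frac_mul !derE ?mulf_neq0 // !frac_mul frac_add ?mulf_neq0 ?expf_neq0 //.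
apply/eqP; rewrite eq_frac ?mulf_neq0 ?expf_neq0 // !(derivM, derivD).
by apply/eqP; ring.
Qed.

Definition unifP1 Q : ratfun k :=
  if Q is Some a then ('X - a%:P)%:F else 'X%:F^-1.

Lemma X_neq0 : 'X%:F != 0 :> ratfun k.
Proof. by rewrite tofrac_eq0 polyX_eq0. Qed.

Lemma der_unif Q : der (unifP1 Q) = if Q is Some _ then 1 else - 'X%:F ^- 2.
Proof.
case: Q => [a|]; first by rewrite der_poly derivXsubC rmorph1.
have := derE 1 (negbT (polyX_eq0 k)); rewrite rmorph1 mul1r => ->.
rewrite derivC derivX mul0r sub0r mulr1 rmorphN rmorph1 rmorphXn /=.
by rewrite mulNr mul1r.
Qed.

Lemma ordP1_unif Q : unifP1 Q != 0 /\ ordP1 Q (unifP1 Q) = 1.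
Proof.
case: Q => [a|] /=.
  rewrite tofrac_eq0 polyXsubC_eq0; split=> //.
  have -> : ('X - a%:P)%:F = (('X - a%:P) ^+ 1)%:F / 1%:F by rewrite rmorph1 divr1.
  rewrite (@ordP1E (Some a)) ?oner_eq0 ?expf_neq0 ?polyXsubC_eq0 //= mup_XsubCX eqxx.
  by rewrite mupNroot ?root1.
split; first by rewrite invr_neq0 ?X_neq0.
have -> : 'X%:F^-1 = 1%:F / 'X%:F :> ratfun k by rewrite rmorph1 mul1r.
by rewrite (@ordP1E None) ?oner_eq0 ?polyX_eq0 //= size_poly1 size_polyX.
Qed.

Lemma ordP1_cst Q c : c != 0 -> ordP1 Q (cstF c) = 0.
Proof.
move=> c0; rewrite /= -[_%:F]divr1 -(rmorph1 (@FracField.tofrac {poly k})).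
by rewrite ordP1E ?polyC_eq0 ?oner_eq0 // ordpC // -[1]/(1%:P) ordpC ?oner_eq0.
Qed.

(** At infinity the derivative with respect to 1/x is - x^2 d/dx. Once the residue
    is subtracted, the numerator has a smaller degree than the denominator, and
    the degree of g drops by at least 1 under d/dx. *)
Lemma ordP1_der Q g :
  vge (ordP1 Q) 0 g -> vge (ordP1 Q) 0 (der g / der (unifP1 Q)).
Proof.
rewrite der_unif; case: Q => [a|].
  move=> /frac_regular[N [M [Ma ->]]].
  have M0 : M != 0 by apply: contraNneq Ma => ->; rewrite horner0.
  rewrite divr1 derE // frac_ge ?expf_neq0 // add0r /= [mup a (M ^+ 2)]mupNroot.
    by rewrite lez_nat orbT.
  by rewrite /root horner_exp expf_neq0.
move=> /ordP1_residue[c].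
have -> : der g = der (g - cstF c).
  by rewrite -[LHS]addr0 -(der_cst (- c)) -derD rmorphN.
move: (g - _) => {}g; have [N [M [M0 ->]]] := ratfunP g.
have -> : der (N%:F / M%:F) / - 'X%:F ^- 2 =
    (- ((N^`() * M - N * M^`()) * 'X ^+ 2))%:F / (M ^+ 2)%:F.
  have XM A : (- (A * 'X ^+ 2))%:F = - (A%:F * 'X%:F ^+ 2) :> ratfun k.
    by rewrite tofracN tofracM tofracXn.
  by rewrite derE // invrN mulrN invrK XM mulNr mulrAC.
rewrite !frac_ge ?expf_neq0 //= => H; set A := _ - _.
rewrite oppr_eq0 size_polyN; have [//|S0] := eqVneq; rewrite orFb.
have A0 : A != 0 by apply: contraNneq S0 => ->; rewrite mul0r.
rewrite [size (M ^+ 2)]size_mul // size_mulXn //; have sM : (0 < size M)%N by rewrite size_poly_gt0.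
have s1 : (size A <= maxn (size (N^`() * M)%R) (size (N * M^`())%R))%N.
  by rewrite (leq_trans (size_polyD _ _)) // size_polyN.
have s2 := size_polyMleq N^`() M; have s3 := size_polyMleq N M^`().
have N0 : N != 0 by apply: contraNneq A0 => N0; rewrite /A N0 deriv0 !mul0r subrr.
have s4 := lt_size_deriv N0; have s5 := lt_size_deriv M0.
move: H s1 s2 s3 s4 s5 sM; rewrite (negbTE N0) orFb; size_lia.
Qed.

Lemma ordP1_place Q : is_place cstF der (ordP1 Q) (unifP1 Q).
Proof.
split.
- exact: ordP1_unif.
- exact: ordP1M.
- exact: ordP1D.
- exact: ordP1_cst.
- exact: ordP1_residue.
- exact: derD.
- exact: derM.
- exact: der_cst.
- by rewrite der_unif; case: Q => [a|]; rewrite ?oner_eq0 // oppr_eq0 invr_neq0 ?expf_neq0 ?X_neq0.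
- exact: ordP1_der.
Qed.

(** The order of the form dx at a point is the opposite of this number: at
    infinity d(1/x) = - x^(-2) dx, and dx has a double pole. *)
Lemma ord_der_unif Q : ordP1 Q (der (unifP1 Q)) = if Q is None then 2 else 0.
Proof.
rewrite der_unif; case: Q => [a|]; first exact: (v1 (ordP1_place (Some a))).
have [t0 vt] := ordP1_unif None; rewrite (vN (ordP1_place None)) -exprVn.
by rewrite (vX (ordP1_place None) 2 t0) vt.
Qed.

End RatFun.

(** * Artin-Schreier extensions of degree p *)

(** The coefficient of y^(p l) after the substitution of y^p - f for y in P(y),
    when P has degree less than p. *)
Definition Acoef (F : fieldType) (p : nat) (f : F) (P : {poly F}) (l : nat) : F :=
  \sum_(r < p) P`_r * ((- f) ^+ (r - l) *+ 'C(r, l)).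

Lemma prime_ndvd_bin p r l : prime p -> (l <= r < p)%N -> ~~ (p %| 'C(r, l))%N.
Proof.
move=> pp /andP[lr rp].
have ndvd_fact n : (n < p)%N -> ~~ (p %| n`!)%N.
  elim: n => [|n IH] np; first by rewrite fact0 dvdn1 gtn_eqF // prime_gt1.
  by rewrite factS Euclid_dvdM // negb_or gtnNdvd //= IH // ltnW.
apply: contra (ndvd_fact r rp) => pC.
by rewrite -(bin_fact lr) dvdn_mulr.
Qed.

Section AcoefOrder.

Variables (k F : fieldType) (iota : {rmorphism k -> F}) (D : F -> F).
Variables (v : F -> int) (t : F) (p : nat) (f : F).
Hypothesis vP : is_place iota D v t.
Hypothesis p_char : p \in [pchar k].

(** The binomial coefficients are units because r < p, so they do not affect the
    orders of the terms. *)
Lemma Acoef_order (P : {poly F}) (R l : nat) (n : int) : (l <= R < p)%N ->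
  P`_R * (- f) ^+ (R - l) != 0 -> v (P`_R * (- f) ^+ (R - l)) = n ->
  (forall r, (l <= r < p)%N -> r != R -> vge v (n + 1) (P`_r * (- f) ^+ (r - l))) ->
  Acoef p f P l != 0 /\ v (Acoef p f P l) = n.
Proof.
move=> lRp t0 vt H; have /andP[lR Rp] := lRp; have pp := pcharf_prime p_char.
have bin0 : 'C(R, l)%:R != 0 :> k by rewrite -(dvdn_pcharf p_char) prime_ndvd_bin.
have binF : 'C(R, l)%:R != 0 :> F by rewrite -(rmorph_nat iota) fmorph_eq0.
rewrite /Acoef (bigD1 (Ordinal Rp)) //= mulrnAr -mulr_natl.
set a := _ * _; have a0 : a != 0 by rewrite mulf_neq0.
have va : v a = n.
  by rewrite (placeM vP) // vt -(rmorph_nat iota) (place_cst vP) // add0r.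
rewrite -va; apply: (v_addr vP) => //; apply: (vge_sum vP) => r rR.
rewrite mulrnAr; have [lr|rl] := leqP l r; last by rewrite bin_small // vge0.
by apply: (vge_natr vP); rewrite va; apply: H; rewrite ?lr ?ltn_ord.
Qed.

End AcoefOrder.

Section ArtinSchreier.

Variables (F : fieldType) (K : fieldExtType F) (p : nat) (f : F) (y : K).
Hypothesis p_char : p \in [pchar F].
Hypothesis y_min : minPoly 1%VS y = 'X^p - 'X - (f%:A)%:P.
Hypothesis y_gen : <<1; y>>%VS = fullv.

Implicit Types P Q : {poly F}.

Notation ev := (horner_alg y).

Lemma evZ g P : ev (g *: P) = g *: ev P.
Proof. by rewrite -mul_polyC rmorphM /= horner_algC mulr_algl. Qed.

Lemma evXn r : ev 'X^r = y ^+ r.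
Proof. by rewrite rmorphXn /= horner_algX. Qed.

Let p_gt1 : (1 < p)%N. Proof. exact/prime_gt1/(pcharf_prime p_char). Qed.

Definition ASpoly : {poly F} := 'X^p - 'X - f%:P.

Lemma size_ASpoly : size ASpoly = p.+1.
Proof.
rewrite /ASpoly -addrA -opprD size_polyDl ?size_polyXn // size_polyN.
by rewrite (leq_ltn_trans (size_polyD _ _)) // size_polyX size_polyC; case: eqP => _ /=; lia.
Qed.

Lemma ASpoly_neq0 : ASpoly != 0.
Proof. by rewrite -size_poly_gt0 size_ASpoly. Qed.

Lemma ev_ASpoly : ev ASpoly = 0.
Proof.
have := minPolyxx 1%VS y; rewrite y_min !hornerE => <-.
by rewrite /ASpoly !(rmorphB, rmorphXn) /= horner_algX horner_algC.
Qed.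

Lemma y_pow : y ^+ p = y + f%:A.
Proof.
apply/eqP; rewrite -subr_eq0 opprD addrA -ev_ASpoly.
by rewrite /ASpoly !(rmorphB, rmorphXn) /= horner_algX horner_algC.
Qed.

Lemma ev_mod P : ev (P %% ASpoly) = ev P.
Proof. by rewrite [in RHS](divp_eq P ASpoly) rmorphD rmorphM /= ev_ASpoly mulr0 add0r. Qed.

Lemma ev_eq0 P : (size P <= p)%N -> ev P = 0 -> P = 0.
Proof.
move=> sP evP; have : minPoly 1%VS y %| map_poly (in_alg K) P.
  by apply: minPoly_dvdp; [exact: alg_polyOver | apply/rootP].
have [->//|P0] := eqVneq P 0; move=> /dvdp_leq.
rewrite map_poly_eq0 P0 size_map_poly y_min => /(_ isT).
have -> : 'X^p - 'X - (f%:A)%:P = map_poly (in_alg K) ASpoly.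
  by rewrite !rmorphB /= map_polyXn map_polyX map_polyC.
by rewrite size_map_poly size_ASpoly ltnNge sP.
Qed.

Lemma ev_ex h : exists P : {poly F}, (size P <= p)%N && (ev P == h).
Proof.
have : h \in <<1; y>>%VS by rewrite y_gen memvf.
move=> /Fadjoin1_polyP[P ->]; exists (P %% ASpoly).
by rewrite -ltnS -size_ASpoly ltn_modp ASpoly_neq0 ev_mod eqxx.
Qed.

(** The coordinates of h in the basis 1, y, .., y^(p - 1), collected in a
    polynomial so that products in K are products modulo ASpoly. *)
Definition rep h : {poly F} := xchoose (ev_ex h).

Lemma size_rep h : (size (rep h) <= p)%N.
Proof. by have /andP[] := xchooseP (ev_ex h). Qed.

Lemma evK h : ev (rep h) = h.
Proof. by have /andP[_ /eqP] := xchooseP (ev_ex h). Qed.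

Lemma repK P : (size P <= p)%N -> rep (ev P) = P.
Proof.
move=> sP; apply/subr0_eq/ev_eq0; last by rewrite rmorphB /= evK subrr.
by rewrite (leq_trans (size_polyD _ _)) // size_polyN geq_max size_rep.
Qed.

Lemma rep_ev P : rep (ev P) = P %% ASpoly.
Proof.
by rewrite -ev_mod repK // -ltnS -size_ASpoly ltn_modp ASpoly_neq0.
Qed.

Lemma repD a b : rep (a + b) = rep a + rep b.
Proof.
rewrite -{1}(evK a) -{1}(evK b) -rmorphD repK //.
by rewrite (leq_trans (size_polyD _ _)) // geq_max !size_rep.
Qed.

Lemma repZ g a : rep (g *: a) = g *: rep a.
Proof.
rewrite -{1}(evK a) -evZ repK //.
by rewrite (leq_trans (size_scale_leq _ _)) // size_rep.
Qed.

Lemma rep0 : rep 0 = 0.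
Proof. by rewrite -(scale0r (0 : K)) repZ scale0r. Qed.

Lemma repN a : rep (- a) = - rep a.
Proof. by rewrite -scaleN1r repZ scaleN1r. Qed.

Lemma rep_alg g : rep (g%:A) = g%:P.
Proof. by rewrite -(horner_algC y) repK // size_polyC; case: eqP => _ /=; lia. Qed.

Lemma rep_mulX g r : (r < p)%N -> rep (g *: y ^+ r) = g *: 'X^r.
Proof.
move=> rp; have -> : g *: y ^+ r = ev (g *: 'X^r).
  by rewrite evZ evXn.
by rewrite repK // (leq_trans (size_scale_leq _ _)) // size_polyXn.
Qed.

Lemma rep_sum (I : Type) (s : seq I) (P : pred I) (E : I -> K) :
  rep (\sum_(i <- s | P i) E i) = \sum_(i <- s | P i) rep (E i).
Proof. by apply: (big_morph rep repD rep0). Qed.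

Lemma ev_coord h : h = \sum_(i < p) (rep h)`_i *: y ^+ i.
Proof.
rewrite -{1}(evK h) -{1}[rep h]coefK (poly_def (size _)) linear_sum /=.
rewrite (big_ord_widen p (fun i => ev ((rep h)`_i *: 'X^i))) ?size_rep //.
rewrite [RHS](bigID (fun i : 'I_p => (i < size (rep h))%N)) /=.
rewrite [X in _ = _ + X]big1 ?addr0; last first.
  by move=> i; rewrite -leqNgt => /leq_sizeP->; rewrite ?scale0r.
by apply: eq_bigr => i _; rewrite evZ evXn.
Qed.

Section Derivation.

Variable D : F -> F.
Hypothesis derD : forall a b, D (a + b) = D a + D b.
Hypothesis derM : forall a b, D (a * b) = a * D b + b * D a.

Let D0 : D 0 = 0.
Proof. by apply: (addrI (D 0)); rewrite -derD !addr0. Qed.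

Let D1 : D 1 = 0.
Proof. by apply: (addrI (D 1)); rewrite addr0 -{3}(mulr1 1) derM !mul1r. Qed.

Let DN a : D (- a) = - D a.
Proof. by apply: (addrI (D a)); rewrite -derD !subrr. Qed.

(** The lift to F[y] of the derivation of K that extends D; it sends y to
    - D f because y^p has derivative zero. *)
Definition derP (P : {poly F}) := map_poly D P - P^`() * (D f)%:P.

Lemma mapDD P Q : map_poly D (P + Q) = map_poly D P + map_poly D Q.
Proof. by apply/polyP => i; rewrite !(coefD, coef_map_id0). Qed.

Lemma mapDM P Q : map_poly D (P * Q) = P * map_poly D Q + Q * map_poly D P.
Proof.
apply/polyP => i; rewrite coefD coef_map_id0 // coefM (coefM P) [Q * _]mulrC coefM.
rewrite -big_split /= (big_morph D derD D0); apply: eq_bigr => j _.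
by rewrite !coef_map_id0 // derM [Q`_ _ * _]mulrC.
Qed.

Lemma derPD P Q : derP (P + Q) = derP P + derP Q.
Proof. by rewrite /derP mapDD derivD; ring. Qed.

Lemma derPM P Q : derP (P * Q) = P * derP Q + Q * derP P.
Proof. by rewrite /derP mapDM derivM; ring. Qed.

Lemma derP_AS : derP ASpoly = 0.
Proof.
have DXn i : map_poly D 'X^i = 0.
  apply/polyP => j; rewrite coef_map_id0 // coefXn coef0.
  by case: eqP.
have mapN P : map_poly D (- P) = - map_poly D P.
  by apply/polyP => i; rewrite !(coefN, coef_map_id0).
have -> : ASpoly = 'X^p + - 'X^1 + - f%:P by rewrite expr1.
have DC a : map_poly D a%:P = (D a)%:P.
  by apply/polyP => j; rewrite coef_map_id0 // !coefC; case: eqP.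
rewrite /derP !mapDD !mapN !DXn DC !derivE.
have -> : 'X^(p.-1) *+ p = 0 :> {poly F}.
  by rewrite -scaler_nat (pcharf0 p_char) scale0r.
by rewrite !subr0 !sub0r mulNr expr0 mul1r opprK addNr.
Qed.

Lemma size_derP P : (size P <= p)%N -> (size (derP P) <= p)%N.
Proof.
move=> sP; rewrite (leq_trans (size_polyD _ _)) // geq_max size_polyN.
rewrite (leq_trans (size_poly _ _)) // mulrC mul_polyC.
by rewrite (leq_trans (size_scale_leq _ _)) // (leq_trans (size_poly _ _)) // (leq_trans (leq_pred _)).
Qed.

Definition derK (h : K) : K := ev (derP (rep h)).

Lemma derK_ev P : derK (ev P) = ev (derP P).
Proof.
rewrite /derK rep_ev [in RHS](divp_eq P ASpoly) derPD derPM derP_AS.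
by rewrite mulr0 add0r [RHS]rmorphD /= rmorphM /= ev_ASpoly mul0r add0r.
Qed.

Lemma rep_derK h : rep (derK h) = derP (rep h).
Proof. by rewrite /derK repK // size_derP // size_rep. Qed.

Lemma derKD a b : derK (a + b) = derK a + derK b.
Proof. by rewrite /derK repD derPD rmorphD. Qed.

Lemma derKM a b : derK (a * b) = a * derK b + b * derK a.
Proof.
by rewrite -{1}(evK a) -{1}(evK b) -rmorphM derK_ev derPM rmorphD !rmorphM /= !evK.
Qed.

Lemma derK_alg g : derK (g%:A) = (D g)%:A.
Proof.
have DC : map_poly D g%:P = (D g)%:P.
  by apply/polyP => j; rewrite coef_map_id0 // !coefC; case: eqP.
rewrite /derK rep_alg /derP DC derivC mul0r subr0.
by rewrite horner_algC.
Qed.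

Lemma derK_y : derK y = - (D f)%:A.
Proof.
rewrite -[y in LHS]horner_algX derK_ev /derP derivX mul1r.
have -> : map_poly D 'X = 0.
  apply/polyP => j; rewrite coef_map_id0 // coefX coef0.
  by case: eqP.
by rewrite sub0r rmorphN /= horner_algC.
Qed.

End Derivation.

End ArtinSchreier.

(** * The point above a pole of f *)

(** The different bounds p x - d r, the order of g y^r for g of order x, from below.
    Since (p - 1) (d + 1) = p d + gam d - d, division by p and rounding turn
    this into a bound on x. *)
Lemma different_bound (p d gam r : nat) (x : int) : p = (gam * d).+1 ->
  (0 < gam * d)%N -> (r < p)%N ->
  - ((p - 1) * d.+1)%N%:Z <= p%:Z * x - d%:Z * r%:Z ->
  - (d%:Z - (r %/ gam)%N%:Z) <= x.
Proof.
move=> pE; rewrite muln_gt0 => /andP[g0 d0].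
have := divn_eq r gam; have := ltn_pmod r g0.
move: (r %/ gam)%N (r %% gam)%N => q s sg -> rp H.
have qd : (q <= d)%N by rewrite leqNgt; apply/negP => dq; move: rp; rewrite pE; nia.
rewrite leNgt; apply/negP => lt; have {lt}xl : x <= q%:Z - d%:Z - 1 by lia.
have : p%:Z * x <= p%:Z * (q%:Z - d%:Z - 1) by rewrite ler_wpM2l.
move: H; rewrite pE subn1 /= PoszM PoszD PoszM.
by nia.
Qed.

Section Ramified.

Variables (F : fieldType) (K : fieldExtType F) (p : nat) (f : F) (y : K).
Hypothesis p_charF : p \in [pchar F].
Hypothesis y_min : minPoly 1%VS y = 'X^p - 'X - (f%:A)%:P.
Hypothesis y_gen : <<1; y>>%VS = fullv.
Variables (k : fieldType) (iota : {rmorphism k -> F}) (D : F -> F).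
Variables (v : F -> int) (t : F) (d : nat).
Hypothesis vP : is_place iota D v t.
Hypothesis f_neq0 : f != 0.
Hypothesis v_f : v f = - d%:Z.
Hypothesis d_pchar : d%:R != 0 :> k.

Implicit Types (P Q : {poly F}) (n m : int) (g : F) (h : K) (r s : nat).

Notation ev := (horner_alg y).
Notation rep := (rep p_charF y_min y_gen).
Notation derK := (derK p_charF y_min y_gen D).
Notation ASpoly := (ASpoly p f).

Let p_prime : prime p. Proof. exact: (pcharf_prime p_charF). Qed.
Let p_gt1 : (1 < p)%N. Proof. exact: prime_gt1. Qed.

Let p_chark : p \in [pchar k].
Proof. by rewrite -(fmorph_pchar iota). Qed.

Let d_gt0 : (0 < d)%N.
Proof. by case: d d_pchar => //; rewrite eqxx. Qed.

Let d_coprime : coprime p d.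
Proof. by rewrite prime_coprime // (dvdn_pcharf p_chark). Qed.

(** The order of g y^r at the totally ramified point above the place, where y has
    a pole of order d and t a zero of order p. *)
Definition wt r g : int := p%:Z * v g - d%:Z * r%:Z.

Definition wge n r g := (g == 0) || (n <= wt r g).

Definition wgeP n P := forall r, wge n r P`_r.

(** The elements of order at least n at the ramified point. The orders of the
    terms g_r y^r, r < p, are distinct modulo p, so the order of their sum is
    the least one. *)
Definition wgeK n h := wgeP n (rep h).

Lemma wge_vge n m r g : vge v m g -> n <= p%:Z * m - d%:Z * r%:Z -> wge n r g.
Proof.
rewrite /vge /wge /wt; case: eqP => //= _ mg nm.
by rewrite (le_trans nm) // lerD2r ler_pM2l // ltz_nat; lia.
Qed.

Lemma wge0 n r : wge n r 0. Proof. by rewrite /wge eqxx. Qed.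

Lemma wgeE n r g : g != 0 -> wge n r g = (n <= wt r g).
Proof. by rewrite /wge => /negbTE ->. Qed.

Lemma wgeD n r g g' : wge n r g -> wge n r g' -> wge n r (g + g').
Proof.
have [->|g0] := eqVneq g 0; first by rewrite add0r.
have [->|g'0] := eqVneq g' 0; first by rewrite addr0.
have [->|s0] := eqVneq (g + g') 0; first by rewrite wge0.
rewrite !wgeE // /wt => H H'.
have := @vgeD _ _ _ _ _ _ vP (Num.min (v g) (v g')) g g'.
rewrite !vgeE // !ge_min !lexx orbT => /(_ isT isT).
case/orP: (le_total (v g) (v g')) => l; rewrite ?(min_l l) ?(min_r l) => l'.
  by rewrite (le_trans H) // lerD2r ler_pM2l; [case/orP: l' => //; lia | lia].
by rewrite (le_trans H') // lerD2r ler_pM2l; [case/orP: l' => //; lia | lia].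
Qed.

Lemma wgeN n r g : wge n r (- g) = wge n r g.
Proof. by rewrite /wge oppr_eq0 /wt (vN vP). Qed.

Lemma wgeM n m r s g g' : wge n r g -> wge m s g' -> wge (n + m) (r + s) (g * g').
Proof.
have [->|g0] := eqVneq g 0; first by rewrite mul0r !wge0.
have [->|g'0] := eqVneq g' 0; first by rewrite mulr0 !wge0.
rewrite !wgeE ?mulf_neq0 // /wt (placeM vP) // => H H'.
by rewrite (le_trans (lerD H H')) // PoszD; lia.
Qed.

Lemma wgeP_D n P Q : wgeP n P -> wgeP n Q -> wgeP n (P + Q).
Proof. by move=> HP HQ r; rewrite coefD wgeD. Qed.

Lemma wgeP_N n P : wgeP n P -> wgeP n (- P).
Proof. by move=> HP r; rewrite coefN wgeN. Qed.

Lemma wgeP_M n m P Q : wgeP n P -> wgeP m Q -> wgeP (n + m) (P * Q).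
Proof.
move=> HP HQ r; rewrite coefM; elim/big_ind: _ => [|a b|i _].
- exact: wge0.
- exact: wgeD.
- by have := wgeM (HP i) (HQ (r - i)%N); rewrite subnKC // -ltnS.
Qed.

Lemma wgeP_mono n r g : wge n r g -> wgeP n (g *: 'X^r).
Proof.
move=> H s; rewrite coefZ coefXn; have [->|_] := eqVneq; first by rewrite mulr1.
by rewrite mulr0 wge0.
Qed.

Lemma wgeP_le n m P : n <= m -> wgeP m P -> wgeP n P.
Proof.
move=> nm H r; have := H r; rewrite /wge => /orP[->//|].
by move=> /(le_trans nm) ->; rewrite orbT.
Qed.

(* Each term of y^p - y - f has order at least - p d. *)
Lemma wgeP_AS : wgeP (- (p * d)%N%:Z) ASpoly.
Proof.
have -> : ASpoly = 1 *: 'X^p + - (1 *: 'X^1) + - (f *: 'X^0).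
  by rewrite !scale1r expr1 expr0 alg_polyC.
have v1' : vge v 0 1 := vge1 vP.
have vf : vge v (- d%:Z) f by rewrite -v_f; exact: vge_v.
apply: wgeP_D; [apply: wgeP_D|]; rewrite ?PoszM.
- apply: wgeP_mono; apply: wge_vge v1' _; lia.
- apply/wgeP_N/wgeP_mono; apply: wge_vge v1' _; nia.
- apply/wgeP_N/wgeP_mono; apply: wge_vge vf _; nia.
Qed.

(** Reduction modulo y^p - y - f replaces y^p, of order - p d, by y + f, whose
    terms have at least this order. *)
Lemma wgeP_mod n P : wgeP n P -> wgeP n (P %% ASpoly).
Proof.
have [s] := ubnP (size P); elim: s P => // s IH P sP HP.
have [lt|ge] := ltnP (size P) (size ASpoly); first by rewrite modp_small.
have sA := size_ASpoly f p_charF.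
set i := (size P - p.+1)%N; set c := lead_coef P.
have iE : (size P).-1 = (i + p)%N by move: ge; rewrite /i sA; lia.
have A0 := ASpoly_neq0 f p_charF.
have P0 : P != 0 by rewrite -size_poly_gt0 (leq_trans _ ge) // sA.
have lA : ASpoly`_p = 1.
  rewrite !coefB coefXn eqxx coefX coefC.
  by rewrite gtn_eqF // gtn_eqF ?subr0 // ltnW.
have -> : P %% ASpoly = (P - c *: 'X^i * ASpoly) %% ASpoly.
  by rewrite modpD modpN modp_mull oppr0 addr0.
apply: IH; last first.
  apply: wgeP_D (HP) (wgeP_N _).
  rewrite -[n](addrK (- (p * d)%N%:Z)) opprK addrAC.
  apply: wgeP_M wgeP_AS; apply: wgeP_mono.
  have := HP (i + p)%N; rewrite -iE -lead_coefE -/c /wge; case: eqP => //= _.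
  by rewrite /wt iE PoszD PoszM; lia.
rewrite ltnS in sP; apply: leq_trans sP.
rewrite -[size P]prednK ?size_poly_gt0 // ltnS; apply/leq_sizeP => j.
rewrite leq_eqVlt => /orP[/eqP <-|jP].
  rewrite coefB -lead_coefE -/c iE -scalerAl coefZ.
  rewrite coefXnM ltnNge leq_addr addKn lA.
  by rewrite mulr1 subrr.
rewrite coefB nth_default; last by move: jP (size_poly_gt0 P); rewrite P0; size_lia.
rewrite sub0r; apply/eqP; rewrite oppr_eq0; apply/eqP/nth_default.
rewrite (leq_trans (size_polyMleq _ _)) // sA addnS /=.
have := size_scale_leq c 'X^i; rewrite size_polyXn.
by move: jP; rewrite iE; size_lia.
Qed.

Lemma wgeK_D n a b : wgeK n a -> wgeK n b -> wgeK n (a + b).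
Proof. by rewrite /wgeK repD; apply: wgeP_D. Qed.

Lemma wgeK_N n a : wgeK n a -> wgeK n (- a).
Proof. by rewrite /wgeK repN; apply: wgeP_N. Qed.

Lemma wgeK_M n m a b : wgeK n a -> wgeK m b -> wgeK (n + m) (a * b).
Proof.
move=> Ha Hb; rewrite /wgeK -(evK p_charF y_min y_gen a).
by rewrite -(evK p_charF y_min y_gen b) -rmorphM rep_ev; apply/wgeP_mod/wgeP_M.
Qed.

Lemma wgeK_le n m h : n <= m -> wgeK m h -> wgeK n h.
Proof. exact: wgeP_le. Qed.

Lemma wgeK_sum (I : Type) (l : seq I) (P : pred I) n (E : I -> K) :
  (forall i, P i -> wgeK n (E i)) -> wgeK n (\sum_(i <- l | P i) E i).
Proof.
move=> H; elim/big_ind: _ => // [|a b]; last exact: wgeK_D.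
by rewrite /wgeK rep0 => r; rewrite coef0 wge0.
Qed.

Lemma wgeK_alg n g : wgeK n g%:A <-> wge n 0 g.
Proof.
rewrite /wgeK rep_alg; split=> [/(_ 0%N)|H r]; first by rewrite coefC.
by rewrite coefC; case: eqP => [->|] //; rewrite wge0.
Qed.

Lemma wgeK_cst c : wgeK 0 (iota c)%:A.
Proof. by apply/wgeK_alg; apply: wge_vge (vge_cst vP c) _; lia. Qed.

(** The orders of the monomials g_r y^r, r < p, are distinct, since p does not
    divide d; so exactly one of them is least. *)
Lemma wgeK_lead h : h != 0 -> exists r g,
  [/\ (r < p)%N, g != 0, wgeK (wt r g) h & wgeK (wt r g + 1) (h - g *: y ^+ r)].
Proof.
move=> h0; set P := rep h.
have P0 : P != 0 by apply: contraNneq h0 => P0; rewrite -(evK p_charF y_min y_gen h) -/P P0 rmorph0.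
have sP : (size P <= p)%N := size_rep p_charF y_min y_gen h.
have lp : ((size P).-1 < p)%N by rewrite prednK ?size_poly_gt0.
pose i0 := Ordinal lp.
have Hi0 : P`_i0 != 0 by rewrite /= -lead_coefE lead_coef_eq0.
case: (Order.TotalTheory.arg_minP (P := fun i : 'I_p => P`_i != 0)
  (fun i : 'I_p => wt i P`_i) Hi0) => r Pr rmin.
exists (val r), P`_r; split=> //; first exact: ltn_ord.
  move=> s; rewrite -/P /wge; case: eqP => //= /eqP Ps.
  have sp : (s < p)%N by rewrite (leq_trans _ sP) // ltnNge; apply: contra Ps => /leq_sizeP->.
  exact: (rmin (Ordinal sp)).
rewrite /wgeK repD repN rep_mulX ?ltn_ord // -/P => s.
rewrite coefB coefZ coefXn; have [->|sr] := eqVneq; first by rewrite mulr1 subrr wge0.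
rewrite mulr0 subr0 /wge; case: eqP => //= /eqP Ps.
have sp : (s < p)%N by rewrite (leq_trans _ sP) // ltnNge; apply: contra Ps => /leq_sizeP->.
have := rmin (Ordinal sp) Ps; rewrite lezD1 lt_neqAle /= => -> ; rewrite andbT.
(* Equal orders would force r = s modulo p. *)
apply: contra sr; rewrite /wt => /eqP E.
have : (p%:Z %| d%:Z * (r%:Z - s%:Z))%Z.
  apply/dvdzP; exists (v P`_r - v P`_s).
  by move: E; move: (v _) (v _) => a b; rewrite mulrBl mulrBr ![_ * p%:Z]mulrC; lia.
rewrite Gauss_dvdzr ?coprimezE //= -eqz_mod_dvd !modz_nat !modn_small //.
by move/eqP=> -[->].
Qed.

(** The product of two monomials has the expected order and no larger one, even
    when its degree in y reaches p: then f y^(r + s - p) is its leading term. *)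
Lemma wgeK_monoM r s g g' : (r < p)%N -> (s < p)%N -> g != 0 -> g' != 0 ->
  ~ wgeK (wt r g + wt s g' + 1) (g *: y ^+ r * (g' *: y ^+ s)).
Proof.
move=> rp sp g0 g'0; rewrite -scalerAl -scalerAr scalerA -exprD.
have gg0 : g * g' != 0 by rewrite mulf_neq0.
have [lt|ge] := ltnP (r + s) p.
  rewrite /wgeK rep_mulX // => /(_ (r + s)%N).
  by rewrite coefZ coefXn eqxx mulr1 wgeE // /wt (placeM vP) // PoszD; lia.
set i := (r + s - p)%N.
have -> : (r + s = i + p)%N by rewrite /i; lia.
have -> : g * g' *: y ^+ (i + p) = ev (g * g' *: 'X^(i.+1) + g * g' * f *: 'X^i).
  rewrite exprD (y_pow y_min) rmorphD /= !evZ !evXn mulrDr exprSr scalerDr.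
  by congr (_ + _); rewrite -[RHS]scalerA -scalerAr mulr1.
rewrite /wgeK repK => [/(_ i)|]; last first.
  rewrite (leq_trans (size_polyD _ _)) // geq_max.
  by rewrite !(leq_trans (size_scale_leq _ _)) ?size_polyXn //; rewrite /i; lia.
rewrite coefD !coefZ !coefXn eqxx ltn_eqF // mulr0 add0r mulr1 wgeE ?mulf_neq0 //.
rewrite /wt !(placeM vP) ?mulf_neq0 // v_f.
have -> : i%:Z = r%:Z + s%:Z - p%:Z by rewrite /i; lia.
by lia.
Qed.

(** Let g y^r and g' y^s be the leading monomials of h and of its inverse. Their
    product is 1 up to terms of order larger than the sum of their orders. If
    the sum were negative, then 1 would be one of these terms as well, and the
    product would have an order larger than expected. *)
Lemma wgeK_val h : wgeK 0 h \/ wgeK 0 h^-1.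
Proof.
have [->|h0] := eqVneq h 0.
  by left; rewrite -(scale0r (1 : K)) wgeK_alg wge0.
have [r [g [rp g0 H1 H2]]] := wgeK_lead h0.
have hV0 : h^-1 != 0 by rewrite invr_eq0.
have [s [g' [sp g'0 H1' H2']]] := wgeK_lead hV0.
suff : 0 <= wt r g \/ 0 <= wt s g'.
  by case=> H; [left; apply: wgeK_le H H1 | right; apply: wgeK_le H H1'].
suff : 0 <= wt r g + wt s g' by lia.
rewrite leNgt; apply/negP => lt0; apply: (wgeK_monoM rp sp g0 g'0).
set e := h - _ in H2; set e' := h^-1 - _ in H2'.
have -> : g *: y ^+ r * (g' *: y ^+ s) = 1 + - (h * e' + (h^-1 - e') * e).
  have -> : g *: y ^+ r = h - e by rewrite /e subKr.
  have -> : g' *: y ^+ s = h^-1 - e' by rewrite /e' subKr.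
  by rewrite -[in RHS](divff h0); ring.
apply: wgeK_D.
  by rewrite -[X in wgeK _ X]scale1r; apply/wgeK_alg; apply: wge_vge (vge1 vP) _; lia.
apply: wgeK_N; apply: wgeK_D; first by rewrite -addrA; apply: wgeK_M.
have -> : wt r g + wt s g' + 1 = wt s g' + (wt r g + 1) by lia.
apply: wgeK_M H2; rewrite /e' subKr.
by rewrite /wgeK rep_mulX //; apply: wgeP_mono; rewrite wgeE.
Qed.

Lemma wgeK_proper : ~ wgeK 0 (t^-1)%:A.
Proof.
have [t0 vt] := place_t vP.
by rewrite wgeK_alg wgeE ?invr_eq0 // /wt (vV vP) // vt; lia.
Qed.

(** The different has exponent (p - 1) (d + 1) at the ramified point, so this is
    the order of the zero of dt there, and differentiation with respect to t
    creates poles of at most this order. *)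
Lemma wgeK_der h : wgeK 0 h ->
  wgeK (- ((p - 1) * d.+1)%N%:Z) ((D t)^-1 *: derK h).
Proof.
move=> H r; rewrite repZ rep_derK ?coefZ /derP; try exact: (place_derD vP); try exact: (place_derM vP).
rewrite coefB coef_map_id0 ?(der0 vP) // coefMC coef_deriv mulrBr.
have e1 : ((p - 1) * d.+1)%N%:Z = p%:Z * d%:Z + p%:Z - d%:Z - 1.
  by rewrite PoszM -subzn ?prime_gt0 //; lia.
have p2 : (2 <= p%:Z) by rewrite lez_nat.
have d1 : (1 <= d%:Z) by rewrite lez_nat.
apply: wgeD.
  have := H r; set g := (rep h)`_r; rewrite mulrC.
  have [->|g0] := eqVneq g 0; first by rewrite (der0 vP) mul0r !wge0.
  rewrite wgeE // => Hg; apply: wge_vge (vge_del vP (vge_v v g)) _.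
  by move: Hg; rewrite e1 /wt mulrBr mulr1; nia.
have := H r.+1; set g := (rep h)`_r.+1.
have [->|g0] := eqVneq g 0; first by rewrite mul0rn mul0r mulr0 oppr0 !wge0.
rewrite wgeN wgeE // => Hg.
have rp : (r.+1 < p)%N.
  rewrite (leq_trans _ (size_rep p_charF y_min y_gen h)) // ltnNge.
  by apply: contra g0 => /leq_sizeP; rewrite /g => ->.
have [df0 vdf] := v_del_pole vP f_neq0 v_f d_pchar.
have -> : (D t)^-1 * (g *+ r.+1 * D f) = g * (D f / D t) *+ r.+1.
  by rewrite mulrnAl mulrnAr [_^-1 * _]mulrC -mulrA.
apply: (@wge_vge _ (v g - d.+1%:Z)).
  by apply: (vge_natr vP); apply: (vgeM vP); rewrite ?vge_v // -vdf vge_v.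
(* The order of g y^(r+1) is not 0 because p does not divide d (r+1). *)
have N : wt r.+1 g != 0.
  apply/negP; rewrite /wt subr_eq0 => /eqP E.
  have : (p %| d * r.+1)%N by rewrite -[(_ %| _)%N]/(p%:Z %| (d * r.+1)%N%:Z)%Z PoszM -E dvdz_mulr.
  by rewrite Gauss_dvdr // => /(dvdn_leq (ltn0Sn r)); rewrite leqNgt rp.
have : 1 <= wt r.+1 g by move: N Hg; lia.
by rewrite e1 /wt -[r.+1]addn1 -[d.+1]addn1 !PoszD; lia.
Qed.

(** The order of h is the least order of its monomials, so the bound on h that the
    different gives holds for each coordinate. *)
Lemma ramified_bound h gam (n : nat) (a b : 'I_n -> K) : p = (gam * d).+1 ->
  (forall i, wgeK 0 (a i) /\ wgeK 0 (b i)) -> h = \sum_i a i * derK (b i) ->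
  forall r, (r < p)%N -> vge v (- (d%:Z - (r %/ gam)%N%:Z)) ((rep h)`_r / D t).
Proof.
move=> pE ab hE r rp; set c := _ / _.
have : wge (- ((p - 1) * d.+1)%N%:Z) r c.
  have -> : c = (rep ((D t)^-1 *: h))`_r by rewrite repZ coefZ mulrC.
  suff : wgeK (- ((p - 1) * d.+1)%N%:Z) ((D t)^-1 *: h) by apply.
  rewrite hE scaler_sumr; apply: wgeK_sum => i _; have [ai bi] := ab i.
  by rewrite scalerAr -[- _]add0r; apply: wgeK_M ai (wgeK_der bi).
have [->|c0] := eqVneq c 0; first by rewrite vge0.
rewrite wgeE // vgeE // /wt; move: (v c) => x.
by apply: different_bound; rewrite // -ltnS -pE.
Qed.

End Ramified.

(** * The points above the other places *)

Section PolynomialValues.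

Variables (k F : fieldType) (iota : {rmorphism k -> F}) (D : F -> F).
Variables (v : F -> int) (t : F).
Hypothesis vP : is_place iota D v t.
Notation ge := (vge v).
Implicit Types (P Q : {poly F}) (m e : int) (c u : F).

Lemma vge_horner m P c : (forall i, ge m P`_i) -> ge 0 c -> ge m P.[c].
Proof.
move=> HP c0; rewrite horner_coef; apply: (vge_sum vP) => i _.
by rewrite -(addr0 m) (vgeM vP) // -(mul0rn _ i) (vgeX vP).
Qed.

(** Polynomials are continuous for the valuation, uniformly on regular arguments. *)
Lemma vge_hornerB m e P c u : (forall i, ge m P`_i) -> ge 0 c -> 0 <= e ->
  ge e u -> ge (m + e) (P.[c + u] - P.[c]).
Proof.
move=> HP c0 e0 gu; elim/poly_ind: P HP => [|P a IH] HP.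
  by rewrite !horner0 subrr vge0.
have {}HP i : ge m P`_i by have := HP i.+1; rewrite coefD coefMX coefC addr0.
have cu0 : ge 0 (c + u) by apply: (vgeD vP) c0 (vge_le e0 gu).
have -> : (P * 'X + a%:P).[c + u] - (P * 'X + a%:P).[c]
    = (c + u) * (P.[c + u] - P.[c]) + P.[c] * u by rewrite !hornerE; ring.
apply: (vgeD vP); first by apply: (vge0M vP) cu0 (IH HP).
by apply: (vgeM vP) gu; apply: vge_horner.
Qed.

Lemma vge_poly_bound P : exists e : nat, forall i, ge (- e%:Z) P`_i.
Proof.
elim/poly_ind: P => [|P a [e He]]; first by exists 0%N => i; rewrite coef0 vge0.
exists (maxn e `|v a|) => -[|i]; rewrite coefD coefMX coefC /= ?add0r ?addr0.
  by apply: (vge_le _ (vge_v v a)); lia.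
by apply: vge_le (He i); lia.
Qed.

End PolynomialValues.

Section Unramified.

Variables (F : fieldType) (K : fieldExtType F) (p : nat) (f : F) (y : K).
Hypothesis p_charF : p \in [pchar F].
Hypothesis y_min : minPoly 1%VS y = 'X^p - 'X - (f%:A)%:P.
Hypothesis y_gen : <<1; y>>%VS = fullv.
Variables (k : fieldType) (iota : {rmorphism k -> F}) (D : F -> F).
Variables (v : F -> int) (t : F).
Hypothesis vP : is_place iota D v t.

Implicit Types (P Q : {poly F}) (g : F) (h a b : K) (r s : nat).

Notation ge := (vge v).
Notation ev := (horner_alg y).
Notation rep := (rep p_charF y_min y_gen).
Notation derK := (derK p_charF y_min y_gen D).
Notation ASpoly := (ASpoly p f).

Let p_prime : prime p. Proof. exact: (pcharf_prime p_charF). Qed.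
Let p_gt1 : (1 < p)%N. Proof. exact: prime_gt1. Qed.

Lemma frob_sub (g g' : F) : (g - g') ^+ p = g ^+ p - g' ^+ p.
Proof. exact: (rmorphB (pFrobenius_aut p_charF)). Qed.

Section Root.

Variable alpha : k.
Hypothesis alpha_root : ge 1 (f - iota (alpha ^+ p - alpha)).

Let phi := f - iota (alpha ^+ p - alpha).

(** Approximate roots of Y^p - Y - f at the place, that start at the residue
    alpha. Every element of K, as a polynomial in y, takes values at these
    roots; the values that it takes in the limit are its expansion at the point
    where y has residue alpha. *)
Fixpoint aroot n : F := if n is m.+1 then aroot m ^+ p - f else iota alpha.

Lemma arootE n : aroot n ^+ p - aroot n - f = - phi ^+ (p ^ n).
Proof.
elim: n => [|n IH] /=.
  by rewrite expr1 /phi -rmorphXn -rmorphB opprB.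
have -> : aroot n ^+ p - f = aroot n - phi ^+ (p ^ n) by rewrite -IH; ring.
rewrite frob_sub expnSr exprM -[LHS]addr0 -[X in _ + X](subrr (- phi ^+ (p ^ n))).
by rewrite -{1}IH; ring.
Qed.

Lemma arootS n : aroot n.+1 = aroot n + - phi ^+ (p ^ n).
Proof. by rewrite /= -arootE; ring. Qed.

Lemma vge_phi n : ge (n.+1)%:Z (phi ^+ (p ^ n)).
Proof.
apply: vge_le (vgeX vP _ alpha_root); have := ltn_expl n p_gt1.
by move: (p ^ n)%N => q; lia.
Qed.

Lemma aroot_res n : ge 1 (aroot n - iota alpha).
Proof.
elim: n => [|n IH]; first by rewrite subrr vge0.
rewrite arootS addrAC; apply: (vgeD vP) IH _; rewrite (vgeN vP).
by apply: vge_le (vge_phi n).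
Qed.

Lemma aroot_reg n : ge 0 (aroot n).
Proof.
rewrite -[aroot n](subrK (iota alpha)); apply: (vgeD vP) _ (vge_cst vP _).
by apply: vge_le (aroot_res n).
Qed.

(** The local ring at the point above the place where y has residue alpha. *)
Definition regK h := exists n0, forall n, (n0 <= n)%N -> ge 0 (rep h).[aroot n].

Lemma regK_cst c : regK (iota c)%:A.
Proof. by exists 0%N => n _; rewrite rep_alg hornerC (vge_cst vP). Qed.

Lemma regK_D a b : regK a -> regK b -> regK (a + b).
Proof.
move=> [n Hn] [m Hm]; exists (maxn n m) => i; rewrite geq_max => /andP[ni mi].
by rewrite repD hornerD; apply: (vgeD vP); [apply: Hn | apply: Hm].
Qed.

Lemma regK_N a : regK a -> regK (- a).
Proof.
by move=> [n Hn]; exists n => i ni; rewrite repN hornerN (vgeN vP) Hn.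
Qed.

Lemma horner_mod P : exists n0, forall n, (n0 <= n)%N ->
  ge 1 (P.[aroot n] - (P %% ASpoly).[aroot n]).
Proof.
have [e He] := vge_poly_bound v (P %/ ASpoly).
exists e => n en; rewrite {1}(divp_eq P ASpoly) hornerD addrK hornerM.
have -> : ASpoly.[aroot n] = - phi ^+ (p ^ n).
  by rewrite /ASpoly !hornerE -arootE.
apply: (@vge_le _ _ _ (- e%:Z + n.+1%:Z)); first by lia.
apply: (vgeM vP); last by rewrite (vgeN vP) vge_phi.
exact: (vge_horner vP) He (aroot_reg n).
Qed.

Lemma rep_mul_value a b : exists n0, forall n, (n0 <= n)%N ->
  ge 1 ((rep a).[aroot n] * (rep b).[aroot n] - (rep (a * b)).[aroot n]).
Proof.
have [n0 Hn] := horner_mod (rep a * rep b).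
exists n0 => n /Hn; rewrite hornerM -(rep_ev p_charF y_min y_gen).
by rewrite rmorphM /= !evK.
Qed.

Lemma regK_M a b : regK a -> regK b -> regK (a * b).
Proof.
move=> [n Hn] [m Hm]; have [l Hl] := rep_mul_value a b.
exists (maxn l (maxn n m)) => i; rewrite !geq_max => /and3P[li ni mi].
rewrite -[_.[_]]opprK -[X in - X](addKr ((rep a).[aroot i] * (rep b).[aroot i])).
rewrite opprD opprK; apply: (vgeD vP).
  by apply: (vge0M vP); [apply: Hn | apply: Hm].
by rewrite (vgeN vP); apply: vge_le (Hl i li).
Qed.

(** Consecutive roots differ by phi^(p^n), which in the end outweighs the poles of
    the coordinates of h. *)
Lemma regK_late h : exists n0, forall n, (n0 <= n)%N ->
  ge 0 (rep h).[aroot n] -> regK h.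
Proof.
have [e He] := vge_poly_bound v (rep h).
exists e => n0 en0 H0; exists n0 => n; elim: n => [|n IH].
  by rewrite leqn0 => /eqP E; rewrite -{1}E.
rewrite leq_eqVlt => /orP[/eqP<- //|]; rewrite ltnS => n0n.
rewrite arootS -[_.[_]](subrK (rep h).[aroot n]); apply: (vgeD vP) (IH n0n).
apply: vge_le (vge_hornerB vP He (aroot_reg n) _ _ : ge (- e%:Z + n.+1%:Z) _).
- by move: en0 n0n; lia.
- by [].
- by rewrite (vgeN vP) vge_phi.
Qed.

(** Late values of h and of its inverse have a product close to 1, so one of the two
    is regular at a late root, hence at all later ones. *)
Lemma regK_val h : regK h \/ regK h^-1.
Proof.
have [->|h0] := eqVneq h 0.
  by left; rewrite -(scale0r (1 : K)) -(rmorph0 iota); apply: regK_cst.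
have [n Hn] := regK_late h; have [m Hm] := regK_late h^-1.
have [l Hl] := rep_mul_value h h^-1; set i := maxn l (maxn n m).
have /and3P[li ni mi] : [&& l <= i, n <= i & m <= i]%N.
  by rewrite /i !leq_max !leqnn !orbT.
have := Hl i li; rewrite divff // -[in rep 1](scale1r (1 : K)) rep_alg hornerC.
move: (Hn i ni) (Hm i mi); set a := _.[_]; set b := (rep h^-1).[_] => Ha Hb ab.
have [/Ha|na] := boolP (ge 0 a); first by left.
have [/Hb|nb] := boolP (ge 0 b); first by right.
have a0 : a != 0 by apply: contraNneq na => ->; rewrite vge0.
have b0 : b != 0 by apply: contraNneq nb => ->; rewrite vge0.
have : ge 0 (a * b).
  by rewrite -[a * b](subrK 1); apply: (vgeD vP) (vge1 vP); apply: vge_le ab.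
move: na nb; rewrite !vgeE ?mulf_neq0 // (placeM vP) //; lia.
Qed.

Lemma regK_proper : ~ regK (t^-1)%:A.
Proof.
move=> [n /(_ _ (leqnn n))]; have [t0 vt] := place_t vP.
by rewrite rep_alg hornerC vgeE ?invr_eq0 // (vV vP) // vt.
Qed.

Lemma aroot_der n : D (aroot n.+1) = - D f.
Proof.
have DN g : D (- g) = - D g.
  by apply: (addrI (D g)); rewrite -(place_derD vP) !subrr (der0 vP).
by rewrite /= (place_derD vP) DN (derX vP) (pcharf0 p_charF) !mul0r add0r.
Qed.

(** The derivative of a p-th power vanishes, so all later approximate roots have
    the derivative - D f that y has. Hence evaluation at them commutes with
    the derivations, and no different appears. *)
Lemma regK_der h : regK h -> regK ((D t)^-1 *: derK h).
Proof.
move=> [n0 Hn]; exists n0.+1 => -[//|n]; rewrite ltnS => n0n.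
rewrite repZ rep_derK; try exact: (place_derD vP); try exact: (place_derM vP).
rewrite hornerZ.
have DH P c : D P.[c] = (map_poly D P).[c] + P^`().[c] * D c.
  elim/poly_ind: P => [|P a IH].
    by rewrite deriv0 !horner0 mul0r addr0 (_ : map_poly D 0 = 0) ?horner0 ?(der0 vP) // map_poly0.
  have -> : map_poly D (P * 'X + a%:P) = map_poly D P * 'X + (D a)%:P.
    apply/polyP => -[|i]; rewrite coef_map_id0 ?(der0 vP) // !coefD !coefMX !coefC /=.
      by rewrite !add0r.
    by rewrite !addr0 coef_map_id0 ?(der0 vP).
  by rewrite !derivE !hornerE (place_derD vP) (place_derM vP) IH; ring.
have -> : (derP f D (rep h)).[aroot n.+1] = D (rep h).[aroot n.+1].
  by rewrite DH aroot_der /derP hornerD hornerN hornerM hornerC mulrN.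
rewrite mulrC; apply: (place_der vP).
by apply: Hn; rewrite ltnW.
Qed.

End Root.

(** The residues of y at the points above the place are permuted by the Galois
    group, which translates them by the integers. *)
Lemma shift_root (alpha : k) (i : nat) :
  ge 1 (f - iota (alpha ^+ p - alpha)) ->
  ge 1 (f - iota ((alpha + i%:R) ^+ p - (alpha + i%:R))).
Proof.
have pk : p \in [pchar k] by rewrite -(fmorph_pchar iota).
have -> : (alpha + i%:R) ^+ p = alpha ^+ p + i%:R.
  have frob_nat : i%:R ^+ p = i%:R :> k := rmorph_nat (pFrobenius_aut pk) i.
  rewrite -[i%:R in RHS]frob_nat; exact: (rmorphD (pFrobenius_aut pk) alpha i%:R).
by rewrite opprD addrACA subrr addr0.
Qed.

(** Otherwise, the residues of the coordinates, rescaled by a power of t, would form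
    a nonzero polynomial of degree less than p that vanishes at the p residues
    of y. *)
Lemma regK_coord (alpha : k) h :
  ge 1 (f - iota (alpha ^+ p - alpha)) ->
  (forall i : nat, regK (alpha + i%:R) h) -> forall r, ge 0 (rep h)`_r.
Proof.
move=> Halpha H r; set P := rep h; apply/negP => nr; move/negP: nr => nr.
have sP : (size P <= p)%N := size_rep p_charF y_min y_gen h.
have Pr0 : P`_r != 0 by apply: contraNneq nr => ->; rewrite vge0.
have ltp s : P`_s != 0 -> (s < p)%N.
  by move=> Ps; rewrite (leq_trans _ sP) // ltnNge; apply: contra Ps => /leq_sizeP->.
case: (Order.TotalTheory.arg_minP (P := fun i : 'I_p => P`_i != 0)
  (fun i : 'I_p => v P`_i) (i0 := Ordinal (ltp r Pr0)) Pr0) => r0 Pr00 rmin.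
have vr0 : v P`_r0 < 0.
  have := rmin (Ordinal (ltp r Pr0)) Pr0; move: nr; rewrite vgeE //=.
  by move: (v P`_r) (v P`_r0) => *; lia.
have [t0 vt] := place_t vP.
pose e := `|v P`_r0|%N; have eE : v P`_r0 = - e%:Z by rewrite /e; lia.
have e_ge1 : 1 <= e%:Z + 0 by move: vr0; rewrite eE addr0; case: (e).
pose Q := t ^+ e *: P.
have vte : v (t ^+ e) = e%:Z by rewrite (vX vP) // vt; lia.
have gQ i : ge 0 Q`_i.
  rewrite coefZ; have [->|Pi] := eqVneq P`_i 0; first by rewrite mulr0 vge0.
  rewrite vgeE ?mulf_neq0 ?expf_neq0 // (placeM vP) ?expf_neq0 // vte.
  by have := rmin (Ordinal (ltp i Pi)) Pi; rewrite /= eE; lia.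
have resQ i : exists c, ge 1 (Q`_i - iota c) := place_res vP (gQ i).
pose q := \poly_(i < p) xchoose (resQ i).
have resq i : ge 1 (Q`_i - iota q`_i).
  rewrite coef_poly; case: ltnP => [ip|pi]; first exact: (xchooseP (resQ i)).
  by rewrite rmorph0 subr0 coefZ nth_default ?mulr0 ?vge0 // (leq_trans sP).
have rootq (i : nat) : root q (alpha + i%:R).
  set b := alpha + i%:R; have fb : ge 1 (f - iota (b ^+ p - b)) := shift_root i Halpha.
  have [n /(_ n (leqnn n)) Hn] := H i; rewrite -/P -/b in Hn.
  apply/negPn/negP => qb; suff : ge 1 (iota q.[b]).
    by rewrite vgeE ?fmorph_eq0 // (place_cst vP).
  have bE := aroot_res fb n; have breg := aroot_reg fb n.
  have -> : iota q.[b] = Q.[aroot b n] - (Q.[aroot b n] - Q.[iota b])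
      - (Q - map_poly iota q).[iota b].
    by rewrite hornerD hornerN horner_map; ring.
  apply: (vgeB vP); first apply: (vgeB vP).
  - rewrite hornerZ; apply: vge_le e_ge1 _.
    by apply: (vgeM vP) Hn; rewrite -vte vge_v.
  - rewrite -{1}(subrK (iota b) (aroot b n)) [_ - iota b + _]addrC.
    by apply: (vge_hornerB vP gQ (vge_cst vP b) _ bE).
  - apply: (vge_horner vP) (vge_cst vP b) => j.
    by rewrite coefB coef_map_id0 ?rmorph0.
suff q0 : q = 0.
  have := resq r0; rewrite q0 coef0 rmorph0 subr0 coefZ.
  by rewrite vgeE ?mulf_neq0 ?expf_neq0 // (placeM vP) ?expf_neq0 // vte eE addrN.
apply: contraTeq (leqnn p) => q0; rewrite -ltnNge.
have pk : p \in [pchar k] by rewrite -(fmorph_pchar iota).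
have := @max_poly_roots _ q (mkseq (fun i => alpha + i%:R) p) q0.
rewrite size_mkseq; have -> : all (root q) (mkseq (fun i => alpha + i%:R) p).
  by apply/allP => _ /mapP[i _ ->]; apply: rootq.
have natr_inj i j : (i <= j < p)%N -> i%:R = j%:R :> k -> i = j.
  case/andP=> ij jp /esym/eqP; rewrite -subr_eq0 -natrB // -(dvdn_pcharf pk).
  by move=> /dvdnP[[|l] E]; [lia | move: E; rewrite mulSn; lia].
have -> : uniq (mkseq (fun i => alpha + i%:R) p).
  apply/(mkseq_uniqP _ p) => i j; rewrite !inE => ip jp /addrI E.
  have [ij|/ltnW ji] := leqP i j; first by apply: natr_inj; rewrite ?ij.
  by apply/esym/natr_inj; rewrite ?ji.
move=> /(_ isT isT) lt; apply: leq_trans lt _.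
exact: size_poly.
Qed.

Lemma unramified_bound (alpha : k) h :
  ge 1 (f - iota (alpha ^+ p - alpha)) ->
  (forall i : nat, exists n (a b : 'I_n -> K),
     (forall j, regK (alpha + i%:R) (a j) /\ regK (alpha + i%:R) (b j)) /\
     h = \sum_j a j * derK (b j)) ->
  forall r, ge 0 ((rep h)`_r / D t).
Proof.
move=> Halpha H r.
have -> : (rep h)`_r / D t = (rep ((D t)^-1 *: h))`_r by rewrite repZ coefZ mulrC.
apply: (regK_coord Halpha) => i; have [n [a [b [ab ->]]]] := H i.
have fi := shift_root i Halpha; rewrite scaler_sumr.
elim/big_ind: _ => [|u w|j _]; last first.
- have [aj bj] := ab j; rewrite scalerAr.
  exact: (regK_M fi aj (regK_der bj)).
- exact: regK_D.
- by have := regK_cst (alpha + i%:R) 0; rewrite rmorph0 scale0r.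
Qed.

End Unramified.

(** * Arbitrary points of the curve *)

Section Scalars.

Variables (F : fieldType) (K : fieldExtType F).
Implicit Types g h : F.

Lemma algM g h : (g * h)%:A = g%:A * h%:A :> K.
Proof. exact: (rmorphM (in_alg K)). Qed.

Lemma algX g n : (g ^+ n)%:A = g%:A ^+ n :> K.
Proof. exact: (rmorphXn (in_alg K)). Qed.

Lemma algV g : (g^-1)%:A = g%:A^-1 :> K.
Proof. exact: (fmorphV (in_alg K)). Qed.

Lemma alg_div g h : (g / h)%:A = g%:A / h%:A :> K.
Proof. by rewrite algM algV. Qed.

Lemma alg_eq0 g : (g%:A == 0 :> K) = (g == 0).
Proof. exact: (fmorph_eq0 (in_alg K)). Qed.

End Scalars.

Section Points.

Variables (k : closedFieldType) (K : fieldExtType (ratfun k)) (O : K -> Prop).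
Hypothesis HO : is_point O.

Implicit Types (a b h u : K) (g : ratfun k) (N M : {poly k}).

Lemma pointC (c : k) : O (cstF k c)%:A. Proof. exact: (point_cst HO). Qed.

Lemma point0 : O 0.
Proof. by have := pointC 0; rewrite rmorph0 scale0r. Qed.

Lemma point1 : O 1.
Proof. by have := pointC 1; rewrite rmorph1 scale1r. Qed.

Lemma pointN a : O a -> O (- a).
Proof. by move=> Oa; rewrite -sub0r; apply: (point_sub HO) point0 Oa. Qed.

Lemma pointD a b : O a -> O b -> O (a + b).
Proof. by move=> Oa Ob; rewrite -[b]opprK; apply: (point_sub HO) Oa (pointN Ob). Qed.

Lemma pointM a b : O a -> O b -> O (a * b). Proof. exact: (point_mul HO). Qed.

Lemma pointX a n : O a -> O (a ^+ n).
Proof.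
by move=> Oa; elim: n => [|n IH]; rewrite ?expr0 ?exprS; [apply: point1 | apply: pointM].
Qed.

Lemma point_sum (I : Type) (s : seq I) (P : pred I) (E : I -> K) :
  (forall i, P i -> O (E i)) -> O (\sum_(i <- s | P i) E i).
Proof.
move=> H; elim/big_ind: _ => //; [exact: point0 | exact: pointD].
Qed.

(** The maximal ideal of the local ring O. Inverses in K send 0 to 0, which is in
    O, so 0 is listed apart. *)
Definition inM a := a = 0 \/ ~ O a^-1.

Lemma inM_point a : inM a -> O a.
Proof.
by case=> [->|na]; [apply: point0 | case: (point_val HO a)].
Qed.

Lemma inM_mul a b : inM a -> O b -> inM (a * b).
Proof.
case=> [->|na] Ob; first by left; rewrite mul0r.
have [->|b0] := eqVneq b 0; first by left; rewrite mulr0.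
right; rewrite invfM => H; apply: na.
by have := pointM H Ob; rewrite mulfVK.
Qed.

Lemma inM_add a b : inM a -> inM b -> inM (a + b).
Proof.
move=> Ma Mb; have [->|a0] := eqVneq a 0; first by rewrite add0r.
have [->|b0] := eqVneq b 0; first by rewrite addr0.
case: (point_val HO (a / b)) => H.
  have -> : a + b = b * (1 + a / b) by rewrite mulrDr mulr1 [b * _]mulrC divfK // addrC.
  by apply: inM_mul => //; apply: pointD point1 H.
have -> : a + b = a * (1 + b / a) by rewrite mulrDr mulr1 [_ / a]mulrC mulVKf.
by apply: inM_mul => //; apply: pointD point1 _; rewrite -invf_div.
Qed.

Lemma inM_cst (c : k) : c != 0 -> ~ inM (cstF k c)%:A.
Proof.
move=> c0 []; first by move/eqP; rewrite alg_eq0 fmorph_eq0 (negbTE c0).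
by rewrite -algV -(fmorphV (cstF k)); apply; apply: pointC.
Qed.

Lemma inM_N a : inM a -> inM (- a).
Proof. by move=> Ma; rewrite -mulrN1; apply: inM_mul Ma (pointN point1). Qed.

Lemma unit_inv a : ~ inM a -> O a^-1.
Proof. by move=> na; apply: NNPP => nO; apply: na; right. Qed.

Lemma inM_cst_add (c : k) a : c != 0 -> inM a -> O ((cstF k c)%:A + a)^-1.
Proof.
move=> c0 Ma; apply: unit_inv => H; apply: (inM_cst c0).
by rewrite -[_%:A](addrK a); apply: inM_add H (inM_N Ma).
Qed.

(** A valuation ring is integrally closed. *)
Lemma point_root a n : (0 < n)%N -> O (a ^+ n) -> O a.
Proof.
case: n => // n _ H; case: (point_val HO a) => // Hi.
have [->|a0] := eqVneq a 0; first exact: point0.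
have -> : a = a ^+ n.+1 * a^-1 ^+ n by rewrite exprS exprVn mulfK ?expf_neq0.
exact: pointM H (pointX _ Hi).
Qed.

Notation "N %:K" := ((N%:F)%:A : K) (at level 2, format "N %:K").

Lemma polyK_D N M : (N + M)%:K = N%:K + M%:K.
Proof. by rewrite rmorphD scalerDl. Qed.

Lemma polyK_M N M : (N * M)%:K = N%:K * M%:K.
Proof. by rewrite -algM -rmorphM. Qed.

Lemma point_poly N : O ('X)%:K -> O N%:K.
Proof.
move=> Ox; elim/poly_ind: N => [|N c IH].
  by rewrite rmorph0 scale0r; apply: point0.
by rewrite polyK_D polyK_M; apply: pointD (pointC c); apply: pointM.
Qed.

Section Center.

Variables (f : ratfun k) (p : nat) (y : K).
Hypothesis p_gt1 : (1 < p)%N.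
Hypothesis y_powp : y ^+ p = y + f%:A.

Lemma y_integral : O f%:A -> O y.
Proof.
move=> Of; case: (point_val HO y) => // Hi.
have [->|y0] := eqVneq y 0; first exact: point0.
case: (classic (O y)) => // ny; have Mi : inM y^-1 by right; rewrite invrK.
have : y = f%:A * y^-1 ^+ p.-1 + y^-1 ^+ p.-1 * y.
  have -> : f%:A = y ^+ p - y by rewrite y_powp addrC addKr.
  rewrite [_ * y]mulrC -mulrDl subrK -[p in y ^+ p]prednK; last by apply: ltnW.
  by rewrite exprS exprVn mulfK ?expf_neq0.
move=> ->; apply: pointD; first by apply: pointM Of (pointX _ Hi).
case E : p.-1 => [|q]; first by move: E p_gt1; case: (p) => [|[]].
by rewrite exprSr mulfVK //; apply: pointX.
Qed.

(** If x is regular at the point, then some x - a is not a unit: otherwise all of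
    k(x) would be regular, and K, which is integral over k(x), as well. If x is
    not regular, then 1/x is in the maximal ideal, and the center is infinity. *)
Lemma point_center :
  (forall h, exists c : 'I_p -> ratfun k, h = \sum_i c i *: y ^+ i) ->
  exists Q : option k,
  (forall g, vge (ordP1 Q) 0 g -> O g%:A) /\
  (forall g, vge (ordP1 Q) 1 g -> inM g%:A).
Proof.
move=> y_coord; suff [Q [H1 H2]] : exists Q : option k,
  (forall g, vge (ordP1 Q) 0 g -> O g%:A) /\ inM (unifP1 Q)%:A.
  exists Q; split=> // g Hg; have [t0 vt] := ordP1_unif Q.
  have -> : g = unifP1 Q * (g / unifP1 Q) by rewrite mulrC divfK.
  rewrite algM; apply: inM_mul H2 (H1 _ _).
  rewrite -(subrr 1); apply: (vgeM (ordP1_place Q)) Hg _.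
  by rewrite -vt -(vV (ordP1_place Q)) // vge_v.
case: (classic (O 'X%:K)) => [Ox|nx].
  case: (classic (exists z : k, inM ('X - z%:P)%:K)) => [[a Ma]|nM].
    exists (Some a); split=> // g /frac_regular[N [M [Na ->]]].
    rewrite alg_div; apply: pointM (point_poly _ Ox) _.
    have /factor_theorem[M1 ME] : root (M - M.[a]%:P) a.
      by rewrite /root !hornerE subrr.
    have -> : M = M.[a]%:P + ('X - a%:P) * M1 by rewrite mulrC -ME addrC subrK.
    rewrite polyK_D polyK_M; apply: inM_cst_add Na _.
    by apply: inM_mul Ma (point_poly _ Ox).
  have inv_poly N : N != 0 -> O N%:K^-1.
    have [r ->] := closed_field_poly_normal N.
    rewrite scaler_eq0 negb_or => /andP[l0 _]; rewrite -mul_polyC polyK_M invfM.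
    apply: pointM; first by apply: unit_inv; apply: inM_cst.
    elim: r => [|z r IH]; first by rewrite big_nil rmorph1 scale1r invr1; apply: point1.
    rewrite big_cons polyK_M invfM; apply: pointM IH.
    by apply: unit_inv => Mz; apply: nM; exists z.
  have allF g : O g%:A.
    have [N [M [M0 ->]]] := ratfunP g; rewrite alg_div.
    by apply: pointM (point_poly _ Ox) (inv_poly _ M0).
  have [h []] := point_proper HO; have [c ->] := y_coord h.
  apply: point_sum => i _; rewrite -mulr_algl; apply: pointM (allF _) _.
  exact/pointX/y_integral/allF.
have x0 : 'X%:K != 0.
  by apply: contra_notN nx => /eqP ->; apply: point0.
have Mx : inM 'X%:K^-1 by right; rewrite invrK.
have Ox := inM_point Mx.
have term N i n : (i <= n)%N ->
    ((N`_i)%:P * 'X^i)%:K / 'X%:K ^+ n = (cstF k N`_i)%:A * 'X%:K^-1 ^+ (n - i).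
  move=> le; rewrite polyK_M -mulrA; congr (_ * _).
  rewrite -[in X in _ / X](subnK le) exprD rmorphXn exprVn.
  have -> : ('X%:F ^+ i)%:A = 'X%:K ^+ i by rewrite -algX.
  by rewrite invfM mulrC -mulrA mulVf ?mulr1 ?expf_neq0.
exists None; split; last by rewrite /= algV.
move=> g; have [N [M [M0 ->]]] := ratfunP g; rewrite frac_ge //=.
have [->|N0] := eqVneq N 0; first by rewrite rmorph0 mul0r scale0r => _; apply: point0.
rewrite /= => NM; have sM : (0 < size M)%N by rewrite size_poly_gt0.
set n := (size M).-1.
have sN : (size N <= n.+1)%N by rewrite /n; move: NM sM; size_lia.
have xn0 : 'X%:K ^+ n != 0 by rewrite expf_neq0.
have -> : (N%:F / M%:F)%:A = (N%:K / 'X%:K ^+ n) / (M%:K / 'X%:K ^+ n).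
  by rewrite alg_div invf_div mulrA mulfVK.
have expand (P : {poly k}) m : (size P <= m.+1)%N -> P%:K = \sum_(i < m.+1) ((P`_i)%:P * 'X^i)%:K.
  move=> sP; rewrite -{1}[P]coefK (poly_def (size _)) rmorph_sum scaler_suml.
  rewrite (big_ord_widen m.+1 (fun i => (P`_i *: 'X^i)%:K)) // big_mkcond /=.
  apply: eq_bigr => i _; rewrite mul_polyC; case: ltnP => // /leq_sizeP-> //.
  by rewrite scale0r rmorph0 scale0r.
apply: pointM.
  rewrite (expand N n sN) mulr_suml; apply: point_sum => i _.
  rewrite term ?leq_ord //.
  by apply: pointM (pointC _) (pointX _ Ox).
have sME : size M = n.+1 by rewrite prednK.
rewrite (expand M n) ?sME // big_ord_recr mulrDl mulr_suml /= addrC.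
rewrite term ?subnn ?expr0 ?mulr1 //.
apply: inM_cst_add; first by rewrite -lead_coefE lead_coef_eq0.
elim/big_ind: _ => [||i _]; [by left | exact: inM_add |].
rewrite term ?(ltnW (ltn_ord i)) //.
rewrite mulrC; apply: inM_mul (pointC _).
rewrite -[(n - i)%N]prednK ?subn_gt0 // exprS.
by apply: inM_mul Mx (pointX _ Ox).
Qed.

Variables (Q : option k) (d : nat).
Hypothesis O_reg : forall g, vge (ordP1 Q) 0 g -> O g%:A.
Hypothesis O_max : forall g, vge (ordP1 Q) 1 g -> inM g%:A.
Hypothesis f_neq0 : f != 0.
Hypothesis v_f : ordP1 Q f = - d%:Z.
Hypothesis d_gt0 : (0 < d)%N.

(** Above a pole of f, y is not regular, and the unit is the inverse of
    1 - y^(1 - p). *)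
Lemma y_pow_unit : exists e : K, [/\ e != 0, O e, O e^-1 & y ^+ p = f%:A * e].
Proof.
have vP := ordP1_place Q.
have MfV : inM (f^-1)%:A.
  by apply: O_max; rewrite vgeE ?invr_eq0 // (vV vP) // v_f; lia.
have fA0 : f%:A != 0 :> K by rewrite alg_eq0.
have nf : ~ O f%:A.
  move=> Of; have := inM_mul MfV Of.
  rewrite -algM mulVf // => M1.
  by apply: (inM_cst (oner_neq0 k)); rewrite rmorph1.
have y0 : y != 0.
  apply/eqP => y0; move: y_powp nf; rewrite y0 expr0n add0r.
  by case: (p) p_gt1 => // q _ <-; case; apply: point0.
have ny : ~ O y.
  move=> Oy; apply: nf; have -> : f%:A = y ^+ p - y by rewrite y_powp addrC addKr.
  by apply: (point_sub HO) (pointX _ Oy) Oy.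
have My : inM y^-1 by right; rewrite invrK.
have Mz : inM (- y^-1 ^+ p.-1).
  rewrite -(prednK (n := p.-1)); last by case: (p) p_gt1 => [|[]].
  by rewrite exprS; apply/inM_N/inM_mul/pointX/inM_point.
have e0 : 1 + - y^-1 ^+ p.-1 != 0.
  apply/eqP => /eqP; rewrite addr_eq0 opprK => /eqP E.
  apply: (inM_cst (oner_neq0 k)); rewrite rmorph1 scale1r E.
  by rewrite -[_ ^+ _]opprK; apply: inM_N.
have HE : y ^+ p * (1 + - y^-1 ^+ p.-1) = f%:A.
  rewrite mulrDr mulr1 mulrN -{2}(prednK (ltnW p_gt1)) exprS exprVn mulfK ?expf_neq0 //.
  by rewrite y_powp addrC addKr.
exists (1 + - y^-1 ^+ p.-1)^-1; split.
- by rewrite invr_eq0.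
- by have := inM_cst_add (oner_neq0 k) Mz; rewrite rmorph1 scale1r.
- by rewrite invrK; apply: pointD point1 (inM_point Mz).
- by rewrite -HE mulfK.
Qed.

(** The local ring is integrally closed, so it suffices to look at the p-th power.
    It is a function on the projective line up to a unit, and its order there is
    the order of g y^(r - s) at the point. *)
Lemma mono_point g (n : int) (r s : nat) : vge (ordP1 Q) n g ->
  0 <= p%:Z * n - d%:Z * (r%:Z - s%:Z) -> O (g%:A * y ^+ r / y ^+ s).
Proof.
move=> gn rsn.
have vP := ordP1_place Q.
have [->|g0] := eqVneq g 0; first by rewrite scale0r !mul0r; apply: point0.
have H : 0 <= p%:Z * ordP1 Q g - d%:Z * (r%:Z - s%:Z).
  move: gn rsn; rewrite vgeE //; move: (ordP1 Q g) => vg ng.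
  by move/le_trans; apply; rewrite lerD2r ler_pM2l ?ltz_nat ?(ltnW p_gt1).
have [e [e0 Oe OeV yE]] := y_pow_unit.
apply: (@point_root _ p); first exact: ltnW.
have -> : (g%:A * y ^+ r / y ^+ s) ^+ p
    = (g ^+ p * f ^+ r / f ^+ s)%:A * (e ^+ r * e^-1 ^+ s).
  rewrite alg_div algM !algX.
  rewrite !exprMn !exprVn -!exprM ![(_ * p)%N]mulnC !exprM yE !exprMn invfM.
  by rewrite mulrA mulrACA.
apply: pointM (pointM (pointX _ Oe) (pointX _ OeV)).
apply: O_reg; apply: (@vge_monomial _ _ _ _ _ _ vP g f p r s g0 f_neq0).
by rewrite v_f mulrN [(r%:Z - _) * _]mulrC.
Qed.

End Center.

End Points.

(** * Regular forms at a point *)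

(** The orders at the ramified point for the form g y^r dx, r = q gam + s, when it is
    expressed by the differential of t y^gam, whose coefficient contains
    y^(gam - 1): the gain d from the derivative of f makes up for the pole of g. *)
Lemma unif_order (p d gam q s : nat) : p = (gam * d).+1 -> (s < gam)%N ->
  0 <= p%:Z * (- (d%:Z - q%:Z) + d%:Z) - d%:Z * ((q * gam + s)%N%:Z - gam.-1%:Z).
Proof.
case: gam => // gam -> sg.
have H : d%:Z * (s%:Z - gam%:Z) <= 0 by nia.
have -> : (q * gam.+1 + s)%N%:Z - gam%:Z = q%:Z * gam%:Z + q%:Z + (s%:Z - gam%:Z) by lia.
by rewrite opprB addrNK mulrDr; move: H; move: (d%:Z * (s%:Z - gam%:Z)) => *; nia.
Qed.

Lemma unif_order0 (p d gam : nat) : p = (gam * d).+1 ->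
  0 <= p%:Z - d%:Z * (gam%:Z - 0%:Z).
Proof. by move=> ->; lia. Qed.

Section RegularAt.

Variables (k : closedFieldType) (K : fieldExtType (ratfun k)) (O : K -> Prop).
Hypothesis HO : is_point O.
Variables (f : ratfun k) (p : nat) (y : K).
Hypothesis p_char : p \in [pchar k].
Hypothesis y_powp : y ^+ p = y + f%:A.
Variables (Omega : lmodType K) (d : K -> Omega) (DK : K -> K) (dx : Omega).
Hypothesis dE : forall a, d a = DK a *: dx.
Hypothesis DKM : forall a b, DK (a * b) = a * DK b + b * DK a.
Hypothesis DKA : forall g, DK g%:A = (der g)%:A.
Hypothesis DKy : DK y = - (der f)%:A.
Variable Q : option k.
Hypothesis O_reg : forall g, vge (ordP1 Q) 0 g -> O g%:A.
Hypothesis O_max : forall g, vge (ordP1 Q) 1 g -> inM O g%:A.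

Notation t := (unifP1 Q).
Notation theta := (der (unifP1 Q)).
Notation v := (ordP1 Q).

Let p_gt1 : (1 < p)%N. Proof. exact/prime_gt1/(pcharf_prime p_char). Qed.

Lemma regular_at_d a b : O a -> O b -> regular_at d O (a *: d b).
Proof.
move=> Oa Ob; exists 1%N, (fun=> a), (fun=> b); split=> //.
by rewrite big_ord1.
Qed.

Let tA0 : theta != 0 := place_dert (ordP1_place Q).

Lemma t_point : O t%:A.
Proof.
have [t0 vt] := ordP1_unif Q; apply: O_reg; by rewrite vgeE ?vt.
Qed.

(** Here y is integral, and dx is a multiple of dt for the uniformizer t of k(x). *)
Lemma regular_at_unramified (c : 'I_p -> ratfun k) : vge v 0 f ->
  (forall r, vge v 0 (c r / theta)) ->
  regular_at d O ((\sum_r c r *: y ^+ r) *: dx).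
Proof.
move=> f0 Hc.
have Oy : O y by apply: (y_integral HO p_gt1 y_powp); apply: O_reg.
have -> : (\sum_r c r *: y ^+ r) *: dx
    = (\sum_r (c r / theta) *: y ^+ r) *: d t%:A.
  rewrite dE DKA scalerA mulr_suml; congr (_ *: _); apply: eq_bigr => r _.
  by rewrite mulr_algr scalerA mulrC divfK.
apply: regular_at_d t_point; apply: (point_sum HO) => r _.
by rewrite -mulr_algl; apply: (pointM HO) (O_reg (Hc r)) (pointX HO _ Oy).
Qed.

Lemma DKX a n : DK (a ^+ n) = n%:R * a ^+ n.-1 * DK a.
Proof.
elim: n => [|n IH].
  rewrite expr0 !mul0r -(scale1r (1 : K)) DKA -(rmorph1 (cstF k)) der_cst.
  by rewrite scale0r.
rewrite exprS DKM IH /=; case: n {IH} => [|n] /=.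
  by rewrite !mul0r mulr0 expr0 add0r !mul1r.
rewrite exprS -[n.+2%:R]natr1 !mulrDl mul1r mulrA mulrCA.
by rewrite [a * _]mulrC -!mulrA.
Qed.

(** Above a pole of f of order dd the function w = t y^gam has order
    p - gam dd = 1. So w is a uniformizer at the point, and the form is regular
    as soon as its coefficient with respect to dw is. *)
Lemma regular_at_ramified (dd gam : nat) (c : 'I_p -> ratfun k) :
  f != 0 -> v f = - dd%:Z -> p = (gam * dd).+1 ->
  (forall r : 'I_p, vge v (- (dd%:Z - (r %/ gam)%N%:Z)) (c r / theta)) ->
  regular_at d O ((\sum_r c r *: y ^+ r) *: dx).
Proof.
move=> f0 vf pE Hc; have vP := ordP1_place Q; have [t0 vt] := ordP1_unif Q.
have [gam0 dd0] : (0 < gam)%N /\ (0 < dd)%N.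
  by move: p_gt1; rewrite pE ltnS muln_gt0 => /andP.
have natp i : (0 < i < p)%N -> i%:R != 0 :> k.
  by case/andP=> i0 ip; rewrite -(dvdn_pcharf p_char) gtnNdvd.
have gamk : gam%:R != 0 :> k by apply: natp; rewrite pE; nia.
have ddk : dd%:R != 0 :> k by apply: natp; rewrite pE; nia.
have [e [e0 Oe OeV yE]] := y_pow_unit HO p_gt1 y_powp O_max f0 vf dd0.
have y0 : y != 0.
  apply: contraTneq (f0) => y0; move/eqP: yE; rewrite y0 expr0n pE /=.
  by rewrite eq_sym mulf_eq0 (negbTE e0) orbF alg_eq0 => ->.
have mono := mono_point HO p_gt1 y_powp O_reg O_max f0 vf dd0.
pose b := gam%:R * t * der f.
have [b0 derf0 Hbp Hbc] := del_unif vP f0 vf dd0 ddk gamk; rewrite -/b in b0 Hbp Hbc.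
have bK0 : b%:A != 0 :> K by rewrite alg_eq0; exact: b0.
have bE : b%:A = gam%:R * t%:A * (der f)%:A :> K.
  rewrite -(rmorph_nat (in_alg K)) /=; apply: etrans (algM _ _ _) _.
  by congr (_ * _); apply: algM.
(* The derivative of w is - b y^(gam - 1) (1 - z), and z is in the maximal ideal. *)
pose z := (theta / b)%:A * y.
have z0 : z != 0.
  apply: mulf_neq0 y0; rewrite alg_eq0; apply: mulf_neq0 tA0 _.
  by rewrite invr_eq0; exact: b0.
have Mz : inM O (- z).
  apply: (inM_N HO); case: (classic (inM O z)) => // nz.
  have zV := unit_inv nz.
  have : inM O (z ^+ p).
    rewrite exprMn yE mulrA -algX -algM; apply: (inM_mul HO) Oe.
    exact: O_max (Hbp p p_gt1).
  case=> [/eqP|[]]; first by rewrite expf_eq0 (negbTE z0) andbF.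
  by rewrite -exprVn; apply: (pointX HO).
have u0 : 1 + - z != 0.
  apply/eqP => /eqP; rewrite addr_eq0 opprK => /eqP E.
  apply: (inM_cst HO (oner_neq0 k)); rewrite rmorph1 scale1r E -[z]opprK.
  exact: (inM_N HO).
have OuV : O (1 + - z)^-1.
  by have := inM_cst_add HO (oner_neq0 k) Mz; rewrite rmorph1 scale1r.
pose w := t%:A * y ^+ gam.
have dwE : DK w = - b%:A * y ^+ gam.-1 * (1 + - z).
  have bz : b%:A * z = theta%:A * y by rewrite /z alg_div mulrA [_ / _]mulrC mulVKf.
  have split_u (B Y Z : K) : - B * Y * (1 + - Z) = - B * Y + B * Z * Y by ring.
  rewrite /w DKM DKX DKy DKA split_u bz bE.
  have -> : y ^+ gam = y * y ^+ gam.-1 by rewrite -exprS prednK.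
  by move: (t%:A : K) (theta%:A) (y ^+ gam.-1) ((der f)%:A) => T TH Y DF; ring.
have dw0 : DK w != 0.
  by rewrite dwE !mulf_neq0 ?expf_neq0 ?oppr_eq0.
have -> : (\sum_r c r *: y ^+ r) *: dx = ((\sum_r c r *: y ^+ r) / DK w) *: d w.
  by rewrite dE scalerA divfK.
apply: regular_at_d.
  rewrite dwE invfM mulrA mulr_suml; apply: (pointM HO) OuV.
  apply: (point_sum HO) => r _.
  have -> : c r *: y ^+ r / (- b%:A * y ^+ gam.-1)
      = - ((c r / b)%:A * y ^+ r / y ^+ gam.-1).
    have frac_neg (A Y B Z : K) : A * Y / (- B * Z) = - (A / B * Y / Z).
      by rewrite mulNr invrN mulrN invfM mulrA [A * Y / B]mulrAC.
    by rewrite -[c r *: _]mulr_algl alg_div; apply: frac_neg.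
  apply: (pointN HO); apply: mono (Hbc _ _ (Hc r)) _.
  by rewrite {2}(divn_eq r gam); apply: unif_order; rewrite ?pE ?ltn_pmod.
have -> : w = t%:A * y ^+ gam / y ^+ 0 by rewrite expr0 divr1.
apply: (mono t 1).
  by have := vge_v v t; rewrite vt.
by rewrite mulr1; apply: unif_order0.
Qed.

End RegularAt.

(** * Kaehler differentials and the Cartier operator *)

Section ScaleBy.

Variables (A : comNzRingType) (V W : lmodType A).
Variables (phi : {linear V -> A^o}) (w : W).

Definition scale_by v : W := (phi v : A) *: w.

Lemma scale_by_linear : linear scale_by.
Proof. by move=> a u v; rewrite /scale_by linearP scalerDl -scalerA. Qed.

HB.instance Definition _ :=
  GRing.isLinear.Build A V W _ scale_by scale_by_linear.

End ScaleBy.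

(** Both v |-> (phi v) w0 and the identity of V are linear maps that send d a to d a, so the
    uniqueness in the universal property identifies them. *)
Lemma universal_generator (A : comNzRingType) (V : lmodType A) (d : A -> V)
    (D : A -> A) (w0 : V) (phi : {linear V -> A^o}) (psi : {linear V -> V}) :
  (forall a, phi (d a) = D a) -> (forall a, d a = D a *: w0) ->
  (forall psi' : {linear V -> V}, (forall a, psi' (d a) = d a) -> psi' =1 psi) ->
  forall w, w = (phi w : A) *: w0.
Proof.
move=> phiE dE psiU w.
have E1 : scale_by phi w0 w = psi w.
  by apply: psiU => a; rewrite /= /scale_by phiE dE.
by rewrite -[RHS]/(scale_by phi w0 w) E1 -(psiU idfun).
Qed.

Lemma linear_free (A : comNzRingType) (V : lmodType A) (w0 : V)
    (phi : {linear V -> A^o}) h : phi w0 = 1 -> h *: w0 = 0 -> h = 0.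
Proof.
move=> phi1 /(congr1 phi); rewrite linearZ linear0 phi1 => H.
by rewrite -[h]mulr1; exact: H.
Qed.

Section Kaehler.

Variables (k : closedFieldType) (p : nat) (f : ratfun k).
Hypothesis p_char : p \in [pchar k].
Variables (K : fieldExtType (ratfun k)) (y : K).
Hypothesis y_min : minPoly 1%VS y = 'X^p - 'X - (f%:A)%:P.
Hypothesis y_gen : <<1; y>>%VS = fullv.
Variables (Omega : lmodType K) (d : K -> Omega).
Hypothesis Omega_d : is_kaehler d.

Lemma ratfun_pchar : p \in [pchar (ratfun k)].
Proof. by rewrite (fmorph_pchar (cstF k)). Qed.

Notation rep := (rep ratfun_pchar y_min y_gen).
Notation DK := (derK ratfun_pchar y_min y_gen (der (k:=k))).
Notation "N %:K" := ((N%:F)%:A : K) (at level 2, format "N %:K").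

Definition dx : Omega := d ('X%:K).

Lemma DKM a b : DK (a * b) = a * DK b + b * DK a.
Proof. by apply: derKM; [exact: derD | exact: derM]. Qed.

Lemma DKA g : DK g%:A = (der g)%:A.
Proof. by apply: derK_alg; exact: derD. Qed.

Lemma DKy : DK y = - (der f)%:A.
Proof. by apply: derK_y; [exact: derD | exact: derM]. Qed.

Lemma DKD a b : DK (a + b) = DK a + DK b.
Proof. by apply: derKD; exact: derD. Qed.

Lemma DK_derivation : is_derivation (DK : K -> K^o).
Proof.
split=> [a b|a b|c]; first exact: DKD.
  exact: DKM.
by rewrite /cst DKA (der_cst c) scale0r.
Qed.

Let dD a b : d (a + b) = d a + d b. Proof. exact: (derivation_add (proj1 Omega_d)). Qed.
Let dM a b : d (a * b) = a *: d b + b *: d a.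
Proof. exact: (derivation_mul (proj1 Omega_d)). Qed.
Let dC c : d (cstF k c)%:A = 0. Proof. exact: (derivation_cst (proj1 Omega_d)). Qed.

Lemma dX a n : d (a ^+ n) = (n%:R * a ^+ n.-1) *: d a.
Proof.
elim: n => [|n IH].
  by rewrite expr0 !mul0r scale0r -(scale1r (1 : K)) -(rmorph1 (cstF k)) dC.
rewrite exprS dM IH /=; case: n {IH} => [|n] /=.
  by rewrite !mul0r !scale0r scaler0 expr0 add0r mul1r.
by rewrite scalerA -scalerDl mulrCA -exprS -[n.+2%:R]natr1 mulrDl mul1r.
Qed.

Lemma d_poly (N : {poly k}) : d N%:K = (N^`())%:K *: dx.
Proof.
elim/poly_ind: N => [|N c IH].
  by rewrite deriv0 rmorph0 !scale0r -[X in d X](scale0r 1) -(rmorph0 (cstF k)) dC.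
have -> : (N * 'X + c%:P)%:K = N%:K * 'X%:K + (cstF k c)%:A.
  by rewrite rmorphD rmorphM scalerDl algM.
rewrite dD dC addr0 dM IH -/dx derivMXaddC rmorphD rmorphM scalerDl algM scalerA -scalerDl.
by congr (_ *: _); rewrite [_%:K * 'X%:K]mulrC.
Qed.

Lemma d_alg g : d g%:A = (der g)%:A *: dx.
Proof.
have [N [M [M0 ->]]] := ratfunP g; set h := _ / _.
have M0' : M%:K != 0 by rewrite alg_eq0 tofrac_eq0.
have hM : h * M%:F = N%:F by rewrite /h divfK ?tofrac_eq0.
have dh : d (h%:A * M%:K) = h%:A *: d M%:K + M%:K *: d h%:A by rewrite dM.
have Dh : DK (h%:A * M%:K) = h%:A * DK M%:K + M%:K * DK h%:A by rewrite DKM.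
rewrite -algM hM d_poly d_poly in dh; rewrite -algM hM !DKA !der_poly in Dh.
apply: (scalerI M0'); rewrite scalerA; apply: (addrI (h%:A *: ((M^`())%:K *: dx))).
by rewrite -dh scalerA -scalerDl -Dh.
Qed.

Lemma d_y : d y = - (der f)%:A *: dx.
Proof.
have := congr1 d (y_pow y_min); rewrite dX dD d_alg.
rewrite -(rmorph_nat (in_alg K)) (pcharf0 ratfun_pchar) rmorph0 mul0r scale0r.
by move/esym/eqP; rewrite addr_eq0 scaleNr => /eqP.
Qed.

(** Both sides are derivations, so it suffices to compare them on k(x) and at y.
    At y they agree because y^p - y = f and p-th powers have differential 0. *)
Lemma dE h : d h = DK h *: dx.
Proof.
pose good a := d a = DK a *: dx.
have goodD a b : good a -> good b -> good (a + b).
  rewrite /good dD => -> ->.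
  by rewrite (derivation_add DK_derivation) scalerDl.
have goodM a b : good a -> good b -> good (a * b).
  by rewrite /good dM DKM => -> ->; rewrite scalerDl !scalerA.
have goodA g : good g%:A by rewrite /good d_alg DKA.
have goodX n : good (y ^+ n).
  elim: n => [|n IH]; first by rewrite expr0 -(scale1r 1); apply: goodA.
  by rewrite exprS; apply: goodM IH; rewrite /good d_y DKy.
rewrite -/(good h) (ev_coord ratfun_pchar y_min y_gen h).
elim/big_ind: _ => // [|i _]; first by rewrite -(scale0r 1); apply: goodA.
by rewrite -mulr_algl; apply: goodM (goodA _) (goodX _).
Qed.

Lemma Omega_dx w : exists h, w = h *: dx.
Proof.
have [phi [phiE _]] := (proj2 Omega_d) _ _ DK_derivation.
have [psi [_ psiU]] := (proj2 Omega_d) _ _ (proj1 Omega_d).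
by exists (phi w); exact: (universal_generator phiE dE psiU w).
Qed.

Lemma dx_free h : h *: dx = 0 -> h = 0.
Proof.
have [phi [phiE _]] := (proj2 Omega_d) _ _ DK_derivation.
have phi1 : phi dx = 1 by rewrite /dx phiE DKA derX1 scale1r.
exact: (linear_free phi1).
Qed.

Variable C : Omega -> Omega.
Hypothesis C_cartier : is_cartier d p C.

Let CD w1 w2 : C (w1 + w2) = C w1 + C w2. Proof. exact: (cartier_add C_cartier). Qed.
Let CZ h w : C (h ^+ p *: w) = h *: C w. Proof. exact: (cartier_scale C_cartier). Qed.
Let Cd h : C (d h) = 0. Proof. exact: (cartier_exact C_cartier). Qed.
Let Clog h : C (h ^+ p.-1 *: d h) = d h. Proof. exact: (cartier_log C_cartier). Qed.

Let p_gt0 : (0 < p)%N. Proof. exact/prime_gt0/(pcharf_prime p_char). Qed.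
Let p_gt1 : (1 < p)%N. Proof. exact/prime_gt1/(pcharf_prime p_char). Qed.

Lemma C0 : C 0 = 0.
Proof. by apply: (addrI (C 0)); rewrite -CD !addr0. Qed.

Lemma C_sum (I : Type) (s : seq I) (P : pred I) (E : I -> Omega) :
  C (\sum_(i <- s | P i) E i) = \sum_(i <- s | P i) C (E i).
Proof. exact: (big_morph C CD C0). Qed.

Lemma proot_ex (c : k) : exists z, z ^+ p == c.
Proof.
have [z zE] := solve_monicpoly (fun i => if i == 0%N then c else 0) p_gt0.
exists z; rewrite zE (bigD1 (Ordinal p_gt0)) //= mulr1 big1 ?addr0 // => i.
by rewrite -val_eqE /= => /negbTE->; rewrite mul0r.
Qed.

Definition proot c := xchoose (proot_ex c).

Lemma prootK c : proot c ^+ p = c.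
Proof. exact/eqP/(xchooseP (proot_ex c)). Qed.

Lemma proot_eq0 c : (proot c == 0) = (c == 0).
Proof. by rewrite -[c in RHS]prootK expf_eq0 p_gt0. Qed.

(** The coefficient extraction that computes the Cartier operator on polynomial
    forms, in any coordinate X - a. *)
Definition cartP (N : {poly k}) : {poly k} :=
  \sum_(n < size N | (n %% p)%N == p.-1) proot N`_n *: 'X^(n %/ p).

Lemma cartP_eq0 N : cartP N = 0 <-> forall i, N`_(i * p + p.-1) = 0.
Proof.
split=> [N0 i|N0]; last first.
  rewrite /cartP big1 // => n /eqP np.
  by rewrite (divn_eq n p) np N0 (_ : proot 0 = 0) ?scale0r //; apply/eqP; rewrite proot_eq0.
have [le|lt] := leqP (size N) (i * p + p.-1); first by rewrite nth_default.
apply/eqP; rewrite -proot_eq0; move/(congr1 (fun q : {poly k} => q`_i)): N0.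
rewrite coef0 /cartP coef_sum (bigD1 (Ordinal lt)) /=; last first.
  by rewrite modnMDl modn_small // prednK.
rewrite coefZ coefXn divnMDl // divn_small ?prednK // addn0 eqxx mulr1.
rewrite big1 ?addr0 => [->//|n /andP[/eqP np ne]].
rewrite coefZ coefXn; case: eqP => [E|]; last by rewrite mulr0.
by case/negP: ne; apply/eqP/val_inj; rewrite /= {1}(divn_eq n p) np -E.
Qed.

(** With s = X - a and n = p i + j, the form s^n ds is (s^i)^p s^j ds, which is a p-th
    power times an exact form unless j = p - 1. *)
Lemma cartier_term (a c : k) n :
  C (((c *: ('X - a%:P) ^+ n)%:K) *: dx) =
  (if (n %% p)%N == p.-1 then (proot c *: ('X - a%:P) ^+ (n %/ p))%:K else 0) *: dx.
Proof.
set s := ('X - a%:P)%:K.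
have ds : d s = dx by rewrite /s d_poly derivXsubC rmorph1 !scale1r.
have termE b i : (b *: ('X - a%:P) ^+ i)%:K = (cstF k b)%:A * s ^+ i.
  by rewrite -mul_polyC rmorphM algM rmorphXn algX.
have -> : (c *: ('X - a%:P) ^+ n)%:K
    = (proot c *: ('X - a%:P) ^+ (n %/ p))%:K ^+ p * s ^+ (n %% p).
  have pc : (cstF k (proot c))%:A ^+ p = (cstF k c)%:A :> K.
    by rewrite -algX -[c in RHS]prootK (rmorphXn (cstF k)).
  by rewrite !termE exprMn -exprM -mulrA -exprD -divn_eq pc.
rewrite -scalerA CZ; case: eqP => [->|/eqP ne]; first by rewrite -ds Clog.
rewrite scale0r -ds; set j := (n %% p)%N in ne *.
have jp : (j < p)%N by rewrite ltn_pmod.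
have j0 : j.+1%:R != 0 :> k.
  rewrite -(dvdn_pcharf p_char) gtnNdvd //.
  by rewrite ltn_neqAle jp andbT; apply: contra ne => /eqP E; rewrite -E.
have -> : s ^+ j *: d s = d ((cstF k j.+1%:R^-1)%:A * s ^+ j.+1).
  rewrite dM dC scaler0 addr0 dX /= scalerA mulrA; congr (_ *: _).
  rewrite -(rmorph_nat (in_alg K)) -(rmorph_nat (cstF k)) /= -algM -rmorphM /=.
  by rewrite -polyCM mulVf // polyC1 rmorph1 scale1r mul1r.
by rewrite Cd scaler0.
Qed.

Lemma cartier_poly (a : k) (N : {poly k}) :
  C ((N \Po ('X - a%:P))%:K *: dx) = (cartP N \Po ('X - a%:P))%:K *: dx.
Proof.
rewrite comp_polyE rmorph_sum !scaler_suml C_sum /cartP.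
under eq_bigr do rewrite cartier_term.
rewrite (linear_sum (comp_poly _)) rmorph_sum !scaler_suml [RHS]big_mkcond /=.
apply: eq_bigr => i _; case: ifP => _; last by rewrite scale0r.
by rewrite comp_polyZ (rmorphXn (comp_poly _)) /= comp_polyX.
Qed.

(** So named because the kernel of the Cartier operator consists of exact forms. *)
Definition exactF g := C (g%:A *: dx) = 0.

(** The fraction is N M^(p - 1) over a p-th power, which the operator takes out. The
    numerator is expanded in the coordinate X - a, for any a. *)
Lemma cartier_frac (a : k) (N M : {poly k}) : M != 0 ->
  C ((N%:F / M%:F)%:A *: dx) =
  (((cartP ((N * M ^+ p.-1) \Po ('X + a%:P)) \Po ('X - a%:P))%:F) / M%:F)%:A *: dx.
Proof.
move=> M0; have M0' : M%:F != 0 by rewrite tofrac_eq0.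
have -> : (N%:F / M%:F)%:A = M%:K^-1 ^+ p * (N * M ^+ p.-1)%:K.
  rewrite -algV -algX -algM; congr (_%:A).
  rewrite rmorphM rmorphXn /= mulrCA exprVn; congr (_ * _).
  by rewrite -[in X in X^-1 * _](prednK p_gt0) exprS invfM -mulrA mulVf ?mulr1 ?expf_neq0.
rewrite -(scalerA (M%:K^-1 ^+ p)) CZ -{1}(comp_polyXaddC_K (N * _) a) cartier_poly scalerA.
by rewrite alg_div mulrC.
Qed.

Lemma C_alg g : exists c : ratfun k, C (g%:A *: dx) = c%:A *: dx.
Proof.
have [N [M [M0 ->]]] := ratfunP g; rewrite (cartier_frac 0) //.
by eexists.
Qed.

Lemma exactF_frac (a : k) (N M : {poly k}) : M != 0 ->
  exactF (N%:F / M%:F) <->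
  forall i, ((N * M ^+ p.-1) \Po ('X + a%:P))`_(i * p + p.-1) = 0.
Proof.
move=> M0; rewrite -cartP_eq0 /exactF (cartier_frac a) //; set q := cartP _.
split=> [/dx_free/eqP|->]; last by rewrite comp_poly0 rmorph0 mul0r !scale0r.
rewrite alg_eq0 mulf_eq0 invr_eq0 !tofrac_eq0 (negbTE M0) orbF => q0.
by apply/eqP; rewrite -(comp_poly2_eq0 q (size_XsubC a)).
Qed.

Lemma exactF_powp (N M : {poly k}) : M != 0 ->
  (forall i, N`_(i * p + p.-1) = 0) -> exactF (N%:F / (M ^+ p)%:F).
Proof.
move=> M0 N0; rewrite /exactF.
have -> : (N%:F / (M ^+ p)%:F)%:A = M%:K^-1 ^+ p * N%:K.
  by rewrite alg_div rmorphXn algX exprVn mulrC.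
have /cartP_eq0 q0 := N0.
rewrite -scalerA CZ -[N]comp_polyXr -['X]subr0 -(polyC0) cartier_poly q0 comp_poly0.
by rewrite rmorph0 !scale0r scaler0.
Qed.

(** An exact form does not have order -1 modulo p: the lowest coefficient of the
    numerator in the coordinate X - a, or its leading coefficient for infinity,
    would be one of those that the Cartier operator extracts. At infinity dx has order -2, so that the
    order of g is then 1 modulo p. *)
Lemma exactF_order (Q : option k) g (e : int) : g != 0 ->
  ordP1 Q g = (if Q is Some _ then p%:Z * e - 1 else p%:Z * e + 1) -> ~ exactF g.
Proof.
have [N [M [M0 ->]]] := ratfunP g.
rewrite mulf_eq0 invr_eq0 !tofrac_eq0 negb_or M0 andbT => N0.
rewrite ordP1E //; set q := N * M ^+ p.-1.
have Mp0 : M ^+ p.-1 != 0 by rewrite expf_neq0.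
have q0 : q != 0 by rewrite mulf_neq0.
have ordq Q' : ordp Q' q = ordp Q' N - ordp Q' M + p%:Z * ordp Q' M.
  rewrite ordpM //; suff -> n : ordp Q' (M ^+ n) = n%:Z * ordp Q' M.
    by rewrite -[in RHS](prednK p_gt0); lia.
  elim: n => [|n IH]; first by rewrite expr0 mul0r ordpC ?oner_eq0.
  by rewrite exprS ordpM ?expf_neq0 // IH; lia.
have modp (n : nat) (e' : int) : n%:Z = p%:Z * e' - 1 -> exists i, n = (i * p + p.-1)%N.
  move=> E; case: e' E => [[|i]|i] E; [by lia | exists i | by nia].
  by rewrite mulnC; nia.
case: Q => [a|] /= E.
  move=> /(exactF_frac a N M0) H.
  have [n [q1 q1a qE]] : exists n, exists2 q1, q1.[a] != 0 & q = q1 * ('X - a%:P) ^+ n.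
    have [n [q1]] := multiplicity_XsubC q a; rewrite q0 /= => q1a qE.
    by exists n, q1.
  have nE : mup a q = n by rewrite qE mupMr ?mup_XsubCX ?eqxx.
  have := ordq (Some a); rewrite /= E nE => nE'.
  have [i ni] : exists i, n = (i * p + p.-1)%N.
    by apply: (modp n (e + mup a M)); rewrite nE' mulrDr addrAC.
  have := H i; rewrite -ni -/q qE comp_polyM (rmorphXn (comp_poly _)) /=.
  rewrite comp_polyB comp_polyX comp_polyC addrK coefMXn ltnn subnn.
  by rewrite -horner_coef0 horner_comp !hornerE => /eqP; rewrite (negbTE q1a).
move=> /(exactF_frac 0 N M0) H; have := ordq None; rewrite /= E => nE'.
have sq : (0 < size q)%N by rewrite size_poly_gt0.
have [i ni] : exists i, (size q).-1 = (i * p + p.-1)%N.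
  apply: (modp _ (- (e + ordp None M))); rewrite -subn1 -subzn //.
  rewrite mulrN mulrDr -[RHS]opprK opprD !opprK addrAC -nE' /=.
  by rewrite opprB.
have := H i; rewrite addr0 comp_polyXr -ni -lead_coefE => /eqP.
by rewrite lead_coef_eq0 (negbTE q0).
Qed.

Notation Acoef := (Acoef p f).

(** The binomial theorem for y^r = (y^p - f)^r. *)
Lemma expand_frob h :
  h = \sum_(l < p) (y ^+ l) ^+ p * (Acoef (rep h) l)%:A.
Proof.
have algN g : (- g)%:A = - g%:A :> K by rewrite scaleNr.
rewrite {1}(ev_coord ratfun_pchar y_min y_gen h).
have yE : y = (- f)%:A + y ^+ p by rewrite (y_pow y_min) algN addrCA addNr addr0.
have ypow (r : 'I_p) : y ^+ r =
    \sum_(l < p) (y ^+ l) ^+ p * ((- f) ^+ (r - l) *+ 'C(r, l))%:A.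
  rewrite {1}yE exprDn (big_ord_widen p (fun i =>
    ((- f)%:A ^+ (r - i) * (y ^+ p) ^+ i) *+ 'C(r, i))) ?ltn_ord // big_mkcond.
  apply: eq_bigr => l _; case: ltnP => [lr|rl]; last first.
    by rewrite bin_small // mulr0n scale0r mulr0.
  by rewrite -scalerMnl mulrnAr algX mulrC -!exprM mulnC.
under eq_bigr do rewrite ypow scaler_sumr.
rewrite exchange_big /=; apply: eq_bigr => l _.
rewrite /Acoef scaler_suml mulr_sumr; apply: eq_bigr => r _.
by rewrite -scalerA scalerAr.
Qed.

(** By p^-1-linearity the operator maps the term of y^(p l) to y^l times a form
    from k(x), and the y^l are independent over k(x). *)
Lemma cartier_ker h :
  C (h *: dx) = 0 <-> forall l, (l < p)%N -> exactF (Acoef (rep h) l).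
Proof.
rewrite {1}(expand_frob h) scaler_suml C_sum; set A := Acoef (rep h).
have CA (l : 'I_p) : C (((y ^+ l) ^+ p * (A l)%:A) *: dx) = y ^+ l *: C ((A l)%:A *: dx).
  by rewrite -scalerA CZ.
under eq_bigr do rewrite CA.
split=> [H l lp|H]; last first.
  by rewrite big1 // => l _; rewrite (H l (ltn_ord l)) scaler0.
have /fin_all_exists[c cE] := fun l : 'I_p => C_alg (A l).
have : (\sum_(l < p) c l *: y ^+ l) *: dx = 0.
  rewrite -[RHS]H scaler_suml; apply: eq_bigr => i _.
  by rewrite cE scalerA mulr_algr.
move=> /dx_free/(congr1 (fun h => (rep h)`_l)); rewrite rep_sum rep0 coef0 coef_sum.
rewrite (bigD1 (Ordinal lp)) //= rep_mulX // coefZ coefXn eqxx mulr1 big1 => [|i ne].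
  by rewrite addr0 /exactF (cE (Ordinal lp)) => ->; rewrite !scale0r.
rewrite rep_mulX ?ltn_ord // coefZ coefXn; case: eqP => [E|]; last by rewrite mulr0.
by case/negP: ne; apply/eqP/val_inj.
Qed.

Lemma cartier_ker_add w1 w2 : C w1 = 0 -> C w2 = 0 -> C (w1 + w2) = 0.
Proof. by rewrite CD => -> ->; rewrite addr0. Qed.

Lemma cartier_ker_scale (c : k) w : C w = 0 -> C ((cstF k c)%:A *: w) = 0.
Proof.
move=> w0; have -> : (cstF k c)%:A = (cstF k (proot c))%:A ^+ p :> K.
  by rewrite -algX -[c in LHS]prootK (rmorphXn (cstF k)).
by rewrite CZ w0 scaler0.
Qed.

End Kaehler.

(** * Counting and linear algebra *)

Section Counting.
Local Open Scope nat_scope.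

Variables p d gam : nat.
Hypothesis p_prime : prime p.
Hypothesis pE : p = (gam * d).+1.

Let R := p.-1./2.

(** The contribution of a pole of order d to the a-number. *)
Definition kernel_count := \sum_(r < p) (d - 1 - (r %/ gam).*2).

Let gam_d : 0 < gam /\ 0 < d.
Proof. by have := prime_gt1 p_prime; rewrite pE ltnS muln_gt0 => /andP. Qed.

(** The summand is constant on blocks of gam consecutive values of r, so the sum is
    gam times the sum of the positive parts of d - 1 - 2 q. *)
Lemma kernel_countE : 4 * kernel_count = gam * (d ^ 2 - odd d).
Proof.
have [g0 d0] := gam_d.
have blocks (F : nat -> nat) c :
    \sum_(r < gam * c) F (r %/ gam) = gam * \sum_(q < c) F q.
  elim: c => [|c IH]; first by rewrite muln0 !big_ord0 muln0.
  rewrite mulnSr -(big_mkord predT (fun r => F (r %/ gam))).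
  rewrite (@big_cat_nat _ _ _ (gam * c)) ?leq_addr //= big_mkord IH.
  rewrite -[X in \sum_(X <= _ < _) _]add0n big_addn addKn big_mkord big_ord_recr mulnDr /=.
  congr (_ + _); rewrite -[X in X * F c](card_ord gam) -sum_nat_const.
  by apply: eq_bigr => i _; rewrite addnC mulnC divnMDl // divn_small ?addn0.
have Fc c : 4 * \sum_(q < c) (c - 1 - q.*2) = c ^ 2 - odd c.
  have [n] := ubnP c; elim: n c => // n IH [|[|c]] cn; rewrite ?big_ord0 //.
    by rewrite big_ord_recl big_ord0.
  rewrite big_ord_recl big_ord_recr /= mulnDr mulnDr.
  have -> : \sum_(i < c) (c.+2 - 1 - (bump 0 i).*2) = \sum_(i < c) (c - 1 - i.*2).
    by apply: eq_bigr => i _; rewrite /bump leq0n; lia.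
  rewrite IH; last by lia.
  have : odd c <= c ^ 2 by case: (c) => // c'; rewrite (leq_trans (leq_b1 _)) // expn_gt0.
  by rewrite negbK /bump leq0n; case: odd => /=; nia.
rewrite /kernel_count pE big_ord_recr /=.
rewrite (blocks (fun q => d - 1 - q.*2)) mulKn // mulnDr mulnCA Fc.
by rewrite (_ : d - 1 - d.*2 = 0) ?muln0 ?addn0 //; lia.
Qed.

(* Whether the pole of f is the point at infinity. *)
Variable b : bool.

(** The bound on the pole of the coordinate of y^r in a regular form. At infinity
    it counts from a simple zero, and dx itself has a double pole there, which
    makes it one less than at a finite point. *)
Definition pole_bound r := d - b - r %/ gam.
(** No nonzero element of the kernel of the Cartier operator has all its
    coordinates within this bound. *)
Definition low_bound r := minn (pole_bound r) ((r %/ gam).+1 - b).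
(** The bound on the pole of the coordinate of y^l in the image of the Cartier
    operator, for forms of degree less than R in y. *)
Definition image_bound l := (R.-1 - l) %/ gam + 1 - b.

Lemma bound_diff r : pole_bound r - low_bound r = d - 1 - (r %/ gam).*2.
Proof. by rewrite /low_bound /pole_bound; case: b => /=; move: (r %/ gam) => q; lia. Qed.

Lemma half_quot r : r < R -> (r %/ gam).*2 < d.
Proof.
case: gam_d => g0 d0; rewrite /R pE /= => rR.
have := leq_trunc_div r gam; move: (r %/ gam) => q qr.
have : r.*2.+1 < gam * d by lia.
nia.
Qed.

Lemma half_quot_ge r : R <= r -> d <= (r %/ gam).*2.+1.
Proof.
case: gam_d => g0 d0 Rr.
have rlt := ltn_ceil r g0; move: (r %/ gam) rlt => q rlt.
have [p2|po] := even_prime p_prime; first by move: pE; rewrite p2; nia.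
have : R.*2 = gam * d.
  by rewrite /R pE /= -[RHS]odd_double_half; move: po; rewrite pE /=; case: odd.
nia.
Qed.

(** The left-hand side bounds the pole of (- f)^(r - l) g for a coordinate g of y^r;
    the operator divides such orders by p. *)
Lemma image_bound_ge l r : l <= r < R ->
  pole_bound r + (r - l) * d <= p * image_bound l + b * p.-1.
Proof.
have [g0 d0] := gam_d; case/andP=> lr rR.
have := ltn_ceil (R.-1 - l) g0; rewrite /image_bound.
move: ((R.-1 - l) %/ gam) => E RE.
have RE' : R - l <= E.+1 * gam by lia.
have rRl : (r - l) * d + d <= (R - l) * d by rewrite -mulSnr leq_mul2r; lia.
have : (R - l) * d <= E.+1 * (gam * d) by rewrite mulnA leq_mul2r RE' orbT.
rewrite /pole_bound pE; move: (r %/ gam) (gam * d) rRl => q G rRl RG.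
by move: b; case; lia.
Qed.

(** The forms of degree less than (p - 1)/2 in y suffice: their number of
    parameters exceeds the number of conditions for lying in the kernel by the
    expected dimension. After the reversal of l, the comparison is termwise. *)
Lemma kernel_count_le :
  kernel_count + \sum_(l < R) image_bound l <= \sum_(r < R) pole_bound r.
Proof.
have Rp : R <= p by rewrite /R; lia.
have -> : kernel_count = \sum_(r < R) (d - 1 - (r %/ gam).*2).
  rewrite /kernel_count (big_ord_widen p (fun r => d - 1 - (r %/ gam).*2) Rp).
  rewrite [RHS]big_mkcond; apply: eq_bigr => r _; case: ltnP => // /half_quot_ge.
  by move: (r %/ gam) => q; lia.
have -> : \sum_(l < R) image_bound l = \sum_(r < R) (r %/ gam + 1 - b).
  rewrite (reindex_inj rev_ord_inj) /=; apply: eq_bigr => r _.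
  have rR := ltn_ord r; rewrite /image_bound; congr (_ %/ gam + 1 - b).
  by lia.
rewrite -big_split; apply: leq_sum => r _ /=.
have := half_quot (ltn_ord r); rewrite /pole_bound.
by case: b => /=; move: (r %/ gam) => q; lia.
Qed.

End Counting.

Lemma a_termE (p d gam : nat) : prime p -> p = (gam * d).+1 ->
  (kernel_count p d gam)%:R = a_term p d.
Proof.
move=> pp pE; have := kernel_countE pp pE; set c := kernel_count _ _ _ => cE.
have d0 : d%:R != 0 :> rat.
  rewrite pnatr_eq0 -lt0n; have := prime_gt1 pp.
  by rewrite pE ltnS muln_gt0 => /andP[].
have p1 : p%:R - 1 = gam%:R * d%:R :> rat by rewrite pE -natr1 natrM addrK.
have cR : 4 * c%:R = gam%:R * (d%:R ^+ 2 - (odd d)%:R) :> rat.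
  rewrite -natrX -natrB; last by rewrite (leq_trans (leq_b1 _)) // expn_gt0 lt0n -(pnatr_eq0 rat) d0.
  by rewrite -!natrM cE.
have four : 4 != 0 :> rat by [].
apply: (mulfI four); rewrite cR /a_term p1; case: odd.
  by rewrite /= mulr1n; field; rewrite d0.
by rewrite /= mulr0n subr0; field.
Qed.

(** The dimension of S is squeezed: S contains the common kernel of the nu_l in the
    span of the e_j, of dimension at least #|J| - #|L|, while the forms lam_i,
    which separate the elements of S, bound the dimension by #|I|. The basis is
    found in that common kernel, and the first conclusion records this. *)
Lemma squeeze_dim (k : fieldType) (V : lmodType k) (I J L : finType)
    (lam : I -> V -> k) (e : J -> V) (nu : L -> V -> k) (S : V -> Prop) :
  (forall i, linear (lam i : V -> k^o)) -> (forall l, linear (nu l : V -> k^o)) ->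
  (forall u v (a : k), S u -> S v -> S (a *: u + v)) ->
  (forall v, S v -> (forall i, lam i v = 0) -> v = 0) ->
  (forall c : J -> k, let v := \sum_j c j *: e j in
     (forall l, nu l v = 0) -> S v) ->
  (forall c : J -> k, \sum_j c j *: e j = 0 -> forall j, c j = 0) ->
  (#|I| + #|L| <= #|J|)%N ->
  exists b : 'I_#|I| -> V,
    [/\ forall c : 'I_#|I| -> k, exists c' : J -> k,
          \sum_i c i *: b i = \sum_j c' j *: e j /\
          forall l, nu l (\sum_j c' j *: e j) = 0,
        forall c : 'I_#|I| -> k, \sum_i c i *: b i = 0 -> forall i, c i = 0 &
        forall v, S v -> exists c : 'I_#|I| -> k, v = \sum_i c i *: b i].
Proof.
move=> lamL nuL SL lam_inj nuS e_free le; set a := #|I|.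
have lin_sum (phi : V -> k) (K : finType) (c : K -> k) (v : K -> V) :
    linear (phi : V -> k^o) -> phi (\sum_i c i *: v i) = \sum_i c i * phi (v i).
  move=> phiL; pose phi' : {linear V -> k^o} := HB.pack (phi : V -> k^o)
    (GRing.isLinear.Build k V k^o _ (phi : V -> k^o) phiL).
  rewrite -[phi _]/(phi' _) linear_sum; apply: eq_bigr => i _.
  by rewrite linearZ.
pose Z : 'M[k]_(#|J|, #|L|) := \matrix_(j, l) nu (enum_val l) (e (enum_val j)).
pose r := \rank (kermx Z).
have ar : (a <= r)%N.
  by rewrite /r mxrank_ker; have := rank_leq_col Z; move: le; rewrite -/a; lia.
pose B : 'M[k]_(a, #|J|) := pid_mx a *m row_base (kermx Z).
have B0 : B *m Z = 0.
  rewrite -mulmxA (_ : row_base _ *m Z = 0) ?mulmx0 //.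
  by apply/sub_kermxP; rewrite eq_row_base.
have B_free : row_free B.
  by rewrite /row_free mxrankMfree ?row_base_free // rank_pid_mx.
pose vec (u : 'rV[k]_(#|J|)) := \sum_j u 0 (enum_rank j) *: e j.
have vec_nu u : u *m Z = 0 -> forall l, nu l (vec u) = 0.
  move=> uZ l; rewrite lin_sum //; move/matrixP: uZ => /(_ 0 (enum_rank l)).
  rewrite !mxE => E; rewrite -[RHS]E (reindex enum_rank) /=; last first.
    by apply: onW_bij; apply: enum_rank_bij.
  by apply: eq_bigr => j _; rewrite !mxE !enum_rankK.
pose b i := vec (row i B).
have bE (c : 'I_a -> k) : \sum_i c i *: b i = vec ((\row_i c i) *m B).
  rewrite /b /vec; under eq_bigr do rewrite scaler_sumr.
  rewrite exchange_big; apply: eq_bigr => j _ /=.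
  rewrite mxE scaler_suml; apply: eq_bigr => i _.
  by rewrite scalerA !mxE.
have S_vec u : u *m Z = 0 -> S (vec u).
  by move=> uZ; apply: (nuS (fun j => u 0 (enum_rank j))); apply: vec_nu.
have S_b c : S (\sum_i c i *: b i).
  by rewrite bE; apply: S_vec; rewrite -mulmxA B0 mulmx0.
have b_free (c : 'I_a -> k) : \sum_i c i *: b i = 0 -> forall i, c i = 0.
  rewrite bE => /e_free H i; set u := _ *m B in H.
  have u0 : u = 0.
    by apply/rowP => j; have := H (enum_val j); rewrite enum_valK => ->; rewrite mxE.
  have /rowP/(_ i) : (\row_i c i) = 0 :> 'rV[k]_a.
    by apply: (row_free_inj B_free); rewrite mul0mx.
  by rewrite !mxE.
pose T : 'M[k]_a := \matrix_(i, i') lam (enum_val i') (b i).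
have T_unit : T \in unitmx.
  rewrite -row_free_unit; apply/inj_row_free => u uT.
  apply/rowP => i; rewrite mxE; apply: (b_free (fun i => u 0 i)).
  apply: lam_inj (S_b _) _ => i'; rewrite lin_sum //.
  move/matrixP: uT => /(_ 0 (enum_rank i')); rewrite !mxE => uT.
  by rewrite -[RHS]uT; apply: eq_bigr => l _; rewrite !mxE enum_rankK.
exists b; split=> // [c|v Sv].
  pose u := (\row_i c i) *m B; exists (fun j => u 0 (enum_rank j)).
  by rewrite bE; split=> //; apply: vec_nu; rewrite -mulmxA B0 mulmx0.
pose c := (\row_i' lam (enum_val i') v) *m invmx T.
exists (fun i => c 0 i); apply/eqP; rewrite -subr_eq0; apply/eqP.
have -> : v - \sum_i c 0 i *: b i = (- 1) *: (\sum_i c 0 i *: b i) + v.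
  by rewrite scaleN1r addrC.
apply: lam_inj => [|i]; first exact: SL.
rewrite lamL /= lin_sum //.
have : c *m T = \row_i' lam (enum_val i') v by rewrite mulmxKV.
move/matrixP/(_ 0 (enum_rank i)); rewrite !mxE enum_rankK => <-.
rewrite -[_ *: _]/(-1 * _) mulN1r -sumrN -big_split big1 // => l _ /=.
by rewrite !mxE enum_rankK addNr.
Qed.

(** * Divisors on the projective line *)

Section Divisors.

Variables (k : closedFieldType) (m : nat) (P : 'I_m.+1 -> option k).
Hypothesis P_inj : injective P.

Implicit Types (n : 'I_m.+1 -> nat) (Q : option k) (g : ratfun k) (N M : {poly k}).

(** The denominator of the functions with poles bounded by the effective divisor
    that has multiplicities n at the points P j. A condition at infinity does
    not show in it, but only in degrees of numerators. *)
Definition Den n : {poly k} :=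
  \prod_j (if P j is Some a then ('X - a%:P) ^+ n j else 1).

Definition mult n Q : nat := \sum_(j | P j == Q) n j.

Definition deg n : nat := \sum_j n j.

Lemma multP n j : mult n (P j) = n j.
Proof.
by rewrite /mult (big_pred1 j) // => i; apply/eqP/eqP => [/P_inj|->].
Qed.

Lemma mult_out n Q : (forall j, P j <> Q) -> mult n Q = 0%N.
Proof. by move=> H; rewrite /mult big_pred0 // => j; apply/eqP/H. Qed.

Lemma mult0 Q : mult (fun=> 0%N) Q = 0%N.
Proof. by rewrite /mult big1. Qed.

Lemma Den_monic n : Den n \is monic.
Proof.
rewrite /Den; apply: rpred_prod => j _; case: (P j) => [a|]; last exact: rpred1.
by apply: rpredX; apply: monicXsubC.
Qed.

Lemma Den_neq0 n : Den n != 0. Proof. exact/monic_neq0/Den_monic. Qed.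

Lemma DenF_neq0 n : (Den n)%:F != 0. Proof. by rewrite tofrac_eq0 Den_neq0. Qed.

Lemma DenD n1 n2 : Den (fun j => n1 j + n2 j)%N = Den n1 * Den n2.
Proof.
rewrite /Den -big_split; apply: eq_bigr => j _.
by case: (P j) => [a|] /=; rewrite ?exprD ?mulr1.
Qed.

Lemma Den_exp n i : Den (fun j => i * n j)%N = Den n ^+ i.
Proof.
rewrite /Den -prodrXl; apply: eq_bigr => j _.
by case: (P j) => [a|]; rewrite ?expr1n // -exprM mulnC.
Qed.

Lemma eq_Den n1 n2 : (forall j, P j != None -> n1 j = n2 j) -> Den n1 = Den n2.
Proof.
by move=> H; apply: eq_bigr => j _; have := H j; case: (P j) => // a ->.
Qed.

Lemma ordp_prod Q (I : Type) (s : seq I) (E : I -> {poly k}) :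
  (forall i, E i != 0) -> ordp Q (\prod_(i <- s) E i) = \sum_(i <- s) ordp Q (E i).
Proof.
move=> E0; elim: s => [|i s IH]; first by rewrite !big_nil ordpC ?oner_eq0.
rewrite !big_cons ordpM ?IH //; elim/big_ind: _ => [|a b a0 b0|j _] //.
  exact: oner_neq0.
exact: mulf_neq0.
Qed.

Lemma ordp_Den Q n :
  ordp Q (Den n) = (mult n Q)%:Z - (if Q is None then (deg n)%:Z else 0).
Proof.
rewrite /Den ordp_prod; last first.
  by move=> j; case: (P j) => [a|]; rewrite ?oner_eq0 // expf_neq0 ?polyXsubC_eq0.
have -> : (mult n Q)%:Z - (if Q is None then (deg n)%:Z else 0)
    = \sum_j ((if P j == Q then (n j)%:Z else 0) - (if Q is None then (n j)%:Z else 0)).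
  rewrite sumrB /mult /deg big_mkcond !(big_morph Posz PoszD (erefl 0%:Z)); congr (_ - _).
    by apply: eq_bigr => j _; case: ifP.
  by case: Q => // a; rewrite big1.
apply: eq_bigr => j _; case: (P j) => [b|]; case: Q => [a|] /=.
- by rewrite mup_XsubCX subr0; have [->|ne] := eqVneq b a;
    rewrite ?eqxx //; case: eqP => // -[/eqP]; rewrite (negbTE ne).
- by rewrite size_exp_XsubC; lia.
- by rewrite mupNroot ?root1.
- by rewrite size_poly1 !subrr.
Qed.

(** A root of the denominator is a root of the numerator, and they cancel. *)
Lemma mup_frac_poly g : (forall a, vge (ordP1 (Some a)) 0 g) -> exists N, g = N%:F.
Proof.
have [N [M [M0 ->]]] := ratfunP g.
have [s] := ubnP (size M); elim: s N M M0 => // s IH N M M0 sM H.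
have [->|N0] := eqVneq N 0; first by exists 0; rewrite rmorph0 mul0r.
have [sM1|sM1] := boolP (size M == 1%N).
  have [c c0 ->] := size_poly1P _ sM1.
  exists (c^-1 *: N); apply/eqP; rewrite -[_%:F in X in _ == X]divr1 -(rmorph1 (@FracField.tofrac {poly k})).
  rewrite eq_frac ?oner_eq0 ?polyC_eq0 // mulr1 -mul_polyC mulrAC -polyCM mulVf //.
  by rewrite mul1r.
have [a Ma] := closed_rootP M sM1.
have MmN : (1 <= mup a N)%N.
  have := H a; rewrite frac_ge // (negbTE N0) /= add0r lez_nat; apply: leq_trans.
  by rewrite mup_geq // expr1 dvdp_XsubCl.
have /dvdpP[N1 NE] : 'X - a%:P %| N by rewrite -[_ - _]expr1 -mup_geq.
have /factor_theorem[M1 ME] := Ma.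
have M10 : M1 != 0 by apply: contraNneq M0 => M10; rewrite ME M10 mul0r.
have gE : N%:F / M%:F = N1%:F / M1%:F.
  by apply/eqP; rewrite eq_frac // NE ME; apply/eqP; ring.
rewrite gE in H *; apply: IH H => //.
by move: sM; rewrite ME size_Mmonic ?monicXsubC // size_XsubC; lia.
Qed.

(** The Riemann-Roch space of a divisor on the projective line. The integer c
    moves the condition at infinity: for c = 1, the dimension is the degree. *)
Lemma divisor_frac n g (c : int) :
  (forall Q, vge (ordP1 Q) ((if Q is None then c else 0) - (mult n Q)%:Z) g) ->
  exists N, (size N)%:Z <= Num.max 0 ((deg n)%:Z + 1 - c) /\ g = N%:F / (Den n)%:F.
Proof.
move=> H; have [->|g0] := eqVneq g 0.
  by exists 0; rewrite size_poly0 rmorph0 mul0r le_max lexx.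
have gD0 : g * (Den n)%:F != 0 by rewrite mulf_neq0 ?DenF_neq0.
have ordD Q : ordP1 Q (Den n)%:F = ordp Q (Den n).
  rewrite -[X in ordP1 Q X]divr1 -(rmorph1 (@FracField.tofrac {poly k})).
  by rewrite ordP1E ?Den_neq0 ?oner_eq0 // [ordp Q 1](ordpC _ (oner_neq0 _)) subr0.
have [|N NE] := mup_frac_poly (g := g * (Den n)%:F).
  move=> a; apply: vge_le (vgeM (ordP1_place (Some a)) (H (Some a)) (vge_v _ _)).
  by rewrite ordD ordp_Den subr0 sub0r addNr.
exists N; split; last by rewrite -NE mulfK ?DenF_neq0.
have N0 : N != 0 by apply: contraNneq gD0 => N0; rewrite NE N0 rmorph0.
have := H None; rewrite (vgeE _ _ g0) => HN.
have : ordP1 None (g * (Den n)%:F) = 1 - (size N)%:Z.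
  rewrite NE -[X in ordP1 _ X]divr1 -(rmorph1 (@FracField.tofrac {poly k})).
  by rewrite ordP1E ?oner_eq0 // [ordp None 1](ordpC _ (oner_neq0 _)) subr0.
rewrite (ordP1M None g0 (DenF_neq0 n)) ordD ordp_Den le_max => E; apply/orP; right.
move: HN E; move: (ordP1 None g) (mult n None) (deg n) => o a b; size_lia.
Qed.

Lemma divisor_ge n N Q : (size N <= deg n)%N ->
  vge (ordP1 Q) ((if Q is None then 1 else 0) - (mult n Q)%:Z) (N%:F / (Den n)%:F).
Proof.
move=> sN; rewrite frac_ge ?Den_neq0 // ordp_Den.
have [//|N0 /=] := eqVneq N 0.
by case: Q => [a|] /=; [lia | move: sN; size_lia].
Qed.

(** The degree of the part of the divisor away from infinity. *)
Definition fdeg n : nat := \sum_(j | P j != None) n j.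

Lemma degE n : deg n = (mult n None + fdeg n)%N.
Proof. by rewrite /deg (bigID (fun j => P j == None)). Qed.

Lemma size_Den n : size (Den n) = (fdeg n).+1.
Proof.
have := ordp_Den None n; rewrite /= degE.
by move: (mult n None) (fdeg n) => a b; size_lia.
Qed.

End Divisors.

(** * The curve and its poles *)

Lemma quot_identity (F : fieldType) (N D F0 Df E : F) h :
  D != 0 -> Df != 0 -> E != 0 ->
  N / D * (F0 / Df) ^+ h = N * (F0 ^+ h * E) / (D * Df ^+ h * E).
Proof.
move=> D0 Df0 E0; have Dh0 : Df ^+ h != 0 by rewrite expf_neq0.
by rewrite expr_div_n; field; rewrite D0 Dh0 E0.
Qed.

Section ArtinSchreierCurve.

Variables (k : closedFieldType) (p : nat).
Hypothesis p_char : p \in [pchar k].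
Variable f : ratfun k.
Hypothesis f_neq0 : f != 0.
Variables (K : fieldExtType (ratfun k)) (y : K).
Hypothesis y_min : minPoly 1%VS y = 'X^p - 'X - (f%:A)%:P.
Hypothesis y_gen : <<1; y>>%VS = fullv.
Variables (Omega : lmodType K) (d : K -> Omega).
Hypothesis Omega_d : is_kaehler d.
Variable C : Omega -> Omega.
Hypothesis C_cartier : is_cartier d p C.
Variables (m : nat) (P : 'I_m.+1 -> option k).
Hypothesis P_inj : injective P.
Variables (ord gam : 'I_m.+1 -> nat).
Hypothesis P_poles : forall Q, ordP1 Q f < 0 -> exists j, Q = P j.
Hypothesis P_ord : forall j, ordP1 (P j) f = - (ord j)%:Z.
Hypothesis pE : forall j, p = (gam j * ord j).+1.

Notation F := (ratfun k).
Notation pF := (ratfun_pchar p_char).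
Notation rep := (rep pF y_min y_gen).
Notation DK := (derK pF y_min y_gen (der (k:=k))).
Notation dx := (dx d).
Notation exactF := (exactF d C).
Notation Acoef := (Acoef p f).
Notation mult := (mult P).
Notation at_inf Q c := (if Q is None then c else 0).

Let p_prime : prime p. Proof. exact: (pcharf_prime p_char). Qed.
Let p_gt1 : (1 < p)%N. Proof. exact: prime_gt1. Qed.

Let isinf j : bool := P j == None.

Definition pbound r j := pole_bound (ord j) (gam j) (isinf j) r.
Definition lbound r j := low_bound (ord j) (gam j) (isinf j) r.

Let gam_ord j : (0 < gam j)%N /\ (0 < ord j)%N.
Proof. by move: p_gt1; rewrite (pE j) ltnS muln_gt0 => /andP. Qed.

Let ord_k j : (ord j)%:R != 0 :> k.
Proof.
have [g0 o0] := gam_ord j.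
rewrite -(dvdn_pcharf p_char) gtnNdvd //.
by rewrite (pE j) ltnS leq_pmull.
Qed.

Let Nf_neq0 : - f != 0. Proof. by rewrite oppr_eq0. Qed.

Lemma quot_le r j : (r < p)%N -> (r %/ gam j <= ord j)%N.
Proof.
have [g0 o0] := gam_ord j; rewrite {1}(pE j) ltnS => rp.
by rewrite -(mulKn (ord j) g0) leq_div2r.
Qed.

Lemma pole_or_not Q : (exists j, Q = P j) \/ (forall j, P j <> Q).
Proof.
have [/existsP[j /eqP <-]|nex] := boolP [exists j, P j == Q]; first by left; exists j.
by right=> j E; case/negP: nex; apply/existsP; exists j; rewrite E.
Qed.

Lemma f_nonpole Q : (forall j, P j <> Q) -> vge (ordP1 Q) 0 f.
Proof.
move=> nQ; rewrite (vgeE _ _ f_neq0) leNgt; apply/negP => /P_poles[j jE].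
by case: (nQ j); rewrite jE.
Qed.

Lemma f_order Q : vge (ordP1 Q) (- (mult ord Q)%:Z) f.
Proof.
have [[j ->]|nQ] := pole_or_not Q; first by rewrite multP // -P_ord vge_v.
by rewrite mult_out // oppr0 f_nonpole.
Qed.

Lemma f_powN_order Q i : vge (ordP1 Q) (- (i * mult ord Q)%N%:Z) ((- f) ^+ i).
Proof.
have Nf : vge (ordP1 Q) (- (mult ord Q)%:Z) (- f).
  by rewrite (vgeN (ordP1_place Q)) f_order.
by apply: vge_le (vgeX (ordP1_place Q) i Nf); rewrite pmulrn mulrzz; lia.
Qed.

(** * Coordinates of regular forms *)

Lemma regular_at_expand O h : regular_at d O (h *: dx) ->
  exists n (a b : 'I_n -> K), (forall i, O (a i) /\ O (b i)) /\
    h = \sum_i a i * DK (b i).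
Proof.
case=> n [a [b [ab hE]]]; exists n, a, b; split=> //.
apply/eqP; rewrite -subr_eq0; apply/eqP.
apply: (dx_free p_char y_min y_gen Omega_d).
rewrite scalerBl hE scaler_suml; apply/eqP; rewrite subr_eq0; apply/eqP.
by apply: eq_bigr => i _; rewrite (dE p_char y_min y_gen Omega_d) scalerA.
Qed.

Lemma ramified_point j : is_point (wgeK pF y_min y_gen (ordP1 (P j)) (ord j) 0).
Proof.
have vP := ordP1_place (P j); have H1 := P_ord j; have H2 := ord_k j.
split.
- exact: (wgeK_cst pF y_min y_gen vP f_neq0 H1 H2).
- move=> a b Ha Hb; apply: (wgeK_D vP f_neq0 H1 H2) Ha _.
  exact: (wgeK_N vP).
- move=> a b Ha Hb; have := wgeK_M vP f_neq0 H1 H2 Ha Hb.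
  by rewrite addr0.
- exact: (wgeK_val pF y_min y_gen vP f_neq0 H1 H2).
- by eexists; apply: (wgeK_proper vP f_neq0 H1 H2).
Qed.

Lemma unramified_point Q (alpha : k) :
  vge (ordP1 Q) 1 (f - cstF k (alpha ^+ p - alpha)) ->
  is_point (regK pF y_min y_gen (cstF k) (ordP1 Q) alpha).
Proof.
move=> Ha; have vP := ordP1_place Q; split.
- exact: (regK_cst pF y_min y_gen vP).
- move=> a b Hx Hy; apply: (regK_D vP) Hx _; exact: (regK_N vP).
- move=> a b; exact: (regK_M vP Ha).
- exact: (regK_val pF y_min y_gen vP Ha).
- by eexists; apply: (regK_proper vP).
Qed.

(** The residue of y at a point where f has the residue c. *)
Lemma root_ex (c : k) : exists a, a ^+ p - a = c.
Proof.
have [a aE] := solve_monicpoly (fun i => if i == 0%N then c else if i == 1%N then 1 else 0)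
  (prime_gt0 p_prime).
exists a; rewrite aE (bigD1 (Ordinal (prime_gt0 p_prime))) //= mulr1.
rewrite (bigD1 (Ordinal p_gt1)) //= mul1r expr1 big1 => [|i].
  by rewrite addr0 addrK.
by rewrite -!val_eqE /= => /andP[/negbTE-> /negbTE->]; rewrite mul0r.
Qed.

(** Regularity is tested at explicit points above Q only: the ramified one if Q is
    a pole of f, and all of the p unramified ones if not. *)
Lemma regular_coord h : regular_form d (h *: dx) -> forall r Q, (r < p)%N ->
  vge (ordP1 Q) (at_inf Q 1 - (mult (pbound r) Q)%:Z) (rep h)`_r.
Proof.
move=> H r Q rp; have vP := ordP1_place Q.
have rescale n g : vge (ordP1 Q) n (g / der (unifP1 Q)) ->
    vge (ordP1 Q) (n + at_inf Q 2) g.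
  have th0 := place_dert vP; move=> Hn; rewrite -(ord_der_unif Q).
  have -> : g = g / der (unifP1 Q) * der (unifP1 Q) by rewrite divfK.
  exact: (vgeM vP) Hn (vge_v _ _).
have [[j QE]|nQ] := pole_or_not Q.
  have vPj := ordP1_place (P j).
  have [n [a [b [ab hE]]]] := regular_at_expand (H _ (ramified_point j)).
  have := ramified_bound vPj f_neq0 (P_ord j) (ord_k j) (pE j) ab hE rp.
  rewrite -QE => /rescale; apply: vge_le; rewrite QE multP //.
  have := quot_le j rp; rewrite /pbound /pole_bound /isinf.
  by case: (P j) => [c|] /=; move: (r %/ gam j)%N (ord j) => q o; lia.
have f0 := f_nonpole nQ; have [c Hc] := place_res vP f0.
have [alpha aE] := root_ex c; rewrite -aE in Hc.
have : vge (ordP1 Q) 0 ((rep h)`_r / der (unifP1 Q)).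
  apply: (unramified_bound vP Hc) => i.
  apply: regular_at_expand; apply: H; apply: unramified_point.
  exact: (shift_root pF i Hc).
move/rescale; apply: vge_le; rewrite mult_out //.
by case: (Q).
Qed.

(** * The Cartier operator and pole orders *)

(** Suppose that A is not zero, and let R be its degree. A function that
    vanishes at infinity has a pole or is zero, so at some P j the order of A_R
    is below 0, or below 1 if P j is infinity; let n be the difference. For
    l = R - gam (n - 1), or l = R - gam n if P j is infinity, the term of A_R
    has the strictly least order in Acoef A l, because (- f)^(R - l) outweighs
    the poles of the coordinates below R. This order is -1 modulo p for the
    form, so the form is not exact. The bound on n is what makes l nonnegative. *)
Lemma low_kernel_zero (A : {poly F}) : (size A <= p)%N ->
  (forall r Q, (r < p)%N ->
     vge (ordP1 Q) (at_inf Q 1 - (mult (lbound r) Q)%:Z) A`_r) ->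
  (forall l, (l < p)%N -> exactF (Acoef A l)) -> A = 0.
Proof.
move=> sA HA HC; apply/eqP; apply: contraT => A0.
have sA0 : (0 < size A)%N by rewrite size_poly_gt0.
set R := (size A).-1; have Rp : (R < p)%N by rewrite /R prednK.
have AR0 : A`_R != 0 by rewrite -lead_coefE lead_coef_eq0.
have [Q nQ] : exists Q, ~ vge (ordP1 Q) (at_inf Q 1) A`_R.
  apply: NNPP => nex.
  have [|N [sN AE]] := @divisor_frac k m P (fun=> 0%N) A`_R 1.
    by move=> Q; rewrite mult0 subr0; apply: NNPP => nQ; apply: nex; exists Q.
  have N0 : N = 0.
    apply/eqP; rewrite -size_poly_eq0; move: sN; rewrite /deg big1 // addrK maxxx.
    by rewrite lez_nat leqn0.
  by move: AR0; rewrite AE N0 rmorph0 mul0r eqxx.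
have HAR := HA R Q Rp.
have [[j QE]|nP] := pole_or_not Q; last first.
  by case: nQ; move: HAR; rewrite mult_out // subr0.
have vP := ordP1_place Q.
pose n := `|(at_inf Q 1 - ordP1 Q A`_R)%R|%N.
have [g0 o0] := gam_ord j.
have [nE n0] : ordP1 Q A`_R = at_inf Q 1 - n%:Z /\ (0 < n)%N.
  move: nQ; rewrite (vgeE _ _ AR0) => /negP; rewrite -ltNge /n.
  by move: (ordP1 Q _) (at_inf Q 1) => o c oc; split; lia.
have nl : (n <= lbound R j)%N.
  by move: HAR; rewrite (vgeE _ _ AR0) nE QE multP //; lia.
pose s := (n - 1 + isinf j)%N.
have sq : (s <= R %/ gam j)%N.
  move: nl n0; rewrite /lbound /low_bound leq_min /s => /andP[_].
  by move: (isinf j : nat) (leq_b1 (isinf j)) (R %/ gam j)%N; clear; lia.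
have gsR : (gam j * s <= R)%N.
  by rewrite mulnC (leq_trans _ (leq_trunc_div R (gam j))) // leq_mul2r sq orbT.
set l := (R - gam j * s)%N.
have lR : (l <= R)%N by rewrite leq_subr.
have RlE : (R - l = gam j * s)%N by rewrite subKn.
have fl0 : (- f) ^+ (R - l) != 0 := expf_neq0 _ Nf_neq0.
have vfi i : ordP1 Q ((- f) ^+ i) = - (i * ord j)%N%:Z.
  by rewrite (vX vP i Nf_neq0) (vN vP) QE P_ord pmulrn mulrzz mulrC mulrN.
have vlead : ordP1 Q (A`_R * (- f) ^+ (R - l))
    = at_inf Q 1 - n%:Z - (gam j * s * ord j)%N%:Z.
  by rewrite (placeM vP AR0 fl0) nE vfi RlE.
have infE : isinf j = (if Q is None then true else false) by rewrite /isinf QE; case: (P j).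
have [|||AC0 ACv] := @Acoef_order _ _ _ _ _ _ p f vP p_char A R l _ _ _ vlead.
- by rewrite lR.
- exact: mulf_neq0 AR0 fl0.
- move=> r /andP[lr rp] rR.
  have [Rr|rltR] := ltnP R r.
    by rewrite nth_default ?mul0r ?vge0 // -(prednK sA0).
  have {rR}rltR : (r < R)%N by rewrite ltn_neqAle rR.
  have bnd : (lbound r j <= ord j - isinf j)%N.
    by rewrite /lbound /low_bound /pole_bound geq_min leq_subr.
  have := vgeM vP (HA r Q rp) (f_powN_order Q (r - l)).
  apply: vge_le; rewrite QE !multP //; rewrite -QE.
  have key : ((r - l) * ord j + ord j <= gam j * s * ord j)%N.
    by rewrite -RlE -mulSnr leq_mul2r (ltn_sub2r (leq_ltn_trans lr rltR) rltR) orbT.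
  move: bnd key n0; move: ((r - l) * ord j)%N (gam j * s * ord j)%N.
  by move: (n) (lbound r j) (at_inf Q 1) (isinf j : nat) (ord j); clear; lia.
case: (exactF_order p_char y_min y_gen Omega_d C_cartier (Q := Q) (e := - s%:Z) AC0).
  have -> : p%:Z * (- s%:Z) = - (gam j * s * ord j)%N%:Z - s%:Z.
    by rewrite (pE j) mulnAC -addn1 PoszD PoszM; clear; lia.
  rewrite ACv /s infE; move: n0; move: (n) (gam j * _ * _)%N; clear.
  by case: (Q) => [c|] /= n' G; lia.
by apply: HC; apply: leq_ltn_trans lR Rp.
Qed.

(** If infinity is not a pole of f, the bounds on the coordinates allow a simple
    pole of the form there. The last coordinate r that has such a pole gives
    Acoef A r the order 1 at infinity, and the form has order -1. *)
Lemma infinity_order (A : {poly F}) : (forall j, P j <> None) ->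
  (size A <= p)%N -> (forall r, (r < p)%N -> vge (ordP1 None) 1 A`_r) ->
  (forall l, (l < p)%N -> exactF (Acoef A l)) ->
  forall r, (r < p)%N -> vge (ordP1 None) 2 A`_r.
Proof.
move=> nP sA HA HC; have vP := ordP1_place (@None k).
suff H n r : (p - r <= n)%N -> (r < p)%N -> vge (ordP1 None) 2 A`_r.
  by move=> r; apply: (H p); rewrite leq_subr.
elim: n r => [|n IH] r; first by lia.
move=> rn rp; apply: contraT => nr.
have Ar0 : A`_r != 0 by apply: contraNneq nr => ->; rewrite vge0.
have vr : ordP1 None A`_r = 1.
  by move: (HA r rp) nr; rewrite !(vgeE _ _ Ar0); move: (ordP1 _ _) => o; lia.
have vlead : ordP1 None (A`_r * (- f) ^+ (r - r)) = 1 by rewrite subnn expr0 mulr1.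
have [|||AC0 ACv] := @Acoef_order _ _ _ _ _ _ p f vP p_char A r r _ _ _ vlead.
- by rewrite leqnn.
- by rewrite subnn expr0 mulr1.
- move=> r' /andP[rr' r'p] ne; have lt : (r < r')%N by rewrite ltn_neqAle eq_sym ne.
  have A2 : vge (ordP1 None) 2 A`_r' by apply: IH => //; lia.
  have := vgeM vP A2 (f_powN_order None (r' - r)).
  by rewrite mult_out // muln0.
case: (exactF_order p_char y_min y_gen Omega_d C_cartier (Q := None) (e := 0) AC0).
  by rewrite ACv mulr0.
exact: HC.
Qed.

(** * Forms with bounded poles are regular *)

(** This is a converse to the bounds of regular_coord, for forms in the kernel of
    the Cartier operator. The bounds on the coordinates are only sharp at
    infinity if it is a pole of f; otherwise the kernel makes up for it. *)
Lemma bound_regular h : (forall r, (p.-1 <= r)%N -> (rep h)`_r = 0) ->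
  (forall r Q, (r < p)%N ->
     vge (ordP1 Q) (at_inf Q 1 - (mult (pbound r) Q)%:Z) (rep h)`_r) ->
  C (h *: dx) = 0 -> regular_form d (h *: dx).
Proof.
move=> hp Hh /(cartier_ker p_char y_min y_gen Omega_d C_cartier) hC O HO.
have yp := y_pow y_min.
have coord h' : exists c : 'I_p -> F, h' = \sum_i c i *: y ^+ i.
  by exists (fun i => (rep h')`_i); rewrite -ev_coord.
have [Q [O1 O2]] := point_center HO p_gt1 yp coord.
have vP := ordP1_place Q.
have rescale n g : vge (ordP1 Q) n g ->
    vge (ordP1 Q) (n - at_inf Q 2) (g / der (unifP1 Q)).
  have th0 := place_dert vP; move=> Hn; rewrite -(ord_der_unif Q).
  by apply: (vgeM vP) Hn _; rewrite -(vV vP th0) vge_v.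
have dE' := dE p_char y_min y_gen Omega_d.
rewrite (ev_coord pF y_min y_gen h).
have [[j QE]|nQ] := pole_or_not Q; last first.
  apply: (regular_at_unramified HO p_char yp dE' (DKA p_char y_min y_gen) O1).
    exact: f_nonpole.
  move=> r; have rp := ltn_ord r.
  have : vge (ordP1 Q) (at_inf Q 2) (rep h)`_r.
    have := Hh r Q rp; rewrite mult_out // subr0.
    case: (Q) nQ => [c //|] nQ _.
    apply: infinity_order => // [|r' r'p]; first exact: size_rep.
    by have := Hh r' None r'p; rewrite mult_out // subr0.
  by move=> /rescale; rewrite subrr.
have Qf : ordP1 Q f = - (ord j)%:Z by rewrite QE P_ord.
apply: (regular_at_ramified HO p_char yp dE' (DKM p_char y_min y_gen)
  (DKA p_char y_min y_gen) (DKy p_char y_min y_gen) O1 O2 f_neq0 Qf (pE j)).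
move=> r; have rp := ltn_ord r.
have [rlt|rge] := ltnP r p.-1; last by rewrite hp // mul0r vge0.
apply: vge_le (rescale _ _ (Hh r Q rp)); rewrite QE multP //.
have qlt : (r %/ gam j < ord j)%N.
  have [g0 o0] := gam_ord j; rewrite ltn_divLR // mulnC.
  by rewrite -[(_ * _)%N]/((gam j * ord j).+1.-1) -pE.
rewrite /pbound /pole_bound /isinf.
by case: (P j) => [c|] /=; move: (r %/ gam j)%N (ord j) qlt => q o qlt; lia.
Qed.

(** * The dimension of the kernel *)

Notation R := (p.-1./2).

Definition ibound l j := image_bound p (gam j) (isinf j) l.

Lemma R_le : (R <= p.-1)%N. Proof. by clear; lia. Qed.

Lemma f_frac : exists F0 : {poly k},
  (size F0 <= (deg ord).+1)%N /\ f = F0%:F / (Den P ord)%:F.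
Proof.
have [Q|F0 [sF0 fE]] := @divisor_frac k m P ord f 0.
  by case: Q (f_order Q) => [c|] /=; rewrite sub0r.
exists F0; split=> //; move: sF0; rewrite subr0; move: (deg ord) => o.
by clear; size_lia.
Qed.

(** The exponent that brings the terms of the l-th coefficient to one denominator. *)
Definition compl_bound r l j := (p * ibound l j - (pbound r j + (r - l) * ord j))%N.

(** The common denominator of the terms of the l-th coefficient is a p-th power, so
    that the Cartier operator acts on the numerators alone. *)
Lemma image_numerator (F0 N : {poly k}) r l : (l <= r < R)%N ->
  (size F0 <= (deg ord).+1)%N -> f = F0%:F / (Den P ord)%:F ->
  (size N <= deg (pbound r))%N ->
  N%:F / (Den P (pbound r))%:F * (- f) ^+ (r - l) =
    (N * ((- F0) ^+ (r - l) * Den P (compl_bound r l)))%:F / (Den P (ibound l) ^+ p)%:F /\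
  (size (N * ((- F0) ^+ (r - l) * Den P (compl_bound r l)))%R
    <= deg (ibound l) * p + p.-1)%N.
Proof.
move=> lr sF fE sN; set h := (r - l)%N.
have bound j : (pbound r j + h * ord j <= p * ibound l j + isinf j * p.-1)%N.
  exact: (image_bound_ge p_prime (pE j) (isinf j) lr).
have finbound j : P j != None -> (pbound r j + h * ord j <= p * ibound l j)%N.
  by move=> Pj; have := bound j; rewrite /isinf (negbTE Pj) mul0n addn0.
have DE : Den P (ibound l) ^+ p = Den P (pbound r) * Den P ord ^+ h * Den P (compl_bound r l).
  rewrite -!Den_exp -!DenD; apply: eq_Den => j Pj.
  by rewrite /compl_bound subnKC // finbound.
split.
  have D0 n : (Den P n)%:F != 0 := DenF_neq0 P n.
  rewrite DE fE -mulNr -rmorphN !rmorphM !rmorphXn /=; apply: quot_identity.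
  - exact: D0.
  - exact: D0.
  - exact: D0.
have degs : (fdeg P (pbound r) + h * fdeg P ord + fdeg P (compl_bound r l)
    = p * fdeg P (ibound l))%N.
  rewrite /fdeg !big_distrr -!big_split; apply: eq_bigr => j Pj /=.
  by rewrite /compl_bound subnKC // finbound.
have infs : (mult (pbound r) None + h * mult ord None
    <= p * mult (ibound l) None + p.-1)%N.
  have [[j jE]|nP] := pole_or_not None; last by rewrite !mult_out ?muln0.
  by have := bound j; rewrite /isinf jE !multP // -jE eqxx mul1n.
have s1 := size_polyMleq N ((- F0) ^+ h * Den P (compl_bound r l)).
have s2 := size_polyMleq ((- F0) ^+ h) (Den P (compl_bound r l)).
have s3 : (size ((- F0) ^+ h)%R <= (deg ord * h).+1)%N.
  rewrite (leq_trans (size_poly_exp_leq _ _)) // ltnS leq_mul2r size_polyN.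
  by rewrite -ltnS (leq_trans (leqSpred _)) ?orbT //; case: (size F0) sF.
rewrite (degE P (ibound l)); move: s1 s2 s3 sN degs infs.
rewrite size_Den (degE P ord) (degE P (pbound r)).
move: (fdeg _ _) (fdeg _ _) (fdeg _ _) (fdeg _ _) (mult _ _) (mult _ _) (mult _ _).
clear; move=> a b c e x y z; rewrite !mulnDl ![(_ * h)%N]mulnC ![(_ * p)%N]mulnC.
by size_lia.
Qed.

Notation V := {ffun 'I_p -> {poly k}}.

(** With denominators fixed by the bounds, elements of K become families of
    polynomials, and the dimension count becomes linear algebra over k. *)
Definition of_num (N : V) : K :=
  \sum_(r < p) ((N r)%:F / (Den P (pbound r))%:F) *: y ^+ r.

Lemma rep_of_num (N : V) (r : 'I_p) :
  (rep (of_num N))`_r = (N r)%:F / (Den P (pbound r))%:F.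
Proof.
rewrite /of_num rep_sum coef_sum (bigD1 r) //= rep_mulX // coefZ coefXn eqxx mulr1.
rewrite big1 ?addr0 // => i ir; rewrite rep_mulX // coefZ coefXn.
by case: eqP => [E|]; rewrite ?mulr0 //; case/eqP: ir; apply: val_inj.
Qed.

Lemma of_num_linear (a : k) (N M : V) :
  of_num (a *: N + M) = (cstF k a)%:A * of_num N + of_num M.
Proof.
rewrite /of_num mulr_sumr -big_split; apply: eq_bigr => r _ /=.
rewrite !ffunE -mul_polyC rmorphD rmorphM /= mulrDl scalerDl; congr (_ + _).
by rewrite mulr_algl scalerA mulrA.
Qed.

Lemma of_num0 : of_num 0 = 0.
Proof. by rewrite /of_num big1 // => r _; rewrite ffunE tofrac0 mul0r scale0r. Qed.

Lemma of_num_eq0 (N : V) : of_num N = 0 -> N = 0.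
Proof.
move=> N0; apply/ffunP => r; rewrite ffunE; have := rep_of_num N r.
rewrite N0 rep0 coef0 => /esym/eqP; rewrite mulf_eq0 invr_eq0 (negbTE (DenF_neq0 _ _)) orbF.
by rewrite tofrac_eq0 => /eqP.
Qed.

Definition ker_num (N : V) : Prop :=
  (forall r : 'I_p, (size (N r) <= deg (pbound r))%N) /\ C (of_num N *: dx) = 0.

Lemma ker_num_linear (N M : V) (a : k) : ker_num N -> ker_num M -> ker_num (a *: N + M).
Proof.
move=> [sN CN] [sM CM]; split=> [r|].
  rewrite !ffunE (leq_trans (size_polyD _ _)) // geq_max sM andbT.
  by rewrite (leq_trans (size_scale_leq _ _)).
rewrite of_num_linear scalerDl -scalerA.
apply: (cartier_ker_add C_cartier) CM.
exact: (cartier_ker_scale p_char C_cartier).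
Qed.

(** They cut out the coordinates with poles bounded by lbound: a numerator must be
    divisible by sep_poly, for the finite poles, and the quotient must have a
    small degree, for infinity. *)
Definition sep_poly r := Den P (fun j => pbound r j - lbound r j)%N.

Definition sep_form (r : 'I_p) (i : nat) (N : V) : k :=
  let e := fdeg P (fun j => pbound r j - lbound r j)%N in
  if (i < e)%N then (N r %% sep_poly r)`_i
  else (N r %/ sep_poly r)`_(deg (lbound r) + (i - e)).

Lemma sep_form_linear r i : linear (sep_form r i : V -> k^o).
Proof.
move=> a N M; rewrite /sep_form !ffunE modpD modpZl divpD divpZl !coefD !coefZ.
by case: ifP.
Qed.

Lemma lbound_le r j : (lbound r j <= pbound r j)%N.
Proof. exact: geq_minl. Qed.

(** This is low_kernel_zero, in terms of numerators. *)
Lemma sep_form_inj (N : V) : ker_num N ->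
  (forall (r : 'I_p) i, (i < deg (pbound r) - deg (lbound r))%N -> sep_form r i N = 0) ->
  N = 0.
Proof.
move=> [sN /(cartier_ker p_char y_min y_gen Omega_d C_cartier) CN] H.
apply: of_num_eq0; rewrite -(evK pF y_min y_gen (of_num N)).
suff -> : rep (of_num N) = 0 by rewrite rmorph0.
apply: low_kernel_zero CN; first exact: size_rep.
move=> r Q rp; rewrite (rep_of_num N (Ordinal rp)) /=; set s := Ordinal rp.
pose dif j := (pbound r j - lbound r j)%N.
have difE j : (lbound r j + dif j = pbound r j)%N by rewrite subnKC // lbound_le.
have degD : deg (pbound r) = (deg (lbound r) + deg dif)%N.
  by rewrite /deg -big_split; apply: eq_bigr => j _.
have DD : Den P (pbound r) = Den P (lbound r) * sep_poly s.
  by rewrite -DenD; apply: eq_Den => j _.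
have Hs i : (i < deg dif)%N -> sep_form s i N = 0.
  by move=> idif; apply: H; rewrite /= degD addKn.
have sQ : size (sep_poly s) = (fdeg P dif).+1 by rewrite size_Den.
have Q0 : sep_poly s != 0 := Den_neq0 _ _.
have mod0 : N s %% sep_poly s = 0.
  apply/polyP => i; rewrite coef0; have [ilt|ige] := ltnP i (fdeg P dif).
    have : (i < deg dif)%N by rewrite (degE P) ltn_addl.
    by move=> /Hs; rewrite /sep_form -/dif /= ilt.
  by rewrite nth_default // -ltnS (leq_trans (n := size (sep_poly s))) ?ltn_modp // sQ.
have NE : N s = N s %/ sep_poly s * sep_poly s.
  by rewrite [LHS](divp_eq _ (sep_poly s)) mod0 addr0.
have sM : (size (N s %/ sep_poly s)%R <= deg (lbound r))%N.
  apply/leq_sizeP => i ri.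
  have [ilt|ige] := ltnP i (deg (lbound r) + mult dif None); last first.
    apply: nth_default; rewrite size_divp // sQ /= (leq_trans _ ige) // leq_subLR.
    by rewrite (leq_trans (sN s)) //= degD (degE P dif) addnA addnC.
  have := Hs (i - deg (lbound r) + fdeg P dif)%N; rewrite /sep_form -/dif /=.
  rewrite [(_ + fdeg P dif < fdeg P dif)%N]ltnNge leq_addl /= addnK subnKC // => -> //.
  by rewrite (degE P dif) ltn_add2r ltn_subLR.
have -> : (N s)%:F / (Den P (pbound r))%:F
    = (N s %/ sep_poly s)%:F / (Den P (lbound r))%:F.
  rewrite [in LHS]NE DD; apply/eqP; rewrite eq_frac ?mulf_neq0 ?Den_neq0 //.
  by rewrite mulrAC mulrA.
exact: divisor_ge.
Qed.

(** The coefficients that the Cartier operator extracts from the numerator of the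
    l-th coefficient; here F0 is the numerator of f. *)
Definition num_coef (F0 : {poly k}) (l i : nat) (N : V) : k :=
  (\sum_(r < p) (N r * ((- F0) ^+ (r - l) * Den P (compl_bound r l))) *+ 'C(r, l))`_(i * p + p.-1).

Lemma num_coef_linear F0 l i : linear (num_coef F0 l i : V -> k^o).
Proof.
move=> a N M; rewrite -[RHS]/(a * num_coef F0 l i N + num_coef F0 l i M).
rewrite /num_coef -coefZ -coefD scaler_sumr -big_split /=.
apply: (congr1 (fun q : {poly k} => q`_(i * p + p.-1))); apply: eq_bigr => r _.
by rewrite !ffunE mulrDl mulrnDl -scalerAl scalerMnr.
Qed.

(** The conditions are finite in number because image_numerator bounds the degrees
    of the numerators. *)
Lemma num_coef_ker (F0 : {poly k}) (N : V) :
  (size F0 <= (deg ord).+1)%N -> f = F0%:F / (Den P ord)%:F ->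
  (forall r : 'I_p, (size (N r) <= deg (pbound r))%N) ->
  (forall r : 'I_p, (R <= r)%N -> N r = 0) ->
  (forall l i, (l < R)%N -> (i < deg (ibound l))%N -> num_coef F0 l i N = 0) ->
  C (of_num N *: dx) = 0.
Proof.
move=> sF fE sN NR H; apply/(cartier_ker p_char y_min y_gen Omega_d C_cartier) => l lp.
pose T := \sum_(r < p) (N r * ((- F0) ^+ (r - l) * Den P (compl_bound r l))) *+ 'C(r, l).
have size_term (r : 'I_p) : (l < R)%N ->
    (size (N r * ((- F0) ^+ (r - l) * Den P (compl_bound r l)) *+ 'C(r, l))%R
      <= deg (ibound l) * p + p.-1)%N.
  move=> lR; have [lr|rl] := leqP l r; last by rewrite bin_small // size_poly0.
  have [rR|Rr] := ltnP r R; last by rewrite NR // mul0r mul0rn size_poly0.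
  rewrite -scaler_nat (leq_trans (size_scale_leq _ _)) //.
  have lrR : (l <= r < R)%N by rewrite lr.
  by have [_ ->] := image_numerator lrR sF fE (sN r).
have AE : Acoef (rep (of_num N)) l = if (l < R)%N then T%:F / (Den P (ibound l) ^+ p)%:F else 0.
  rewrite /Acoef; case: ifP => lR.
    rewrite /T rmorph_sum mulr_suml; apply: eq_bigr => r _.
    rewrite rep_of_num rmorphMn /= mulrnAr mulrnAl.
    have [lr|rl] := leqP l r; last by rewrite bin_small.
    have [rR|Rr] := ltnP r R; last by rewrite NR // !(mul0r, tofrac0, mul0rn).
    have lrR : (l <= r < R)%N by rewrite lr.
    by have [-> _] := image_numerator lrR sF fE (sN r).
  rewrite big1 // => r _; rewrite rep_of_num.
  have [lr|rl] := leqP l r; last by rewrite bin_small // mulr0.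
  by rewrite NR ?rmorph0 ?mul0r // (leq_trans _ lr) // leqNgt lR.
rewrite AE; case: ifP => lR; last first.
  rewrite /exactF -(C0 C_cartier); congr C; by rewrite !scale0r.
apply: (exactF_powp p_char Omega_d C_cartier); first exact: Den_neq0.
move=> i; have [/(H l i lR)//|ige] := ltnP i (deg (ibound l)).
apply: nth_default; apply: leq_trans (_ : _ <= deg (ibound l) * p + p.-1)%N _.
  by apply: (big_ind (fun q : {poly k} => size q <= deg (ibound l) * p + p.-1)%N)
    => [|q1 q2 s1 s2|r _]; rewrite ?size_poly0 //;
    [rewrite (leq_trans (size_polyD _ _)) // geq_max s1 | apply: size_term].
by rewrite leq_add2r leq_mul2r ige orbT.
Qed.

Definition kernel_dim : nat := \sum_j kernel_count p (ord j) (gam j).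

Lemma card_tagged_ord (n : nat) (b : 'I_n -> nat) :
  #|{: {r : 'I_n & 'I_(b r)}}| = (\sum_r b r)%N.
Proof.
rewrite card_tagged sumnE big_map big_enum /=.
by apply: eq_bigr => r _; rewrite card_ord.
Qed.

Lemma card_sep : (\sum_(r < p) (deg (pbound r) - deg (lbound r)))%N = kernel_dim.
Proof.
rewrite /kernel_dim /kernel_count exchange_big; apply: eq_bigr => r _ /=.
rewrite /deg -sumnB => [|j _]; last exact: lbound_le.
by apply: eq_bigr => j _; apply: (bound_diff p_prime (pE j)).
Qed.

Lemma card_conditions :
  (kernel_dim + \sum_(l < R) deg (ibound l) <= \sum_(r < R) deg (pbound r))%N.
Proof.
have ex n (b : nat -> 'I_m.+1 -> nat) :
    (\sum_(r < n) deg (b r) = \sum_j \sum_(r < n) b r j)%N by exact: exchange_big.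
rewrite !ex /kernel_dim -big_split.
by apply: leq_sum => j _; apply: (kernel_count_le p_prime (pE j)).
Qed.

(** The forms in the span of monomials of degree less than R in y provide enough
    elements of the kernel, and low_kernel_zero shows that there are no more. *)
Lemma a_number : is_a_number d C kernel_dim.
Proof.
have [F0 [sF fE]] := f_frac.
pose I := {r : 'I_p & 'I_(deg (pbound r) - deg (lbound r))}.
pose J := {r : 'I_R & 'I_(deg (pbound r))}.
pose L := {l : 'I_R & 'I_(deg (ibound l))}.
pose e (j : J) : V := [ffun r : 'I_p => if val r == val (projT1 j) then 'X^(val (projT2 j)) else 0].
have eE (c : J -> k) (r : 'I_p) (i : nat) : ((\sum_j c j *: e j) r)`_i
    = \sum_(j | (val r == val (projT1 j)) && (i == val (projT2 j))) c j.
  rewrite sum_ffunE coef_sum [RHS]big_mkcond; apply: eq_bigr => j _.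
  rewrite !ffunE; case: eqP => _; last by rewrite scaler0 coef0.
  by rewrite coefZ coefXn; case: eqP => _; rewrite ?mulr1 ?mulr0.
have [||||c|c||b [b_ker b_free b_span]] := @squeeze_dim k V I J L
  (fun i : I => sep_form (projT1 i) (val (projT2 i))) e
  (fun l : L => num_coef F0 (val (projT1 l)) (val (projT2 l))) ker_num.
- by move=> i; apply: sep_form_linear.
- by move=> l; apply: num_coef_linear.
- by move=> N M a; apply: ker_num_linear.
- move=> N kN H; apply: (sep_form_inj kN) => r i ir.
  exact: (H (existT _ r (Ordinal ir) : I)).
- move=> v H; have vs r : (size (v r) <= deg (pbound r))%N.
    apply/leq_sizeP => i ri; rewrite eE big1 // => j /andP[/eqP rj /eqP ij].
    by move: ri; rewrite rj ij leqNgt ltn_ord.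
  split=> //; apply: (num_coef_ker sF fE vs).
    move=> r Rr; apply/polyP => i; rewrite eE coef0 big1 // => j /andP[/eqP rj _].
    by move: Rr; rewrite rj leqNgt ltn_ord.
  move=> l i lR il.
  exact: (H (existT _ (Ordinal lR) (Ordinal il) : L)).
- move=> c0 j0; have rp : (projT1 j0 < p)%N.
    by apply: leq_trans (ltn_ord (projT1 j0)) _; apply: leq_trans R_le (leq_pred p).
  have := eE c (Ordinal rp) (val (projT2 j0)); rewrite c0 ffunE coef0.
  rewrite (bigD1 j0) /= ?eqxx // big1 ?addr0 // => j /andP[/andP[/eqP rj /eqP ij]].
  case/eqP; apply/esym; case: j0 rj ij {rp} => r0 i0 /= ; case: j => r1 i1 /=.
  by move=> /val_inj rr; case: _ / rr i1 => i1 /val_inj ->.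
- by rewrite !card_tagged_ord card_sep card_conditions.
have cardI : #|{: I}| = kernel_dim by rewrite card_tagged_ord card_sep.
rewrite -cardI; exists (fun i => of_num (b i) *: dx).
have combine (c : 'I_#|{: I}| -> k) :
    \sum_i cst K (c i) *: (of_num (b i) *: dx) = of_num (\sum_i c i *: b i) *: dx.
  elim/big_rec2: _ => [|i u w _ ->].
    by rewrite (_ : of_num 0 = 0) ?scale0r //; apply: of_num0.
  by rewrite of_num_linear scalerDl scalerA.
split=> [w|c]; last first.
  rewrite combine => /(dx_free p_char y_min y_gen Omega_d)/of_num_eq0.
  exact: b_free.
split=> [[w_reg Cw]|[c ->]]; last first.
  rewrite combine; have [c' [-> nu0]] := b_ker c.
  set v := \sum_j _ in nu0 *.
  have vs r : (size (v r) <= deg (pbound r))%N.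
    apply/leq_sizeP => i ri; rewrite eE big1 // => j /andP[/eqP rj /eqP ij].
    by move: ri; rewrite rj ij leqNgt ltn_ord.
  have vR (r : 'I_p) : (R <= r)%N -> v r = 0.
    move=> Rr; apply/polyP => i; rewrite eE coef0 big1 // => j /andP[/eqP rj _].
    by move: Rr; rewrite rj leqNgt ltn_ord.
  have Cv : C (of_num v *: dx) = 0.
    apply: (num_coef_ker sF fE vs vR) => l i lR il.
    exact: (nu0 (existT _ (Ordinal lR) (Ordinal il) : L)).
  split=> //; apply: bound_regular Cv => [r rp|r Q rp].
    have [rlt|rge] := ltnP r p; last by rewrite nth_default // (leq_trans (size_rep _ _ _ _)).
    by rewrite (rep_of_num v (Ordinal rlt)) vR /= ?tofrac0 ?mul0r // (leq_trans R_le).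
  by rewrite (rep_of_num v (Ordinal rp)); apply: divisor_ge; apply: vs.
have [h wE] := Omega_dx p_char y_min y_gen Omega_d w; rewrite wE in w_reg Cw *.
have num (r : 'I_p) : exists N : {poly k}, (size N <= deg (pbound r))%N /\
    (rep h)`_r = N%:F / (Den P (pbound r))%:F.
  have [Q|N [sN hE]] := @divisor_frac k m P (pbound r) (rep h)`_r 1.
    exact: regular_coord.
  exists N; split=> //; move: sN; rewrite addrK; move: (deg _) => D0.
  by clear; size_lia.
have [N /all_and2[sN hE]] := fin_all_exists num.
have hN : h = of_num [ffun r => N r].
  rewrite [LHS](ev_coord pF y_min y_gen h) /of_num.
  by apply: eq_bigr => r _; rewrite ffunE -hE.
have [|c cE] := b_span [ffun r => N r].
  by split=> [r|]; rewrite ?ffunE // -hN.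
by exists c; rewrite combine -cE -hN.
Qed.

End ArtinSchreierCurve.

Theorem theorem1p1 (k : closedFieldType) (p : nat) (p_char : p \in [pchar k])
  (f : ratfun k) (f_nonconst : forall c : k, f <> cst_ratfun c)
  (K : fieldExtType (ratfun k)) (y : K) (K_AS : is_artin_schreier p f y)
  (Omega : lmodType K) (d : K -> Omega) (Omega_d : is_kaehler d)
  (C : Omega -> Omega) (C_cartier : is_cartier d p C)
  (m : nat) (P : 'I_m.+1 -> option k) (P_inj : injective P)
  (P_poles : forall Q : option k, ordP1 Q f < 0 <-> exists j, Q = P j)
  (ord : 'I_m.+1 -> nat) (P_ord : forall j, ordP1 (P j) f = - (ord j)%:Z)
  (p_mod_L : p = 1%N %[mod \big[lcmn/1%N]_(j < m.+1) ord j]) :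
  exists a : nat,
    is_a_number d C a /\ a%:R = \sum_(j < m.+1) a_term p (ord j).
Proof.
have p_prime := pcharf_prime p_char.
have f_neq0 : f != 0.
  by apply/eqP => f0; case: (f_nonconst 0); rewrite f0 /cst_ratfun polyC0 tofrac0.
have [y_min y_gen] := K_AS.
have pE j : p = ((p.-1 %/ ord j) * ord j).+1.
  have dvd : (ord j %| p.-1)%N.
    apply: (@dvdn_trans (\big[lcmn/1%N]_(j < m.+1) ord j)).
      exact: (biglcmn_sup j).
    by rewrite -subn1 -eqn_mod_dvd ?prime_gt0 //; apply/eqP.
  by rewrite divnK // prednK // prime_gt0.
have poles Q : ordP1 Q f < 0 -> exists j, Q = P j by move/P_poles.
exists (kernel_dim p ord (fun j => p.-1 %/ ord j)%N); split.
  exact: (a_number p_char f_neq0 y_min y_gen Omega_d C_cartier P_inj poles P_ord pE).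
rewrite /kernel_dim natr_sum; apply: eq_bigr => j _.
exact: a_termE p_prime (pE j).
Qed.
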